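(* (Spectral Theorem for unbounded self-adjoint operators) Let $a:H\supset D(a)\to H$ be a self-adjoint linear operator in a Hilbert space $H\neq\{0\}$, defined on a dense subspace $D(a)$ of $H$. There exists a unique resolution of identity $P$ on $\mathrm{sp}(a)$, acting on $H$, such that $$a=\int_{\mathrm{sp}(a)}\mathrm{id}_{\mathrm{sp}(a)}\,dP\quad\text{(pointwise)}.$$ Moreover $\{a\}'=P'$, and the support of $P$ is all of $\mathrm{sp}(a)$.
   Context: Hilbert spaces are complex. Self-adjoint means $a=a^*$ (including equality of domains). The spectrum $\mathrm{sp}(a)$ is the complement in $\mathbb{C}$ of the set of regular values, where $\lambda$ is a regular value if $\lambda 1-a$ is injective, surjective onto $H$, and has bounded inverse. It is a non-empty closed subset of $\mathbb{R}$. $\mathrm{id}_{\mathrm{sp}(a)}$ is the function $\lambda\mapsto\lambda$ on $\mathrm{sp}(a)$. A spectral measure $P$ defined on a $\sigma$-algebra $\mathcal{E}$ on a set $\Omega\ne\varnothing$ and acting on $H$ is a map $P:\mathcal{E}\to B(H)$ such that each $P(\omega)$ is an orthogonal projection, $P(\Omega)=1$, and $\omega\mapsto\langle P(\omega)x,x\rangle$ is a measure for every $x\in H$. A resolution of identity on a locally compact Hausdorff space $\Omega\neq\varnothing$ is a spectral measure on the Borel $\sigma$-algebra of $\Omega$ such that all measures $\langle Px,x\rangle$ are inner regular ($\mu(\omega)=\sup\{\mu(K):K\subset\omega\text{ compact}\}$). Its support is $\Omega\setminus\omega$, where $\omega$ is the largest open set with $P(\omega)=0$. For a bounded measurable complex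 function $h$, $\pi_P(h)\in B(H)$ is the operator with $\langle\pi_P(h)x,x\rangle=\int h\,d\langle Px,x\rangle$ for all $x\in H$. For a measurable complex function $f$ put $\mathcal{D}_f=\{x\in H: f\in\mathscr{L}^2(\langle Px,x\rangle)\}$. For a linear operator $a$ in $H$ with domain $D(a)$, $a=\int f\,dP$ (pointwise) means that $D(a)=\mathcal{D}_f$ and that for all $x\in\mathcal{D}_f$ and all bounded measurable complex $h$ one has $\|(a-\pi_P(h))x\|=\bigl(\int|f-h|^2\,d\langle Px,x\rangle\bigr)^{1/2}$. $\{a\}'$ is the set of bounded linear operators $c$ on $H$ such that $D(a)$ is invariant under $c$ and $cax=acx$ for all $x\in D(a)$. $P'$ is the set of operators in $B(H)$ commuting with all $P(\omega)$. *)

(* Defs.v *)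
From HB Require Import structures.
From mathcomp Require Import all_boot all_order all_algebra.
From mathcomp Require Import sesquilinear complex.
From mathcomp Require Import all_classical all_reals all_analysis.

Set Implicit Arguments.
Unset Strict Implicit.
Unset Printing Implicit Defensive.

Import Order.TTheory GRing.Theory Num.Theory.
Import ComplexField.Normc.
Import numFieldNormedType.Exports.

Local Open Scope classical_set_scope.
Local Open Scope ring_scope.
Local Open Scope complex_scope.

(* The libraries put no topology on [R[i]]; it receives the one every
   numFieldType gets from its norm. *)
HB.instance Definition _ (R : realType) := NormedModule.copy R[i] R[i]^o.

(* [measurableType]s are pointed, so a nonempty space has to come with a point
   to carry its Borel sigma-algebra. *)
Definition pointed_at (X : topologicalType) (x0 : X) : Type := X.
HB.instance Definition _ (X : topologicalType) (x0 : X) :=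
  Topological.copy (pointed_at x0) X.
HB.instance Definition _ (X : topologicalType) (x0 : X) :=
  isPointed.Build (pointed_at x0) x0.

Notation borel X := (g_sigma_algebraType (@open X)).

Section ComplexFunctions.
Context {R : realType} d {T : measurableType d}.
Implicit Types (mu : set T -> \bar R) (f h : T -> R[i]).

Definition cmeasurable f := measurable_fun [set: T] (f : T -> borel R[i]).

Definition cbounded f := exists M : R, forall t, normc (f t) <= M.

Definition cintegral mu h : R[i] :=
  fine (\int[mu]_t (complex.Re (h t))%:E)%E
    +i* fine (\int[mu]_t (complex.Im (h t))%:E)%E.

Definition sq_integral mu f : \bar R := (\int[mu]_t (normc (f t) ^+ 2)%:E)%E.

Definition L2 mu f := cmeasurable f /\ (sq_integral mu f < +oo)%E.

End ComplexFunctions.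

Section Operators.
Context {R : realType} {H : completeNormedModType R[i]}.
Variable ip : {dot H for Num.conj}.

Definition bounded_operator (b : H -> H) :=
  linear b /\ exists M : R, forall x, `|b x| <= M%:C * `|x|.

Definition orthogonal_projection (p : H -> H) :=
  [/\ bounded_operator p, p \o p = p & forall x y, ip (p x) y = ip x (p y)].

(* A partially defined map; the values of [app] off [dom] are irrelevant. *)
Record operator := Operator { dom : set H; app :> H -> H }.

Definition linear_operator (a : operator) :=
  dom a 0 /\
  forall (k : R[i]) x y, dom a x -> dom a y ->
    dom a (k *: x + y) /\ a (k *: x + y) = k *: a x + a y.

(* Meaningful for densely defined [a]: the vector z is then unique. *)
Definition adjoint (a : operator) : operator :=
  let adj y := [set z | forall x, dom a x -> ip (a x) y = ip x z] in
  Operator [set y | adj y !=set0] (fun y => xget 0 (adj y)).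

Definition self_adjoint (a : operator) :=
  dom (adjoint a) = dom a /\ forall x, dom a x -> adjoint a x = a x.

(* The last clause is boundedness of the inverse of [b], written at [b x]. *)
Definition regular_value (a : operator) (l : R[i]) :=
  let b x := l *: x - a x in
  [/\ set_inj (dom a) b, set_surj (dom a) [set: H] b
    & exists M : R, forall x, dom a x -> `|x| <= M%:C * `|b x|].

Definition spectrum (a : operator) : set R[i] := ~` regular_value a.

Definition op_commutant (a : operator) : set (H -> H) :=
  [set c | bounded_operator c /\
           forall x, dom a x -> dom a (c x) /\ c (a x) = a (c x)].

End Operators.
Arguments operator {R} H.

Section SpectralMeasures.
Context {R : realType} {H : completeNormedModType R[i]}.
Variable ip : {dot H for Num.conj}.

Section Measurable.
Context d {T : measurableType d}.
Implicit Types (P : set T -> H -> H) (f h : T -> R[i]).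

(* For an orthogonal projection P w, the number <P(w)x, x> is real. *)
Definition diag P (x : H) : set T -> \bar R :=
  fun w => (complex.Re (ip (P w x) x))%:E.

(* Only the values of P on measurable sets are meaningful, whereas a
   {measure set T -> \bar R} is constrained on all sets. *)
Definition spectral_measure P :=
  [/\ forall w, measurable w -> orthogonal_projection ip (P w),
      P [set: T] = id
    & forall x, exists mu : {measure set T -> \bar R},
        forall w, measurable w -> mu w = diag P x w].

Definition is_bounded_integral P h (b : H -> H) :=
  bounded_operator b /\ forall x, ip (b x) x = cintegral (diag P x) h.

(* The operator is unique when it exists; it exists for every spectral measure
   [P] and every bounded measurable [h]. *)
Definition pi_op P h : H -> H :=
  xget (fun=> 0) [set b | is_bounded_integral P h b].

Definition integral_dom P f : set H := [set x | L2 (diag P x) f].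

Definition pointwise_integral (a : operator H) P f :=
  dom a = integral_dom P f /\
  forall x, integral_dom P f x ->
  forall h, cmeasurable h -> cbounded h ->
    `|a x - pi_op P h x| =
      (Num.sqrt (fine (sq_integral (diag P x) (fun t => f t - h t))))%:C.

Definition measure_commutant P : set (H -> H) :=
  [set b | bounded_operator b /\
           forall w, measurable w -> b \o P w = P w \o b].

End Measurable.

Section Topological.
Variable X : ptopologicalType.
Implicit Type P : set (borel X) -> H -> H.

Definition inner_regular (mu : set (borel X) -> \bar R) :=
  forall w, measurable w ->
    mu w = ereal_sup [set mu K | K in
                        [set K : set X | compact K /\ K `<=` w]].

Definition resolution_of_identity P :=
  [/\ hausdorff_space X, locally_compact [set: X], spectral_measure P
    & forall x, inner_regular (diag P x)].

Definition is_support P (S : set X) :=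
  exists w : set X,
    [/\ open w, P w = (fun=> 0),
        forall u : set X, open u -> P u = (fun=> 0) -> u `<=` w
      & S = ~` w].

End Topological.

End SpectralMeasures.

(* Main.v *)
Require Import Defs.
From HB Require Import structures.
From mathcomp Require Import all_boot all_order all_algebra.
From mathcomp Require Import sesquilinear complex.
From mathcomp Require Import all_classical all_reals all_analysis.
From mathcomp Require Import ring lra zify.
From mathcomp Require Import measurable_realfun.

(** A self-adjoint operator a is encoded by the bounded operators
    J = (a - i)^-1 and J' = (a + i)^-1, which are adjoint to each other. For a
    real t the operator T = J' (a - t) J is bounded and symmetric, and
    <T x, x> = <(a - t) v, v> where v = J x runs over the domain of a.
    A bounded symmetric T has a negative projection, the orthogonal projection
    onto the kernel of |T| + T, which commutes with all that commutes with T
    ([sign_projection]). Hence for every t there is a projection E t that reduces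
    a, lies in the bicommutant of a, and separates the vectors on which the form
    of a is at most t from those on which it exceeds t ([cut_ex]). These
    properties determine E t ([family_uniq]), and they make E an increasing,
    right-continuous family that tends to 0 and to 1 at the two ends.

    For each x the function |E t x|^2 is the distribution function of a finite
    measure mu_x on the line. The Borel sets B whose measures mu_x B are given by
    the quadratic form of a projection form a Dynkin system that contains the
    half-lines, so every Borel set has its projection
    ([projection_valued_measure]). Near a real regular value of a the family E is
    constant ([family_const_near_regular]), because a lies close to a scalar on
    the range of E t - E s when t - s is small ([family_window]). Therefore mu_x
    lives on the spectrum and the projections can be carried over to sp(a) along
    a left inverse of its inclusion into the line. If the spectrum were empty, all
    measures mu_x would vanish.

    Unbounded integrals are avoided by passing to J: for a spectral measure P and
    its bounded functional calculus, a = int l dP is equivalent to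
    J = int (l - i)^-1 dP ([pointwise_of_resolvent], [resolvent_of_pointwise]).
    For the projections built from E the latter holds since the difference of the
    two sides is at most t - s times the identity on the range of E t - E s: cutting
    ]s, t] into 2^k pieces and adding squared norms makes it 0
    ([resolvent_of_family]).

    Conversely, if J = int (l - i)^-1 dQ then the projection of {l <= t} under Q
    has the properties that characterise E t ([cut_of_resolvent]); as half-lines
    generate the Borel sets, Q = P. The commutants agree because commuting with a
    amounts to commuting with J. If an open set u of the spectrum had P u = 0, then
    |(a - t) x| >= e |x| for a point t of u and some e > 0, so t would be a regular
    value; this gives the support. Inner regularity holds because
    finite Borel measures on the line are inner regular. *)

Set Implicit Arguments.
Unset Strict Implicit.
Unset Printing Implicit Defensive.

Import Order.TTheory GRing.Theory Num.Theory.
Import numFieldNormedType.Exports.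

Local Open Scope classical_set_scope.
Local Open Scope ring_scope.

(** * The underlying real normed space *)

Section RealNorm.
Context {R : realType} {H : completeNormedModType R[i]}.
Implicit Types (x y : H) (k : R[i]) (f g : H -> H) (u v : nat -> H).

(** The norm of H takes values in R[i]; estimates and limits are done in R. *)
Definition nrm x : R := complex.Re `|x|.

Lemma nrmE x : `|x| = (nrm x)%:C%C.
Proof.
have : 0 <= `|x| := normr_ge0 x.
by rewrite /nrm; case: (`|x|) => c d; rewrite lecE /= => /andP[/eqP-> _].
Qed.

Lemma normcE k : `|k| = (ComplexField.Normc.normc k)%:C%C.
Proof. by []. Qed.

Lemma nrm_ge0 x : 0 <= nrm x.
Proof. by rewrite -ler0c -nrmE. Qed.

Lemma nrm_eq0 x : nrm x = 0 -> x = 0.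
Proof. by move=> h; apply/normr0_eq0; rewrite nrmE h. Qed.

Lemma nrm0 : nrm 0 = 0. Proof. by rewrite /nrm normr0. Qed.

Lemma nrmD x y : nrm (x + y) <= nrm x + nrm y.
Proof. by rewrite -lecR rmorphD /= -!nrmE ler_normD. Qed.

Lemma nrmN x : nrm (- x) = nrm x.
Proof. by rewrite /nrm normrN. Qed.

Lemma nrmB x y : nrm (x - y) <= nrm x + nrm y.
Proof. by rewrite -(nrmN y) nrmD. Qed.

Lemma nrmBC x y : nrm (x - y) = nrm (y - x).
Proof. by rewrite -nrmN opprB. Qed.

Lemma nrmZ k x : nrm (k *: x) = ComplexField.Normc.normc k * nrm x.
Proof. by rewrite {1}/nrm normrZ (nrmE x) normcE -rmorphM. Qed.

Lemma nrmZR (r : R) x : nrm (r%:C%C *: x) = `|r| * nrm x.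
Proof. by rewrite nrmZ /= expr0n /= addr0 sqrtr_sqr. Qed.

Lemma bounded_opP f : bounded_operator f <->
  linear f /\ exists2 M : R, 0 <= M & forall x, nrm (f x) <= M * nrm x.
Proof.
split=> [[lf [M Mf]]|[lf [M M0 Mf]]]; split=> //.
- exists (Num.max M 0); first by rewrite le_max lexx orbT.
  move=> x; have : (nrm (f x) <= M * nrm x).
    by rewrite -lecR rmorphM /= -!nrmE.
  move=> h; apply: (le_trans h); apply: ler_wpM2r; first exact: nrm_ge0.
  by rewrite le_max lexx.
- exists M => x; rewrite !nrmE -rmorphM lecR; exact: Mf.
Qed.

Section Linear.
Variable f : H -> H.
Hypothesis lf : linear f.
Lemma lin0 : f 0 = 0.
Proof.
have := lf 1 0 0; rewrite !scale1r addr0 => /esym/(canRL (addrK _)); by rewrite subrr => ->.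
Qed.
(** The operators below are plain functions that come with a proof of linearity,
    not bundled morphisms. *)
Lemma linD x y : f (x + y) = f x + f y.
Proof. by rewrite -[x]scale1r lf !scale1r. Qed.
Lemma linZ k x : f (k *: x) = k *: f x.
Proof. by rewrite -[k *: x]addr0 lf lin0 !addr0. Qed.
Lemma linN x : f (- x) = - f x.
Proof. by rewrite -scaleN1r linZ scaleN1r. Qed.
Lemma linB x y : f (x - y) = f x - f y.
Proof. by rewrite linD linN. Qed.
End Linear.

Lemma bop_id : bounded_operator (@id H).
Proof. by apply/bounded_opP; split=> //; exists 1 => // x; rewrite mul1r. Qed.

Lemma bop_comp f g : bounded_operator f -> bounded_operator g ->
  bounded_operator (fun x => f (g x)).
Proof.
move=> /bounded_opP[lf [M M0 Mf]] /bounded_opP[lg [N N0 Ng]].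
apply/bounded_opP; split; first by move=> k x y; rewrite lg lf.
exists (M * N); first by rewrite mulr_ge0.
move=> x; apply: le_trans (Mf _) _.
by rewrite -mulrA ler_wpM2l.
Qed.

Lemma bop_lin k f g : bounded_operator f -> bounded_operator g ->
  bounded_operator (fun x => f x + k *: g x).
Proof.
move=> /bounded_opP[lf [M M0 Mf]] /bounded_opP[lg [N N0 Ng]].
apply/bounded_opP; split.
  move=> c x y; rewrite lg lf !scalerDr !scalerA addrACA.
  by rewrite (mulrC k c).
exists (M + ComplexField.Normc.normc k * N).
  by rewrite addr_ge0// mulr_ge0// -ler0c -normcE.
move=> x; apply: le_trans (nrmD _ _) _.
rewrite mulrDl lerD// nrmZ -mulrA ler_wpM2l//.
by rewrite -ler0c -normcE.
Qed.

Lemma bop_sub f g : bounded_operator f -> bounded_operator g ->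
  bounded_operator (fun x => f x - g x).
Proof.
move=> bf bg; have := bop_lin (-1) bf bg.
by congr bounded_operator; apply/funext => x; rewrite scaleN1r.
Qed.

(** Norm convergence expressed by real sequences, which spares the use of the
    topology that H gets from the field R[i]. *)
Definition cvgH u x := (fun n => nrm (u n - x)) @ \oo --> (0 : R).

Lemma cvgHP u x : cvgH u x <->
  forall e : R, 0 < e -> exists N, forall n, (N <= n)%N -> nrm (u n - x) < e.
Proof.
split=> [/cvgrPdist_lt h e e0|h].
  have [N _ hN] := h e e0; exists N => n Nn.
  by have := hN n Nn; rewrite sub0r normrN ger0_norm ?nrm_ge0.
apply/cvgrPdist_lt => e e0; have [N hN] := h e e0.
by exists N => // n Nn; rewrite sub0r normrN ger0_norm ?nrm_ge0// hN.
Qed.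

Lemma cvgH_le u x (w : nat -> R) : w @ \oo --> (0 : R) ->
  (forall n, nrm (u n - x) <= w n) -> cvgH u x.
Proof.
move=> w0 h; apply: (@squeeze_cvgr _ _ _ _ (fun=> 0) w) => //.
- by apply: nearW => n; rewrite nrm_ge0 h.
- exact: cvg_cst.
Qed.

Lemma cvgH_cst x : cvgH (fun=> x) x.
Proof. by rewrite /cvgH subrr nrm0; exact: cvg_cst. Qed.

Lemma cvgHD u v x y : cvgH u x -> cvgH v y -> cvgH (fun n => u n + v n) (x + y).
Proof.
move=> ux vy; apply: (@cvgH_le _ _ (fun n => nrm (u n - x) + nrm (v n - y))).
  by rewrite -[X in _ --> X]addr0; exact: cvgD.
by move=> n; rewrite opprD addrACA nrmD.
Qed.

Lemma cvgH_op f u x : bounded_operator f -> cvgH u x ->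
  cvgH (fun n => f (u n)) (f x).
Proof.
move=> /bounded_opP[lf [M M0 Mf]] ux.
apply: (@cvgH_le _ _ (fun n => M * nrm (u n - x))).
  by rewrite -[X in _ --> X](mulr0 M); apply: cvgM => //; exact: cvg_cst.
by move=> n; rewrite -(linB lf).
Qed.

Lemma cvgHZ k u x : cvgH u x -> cvgH (fun n => k *: u n) (k *: x).
Proof.
apply: (@cvgH_op (fun x => k *: x)); apply/bounded_opP; split.
  by move=> c y z; rewrite scalerDr !scalerA mulrC.
exists (ComplexField.Normc.normc k).
  by rewrite -ler0c -normcE.
by move=> y; rewrite nrmZ.
Qed.

Lemma cvgHN u x : cvgH u x -> cvgH (fun n => - u n) (- x).
Proof.
by move=> ux; apply: (cvgH_le ux) => n; rewrite -opprD nrmN.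
Qed.

Lemma cvgHB u v x y : cvgH u x -> cvgH v y -> cvgH (fun n => u n - v n) (x - y).
Proof. by move=> ux /cvgHN; exact: cvgHD. Qed.

Lemma cvgH_uniq u x y : cvgH u x -> cvgH u y -> x = y.
Proof.
move=> ux uy; apply/eqP; rewrite -subr_eq0; apply/eqP/nrm_eq0.
have h := cvgHB ux uy.
have : (fun n => nrm (u n - u n - (x - y))) @ \oo --> (0 : R) := h.
have -> : (fun n => nrm (u n - u n - (x - y))) = fun=> nrm (x - y).
  by apply/funext => n; rewrite subrr sub0r nrmN.
move=> h2; have := cvg_cst (nrm (x - y)) : (fun=> nrm (x - y)) @ \oo --> _.
by rewrite -(cvg_lim (@Rhausdorff R) h2) (cvg_lim (@Rhausdorff R) (cvg_cst _)).
Qed.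

Lemma cvgH_nrm u x : cvgH u x -> (fun n => nrm (u n)) @ \oo --> nrm x.
Proof.
move=> ux; apply: cvg_zero.
apply: norm_cvg0 => /=.
apply: (@squeeze_cvgr _ _ _ _ (fun=> 0) (fun n => nrm (u n - x))) => //.
- apply: nearW => n /=; rewrite normr_ge0 /= ler_norml.
  have := nrmD (u n - x) x; have := nrmD (x - u n) (u n).
  rewrite !subrK nrmBC => h1 h2; apply/andP; split; rewrite !fctE; lra.
- exact: cvg_cst.
Qed.

Lemma cvgH_shift u x m : cvgH u x -> cvgH (fun n => u (n + m)%N) x.
Proof. by rewrite /cvgH => h; rewrite (cvg_shiftn m (fun n => nrm (u n - x))). Qed.

Lemma complex_gt0 (e : R[i]) : 0 < e -> exists2 r : R, 0 < r & e = r%:C%C.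
Proof.
case: e => c d; rewrite ltcE /= => /andP[/eqP-> c0]; by exists c.
Qed.

Lemma cvgH_cauchy u :
  (forall e : R, 0 < e -> exists N, forall m n, (N <= m)%N -> (N <= n)%N ->
     nrm (u m - u n) < e) -> exists x, cvgH u x.
Proof.
move=> h.
have cu : cvg (u @ \oo).
  apply/cauchy_cvgP/cauchy_ballP => _ /complex_gt0[e e0 ->].
  have [N hN] := h e e0.
  exists (u @` [set n | (N <= n)%N], u @` [set n | (N <= n)%N]) => /=.
    by split; exists N => // n Nn; exists n.
  move=> [? ?] /= [[m Nm <-] [n Nn <-]].
  by rewrite -ball_normE /= nrmE ltcR hN.
exists (lim (u @ \oo)); apply/cvgHP => e e0.
have /cvgrPdist_lt/(_ e%:C%C) := cu.
rewrite ltcR => /(_ e0)[N _ hN]; exists N => n Nn.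
by have := hN n Nn; rewrite /= nrmE ltcR nrmBC.
Qed.

Lemma dense_approx (D : set H) : dense D ->
  forall x (e : R), 0 < e -> exists2 v, D v & nrm (x - v) < e.
Proof.
move=> dD x e e0.
have : ball x e%:C%C `&` D !=set0.
  apply: dD; last by apply: ball_open; rewrite ltcR.
  by exists x; apply: ballxx; rewrite ltcR.
case=> v [xv Dv]; exists v => //.
by move: xv; rewrite -ball_normE /= nrmE ltcR.
Qed.

Lemma dense_seq (D : set H) : dense D ->
  forall x, exists2 v : nat -> H, (forall n, D (v n)) & cvgH v x.
Proof.
move=> dD x.
have h n : {v | D v /\ nrm (x - v) < n.+1%:R^-1}.
  by apply: cid; have [|v Dv xv] := @dense_approx D dD x n.+1%:R^-1;
    [rewrite invr_gt0 | exists v].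
exists (fun n => sval (h n)) => [n|]; first by case: (svalP (h n)).
apply: (@cvgH_le _ _ (fun n => n.+1%:R^-1)); first exact: cvg_harmonic.
by move=> n; rewrite nrmBC ltW//; case: (svalP (h n)).
Qed.

End RealNorm.

(** * The real inner product and polarization *)

Section InnerProduct.
Context {R : realType} {H : completeNormedModType R[i]}.
Variable ip : {dot H for Num.conj}.
Hypothesis ip_norm : forall x : H, `|x| ^+ 2 = ip x x.
Implicit Types (x y z : H) (k : R[i]) (f g : H -> H) (u v : nat -> H).

(** Symmetric operators and projections can be handled in the real Hilbert space
    underlying H; [ip_rip] recovers the complex inner product. *)
Definition rip x y : R := complex.Re (ip x y).

Lemma ripRe x y : rip x y = complex.Re (ip x y). Proof. by []. Qed.

Lemma ipC x y : ip x y = ((ip y x)^*)%C.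
Proof. by rewrite hermC expr0 mul1r. Qed.
Lemma ipZr k x y : ip x (k *: y) = (k^*)%C * ip x y.
Proof. by rewrite linearZr_LR. Qed.
Lemma ipZl k x y : ip (k *: x) y = k * ip x y.
Proof. by rewrite linearZl_LR. Qed.
Lemma ipDr x y z : ip x (y + z) = ip x y + ip x z.
Proof. exact: linearDr. Qed.
Lemma ipDl x y z : ip (x + y) z = ip x z + ip y z.
Proof. exact: linearDl. Qed.

Lemma ReD (c d : R[i]) : complex.Re (c + d) = complex.Re c + complex.Re d.
Proof. by case: c; case: d. Qed.
Lemma ReN (c : R[i]) : complex.Re (- c) = - complex.Re c.
Proof. by case: c. Qed.

Lemma ripDl x y z : rip (x + y) z = rip x z + rip y z.
Proof. by rewrite /rip ipDl ReD. Qed.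
Lemma ripDr x y z : rip x (y + z) = rip x y + rip x z.
Proof. by rewrite /rip ipDr ReD. Qed.
Lemma ripNl x y : rip (- x) y = - rip x y.
Proof. by rewrite /rip linearNl ReN. Qed.
Lemma ripNr x y : rip x (- y) = - rip x y.
Proof. by rewrite /rip linearNr ReN. Qed.
Lemma ripC x y : rip x y = rip y x.
Proof. by rewrite /rip ipC; case: (ip y x). Qed.
Lemma ripZl (r : R) x y : rip (r%:C%C *: x) y = r * rip x y.
Proof. by rewrite /rip ipZl; case: (ip x y) => c d /=; rewrite mul0r subr0. Qed.
Lemma ripZr (r : R) x y : rip x (r%:C%C *: y) = r * rip x y.
Proof. by rewrite ripC ripZl ripC. Qed.
Lemma rip0l x : rip 0 x = 0. Proof. by rewrite /rip linear0l. Qed.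
Lemma rip0r x : rip x 0 = 0. Proof. by rewrite /rip linear0r. Qed.

Definition ripE := (ripDl, ripDr, ripNl, ripNr, ripZl, ripZr, rip0l, rip0r).

Lemma ipxx x : ip x x = (nrm x ^+ 2)%:C%C.
Proof. by rewrite -ip_norm nrmE rmorphXn. Qed.

Lemma ripxx x : rip x x = nrm x ^+ 2.
Proof. by rewrite /rip ipxx. Qed.

Lemma ip_rip x y : ip x y = (rip x y +i* rip x ('i%C *: y))%C.
Proof.
rewrite /rip ipZr; case: (ip x y) => c d /=.
by congr (_ +i* _)%C; rewrite mul0r sub0r mulN1r opprK.
Qed.

Lemma rip_CS x y : `|rip x y| <= nrm x * nrm y.
Proof.
rewrite -(@ler_pXn2r _ 2) ?nnegrE ?mulr_ge0 ?nrm_ge0//.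
rewrite real_normK ?num_real// exprMn -!ripxx.
have h (r : R) : 0 <= rip y y * r ^+ 2 + (2 * rip x y) * r + rip x x.
  have : 0 <= rip (r%:C%C *: y + x) (r%:C%C *: y + x).
    by rewrite ripxx sqr_ge0.
  rewrite !ripE (ripC y x) => h; apply: le_trans h _; rewrite le_eqVlt.
  by apply/orP; left; apply/eqP; ring.
have y0 : 0 <= rip y y by rewrite ripxx sqr_ge0.
have [y1|y1] := eqVneq (rip y y) 0.
  have -> : y = 0 by apply/nrm_eq0/eqP; rewrite -sqrf_eq0 -ripxx y1.
  by rewrite !rip0r expr0n mulr0.
have := h (- rip x y / rip y y).
have y2 : 0 < rip y y by rewrite lt_neqAle eq_sym y1.
move=> {}h.
have : 0 <= (rip y y * (- rip x y / rip y y) ^+ 2 +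
    2 * rip x y * (- rip x y / rip y y) + rip x x) * rip y y.
  by rewrite mulr_ge0// ltW.
have -> : (rip y y * (- rip x y / rip y y) ^+ 2 +
    2 * rip x y * (- rip x y / rip y y) + rip x x) * rip y y =
   rip x x * rip y y - rip x y ^+ 2 by field.
by rewrite subr_ge0.
Qed.

(** Cancels a norm in estimates of the form |x|^2 <= M |x| |y|. *)
Lemma nrm_le_of_sq (x y : H) (M : R) : 0 <= M -> nrm x ^+ 2 <= M * nrm x * nrm y ->
  nrm x <= M * nrm y.
Proof.
move=> M0; have := nrm_ge0 x; have := nrm_ge0 y.
rewrite le_eqVlt => y0; rewrite le_eqVlt => /orP[/eqP<-|x0].
  by rewrite mulr_ge0 ?nrm_ge0.
by rewrite -mulrA (mulrC (nrm x)) mulrA expr2 ler_pM2r.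
Qed.

Lemma rip_separates x y : (forall z, rip x z = rip y z) -> x = y.
Proof.
move=> h; apply/eqP; rewrite -subr_eq0; apply/eqP/nrm_eq0/eqP.
by rewrite -sqrf_eq0 -ripxx ripDl ripNl h subrr.
Qed.

Lemma cvgH_rip u v x y : cvgH u x -> cvgH v y ->
  (fun n => rip (u n) (v n)) @ \oo --> rip x y.
Proof.
move=> ux vy.
have nvy := cvgH_nrm vy.
apply: cvg_zero; apply: norm_cvg0 => /=.
apply: (@squeeze_cvgr _ _ _ _ (fun=> 0)
  (fun n => nrm (u n - x) * nrm (v n) + nrm x * nrm (v n - y))).
- apply: nearW => n; rewrite normr_ge0 /= !fctE.
  have -> : rip (u n) (v n) - rip x y = rip (u n - x) (v n) + rip x (v n - y).
    by rewrite !ripE; ring.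
  by apply: le_trans (ler_normD _ _) _; rewrite lerD ?rip_CS.
- exact: cvg_cst.
- rewrite -[X in _ --> X](addr0 0); apply: cvgD.
    by rewrite -[X in _ --> X](mul0r (nrm y)); exact: cvgM.
  by rewrite -[X in _ --> X](mulr0 (nrm x)); apply: cvgM => //; exact: cvg_cst.
Qed.

(** Two vectors x + y and x + iy suffice: together they yield the real and the
    imaginary part of the mixed term. Only the complex field makes this possible. *)
Lemma polarize f g f' g' : linear f -> linear g -> linear f' -> linear g' ->
  (forall x, ip (f x) (g x) = ip (f' x) (g' x)) ->
  forall x y, ip (f x) (g y) = ip (f' x) (g' y).
Proof.
move=> lf lg lf' lg' h x y.
have h1 := h (x + y); have h2 := h (x + 'i%C *: y).
have hx := h x; have hy := h y.
move: h1; rewrite (linD lf) (linD lg) (linD lf') (linD lg') !ipDl !ipDr hx hy.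
move=> h1.
move: h2; rewrite (linD lf) (linD lg) (linD lf') (linD lg').
rewrite (linZ lf) (linZ lg) (linZ lf') (linZ lg') !ipDl !ipDr !ipZl !ipZr hx hy.
move=> h2; clear - h1 h2.
move: h1 h2.
case: (ip (f x) (g y)) => a b; case: (ip (f' x) (g' y)) => a' b'.
case: (ip (f y) (g x)) => c d; case: (ip (f' y) (g' x)) => c' d'.
case: (ip (f' x) (g' x)) => e1 e2; case: (ip (f' y) (g' y)) => e3 e4.
move=> [h1 h2] [h3 h4]; apply/eqP; rewrite eq_complex /=.
apply/andP; split; apply/eqP; lra.
Qed.

Lemma polarize0 f : linear f -> (forall x, ip (f x) x = 0) -> forall x, f x = 0.
Proof.
move=> lf h x.
have l0 : linear (fun _ : H => 0 : H) by move=> k y z; rewrite scaler0 addr0.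
have lid : linear (@id H) by [].
have := @polarize f id (fun=> 0) id lf lid l0 lid.
move=> /(_ (fun x => etrans (h x) (esym (linear0l _ _))))/(_ x (f x)).
rewrite linear0l ipxx => -[] /eqP; rewrite sqrf_eq0 => /eqP; exact: nrm_eq0.
Qed.

Lemma polarize_eq f g : linear f -> linear g ->
  (forall x, ip (f x) x = ip (g x) x) -> f =1 g.
Proof.
move=> lf lg h x; apply/eqP; rewrite -subr_eq0; apply/eqP.
apply: (@polarize0 (fun x => f x - g x)) => [k y z|y].
  by rewrite lf lg scalerBr opprD addrACA.
by rewrite ipDl linearNl h subrr.
Qed.

(** Polarizing <f x, f x> = <f x, x> gives <f x, f y> = <f x, y>, which is
    symmetry and idempotence at once. *)
Lemma proj_of_form f : linear f -> (forall x, ip (f x) (f x) = ip (f x) x) ->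
  orthogonal_projection ip f.
Proof.
move=> lf h.
have lid : linear (@id H) by [].
have h1 := @polarize f f f id lf lf lf lid h.
have sa x y : ip (f x) y = ip x (f y).
  by rewrite -h1 ipC h1 -ipC.
split=> //.
- apply/bounded_opP; split=> //; exists 1 => // x.
  apply: nrm_le_of_sq => //; rewrite mul1r -ripxx /rip h.
  exact: le_trans (ler_norm _) (rip_CS _ _).
- apply/funext => x /=.
  have : forall y, ip (f (f x)) y = ip (f x) y by move=> y; rewrite sa h1.
  by move=> e; apply: rip_separates => y; rewrite /rip e.
Qed.

Definition symop f := forall x y, rip (f x) y = rip x (f y).

Lemma symop_ip f : linear f -> symop f -> forall x y, ip (f x) y = ip x (f y).
Proof.
by move=> lf sf x y; rewrite ip_rip [RHS]ip_rip !sf (linZ lf).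
Qed.

Lemma proj_of_rip f : linear f -> symop f ->
  (forall x, rip (f x) (f x) = rip (f x) x) -> orthogonal_projection ip f.
Proof.
move=> lf sf h; apply: proj_of_form => // x.
have r1 : complex.Im (ip (f x) x) = 0.
  have := symop_ip lf sf x x; rewrite [RHS]ipC.
  by case: (ip (f x) x) => c d /= [] h1; lra.
rewrite ipxx -ripxx h /rip; move: r1.
by case: (ip (f x) x) => c d /= ->.
Qed.

End InnerProduct.

(** * Absolute value and negative projection of a symmetric operator *)

Section SignProjection.
Context {R : realType} {H : completeNormedModType R[i]}.
Variable ip : {dot H for Num.conj}.
Hypothesis ip_norm : forall x : H, `|x| ^+ 2 = ip x x.
Implicit Types (x y z : H) (k : R[i]) (f g : H -> H) (u v : nat -> H).
Local Notation rip := (rip ip).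
Let ripxx := ripxx ip_norm.

Local Notation symop := (symop ip).
Definition commutes f g := forall x, f (g x) = g (f x).

(** The form in which the Cauchy property arises here: squared distances bounded
    by a null sequence, as in the parallelogram identity. *)
Lemma cvgH_cauchy_sq u (phi : nat -> R) : phi @ \oo --> (0 : R) ->
  (forall m n, nrm (u m - u n) ^+ 2 <= phi m + phi n) -> exists x, cvgH u x.
Proof.
move=> /cvgrPdist_lt h hu; apply: cvgH_cauchy => e e0.
have [|N _ hN] := h (e ^+ 2 / 2); first by rewrite divr_gt0// exprn_gt0.
exists N => m n Nm Nn.
rewrite -(@ltr_pXn2r _ 2) ?nnegrE ?nrm_ge0 ?ltW//.
apply: le_lt_trans (hu m n) _.
have := hN _ Nm; have := hN _ Nn; rewrite !sub0r !normrN.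
have := ler_norm (phi m); have := ler_norm (phi n); lra.
Qed.

Lemma lim_linear (F : nat -> H -> H) f : (forall n, linear (F n)) ->
  (forall x, cvgH (F^~ x) (f x)) -> linear f.
Proof.
move=> lF Ff k x y; apply: (cvgH_uniq (Ff _)).
have := cvgHD (cvgHZ k (Ff x)) (Ff y).
by rewrite /cvgH; under [X in _ -> X @ _ --> _]eq_fun do rewrite (lF _ k).
Qed.

Lemma lim_symop (F : nat -> H -> H) f : (forall n, symop (F n)) ->
  (forall x, cvgH (F^~ x) (f x)) -> symop f.
Proof.
move=> lF Ff x y.
have h1 := cvgH_rip ip_norm (Ff x) (cvgH_cst y).
have h2 := cvgH_rip ip_norm (cvgH_cst x) (Ff y).
rewrite -(cvg_lim (@Rhausdorff R) h1) -(cvg_lim (@Rhausdorff R) h2).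
by congr (lim (_ @ \oo)); apply/funext => n; exact: lF.
Qed.

Lemma lim_commutes (F : nat -> H -> H) f c : bounded_operator c ->
  (forall n, commutes c (F n)) ->
  (forall x, cvgH (F^~ x) (f x)) -> commutes c f.
Proof.
move=> bc cF Ff x; have h := cvgH_op bc (Ff x); apply: (cvgH_uniq h).
have := Ff (c x); rewrite /cvgH.
by under eq_fun do rewrite -cF.
Qed.

Lemma nrm_cvg_le u x (M : R) : cvgH u x -> (forall n, nrm (u n) <= M) -> nrm x <= M.
Proof.
move=> /cvgH_nrm h hM.
rewrite -(cvg_lim (@Rhausdorff R) h); apply: limr_le; first by apply/cvg_ex; exists (nrm x).
exact: nearW.
Qed.

Section Kernel.
Variable K : H -> H.
Hypothesis lK : linear K.
Hypothesis sK : symop K.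
Hypothesis cK : forall x, nrm (K x) <= nrm x.
Let D x := x - K (K x).

Let lD : linear D.
Proof. by move=> k x y; rewrite /D !(lK k) scalerBr opprD addrACA. Qed.

Let sD : symop D.
Proof. by move=> x y; rewrite /D !ripE 2!sK. Qed.

Let lDn n : linear (iter n D).
Proof. by elim: n => [//|n IH] k x y /=; rewrite IH lD. Qed.

Let sDn n : symop (iter n D).
Proof. by elim: n => [//|n IH] x y; rewrite iterS sD IH -iterSr. Qed.

Let KDn n : commutes K (iter n D).
Proof.
elim: n => [//|n IH] x /=.
by rewrite /D (linB lK) -/(D _) IH.
Qed.

Let d x n := rip (iter n D x) x.

Let dD x m n : rip (iter m D x) (iter n D x) = d x (m + n).
Proof. by rewrite -sDn -iterD addnC. Qed.

Let d_ge0 x n : 0 <= d x n.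
Proof.
rewrite -(odd_double_half n) -addnn; case: (odd n); last first.
  by rewrite add0n -dD ripxx sqr_ge0.
rewrite addnC addnAC addn1 -dD iterS /D.
set y := iter _ D x; rewrite !ripE sK !ripxx.
by rewrite subr_ge0 ler_pXn2r// nnegrE nrm_ge0.
Qed.

Let d_dec x n : d x n.+1 <= d x n.
Proof.
rewrite -subr_ge0 /d iterSr {1}/D (linB (lDn n)) !ripE opprD opprK addNKr.
by rewrite -KDn sK; exact: d_ge0.
Qed.

Let ex_E x : exists y, cvgH (fun n => iter n D x) y.
Proof.
have dnon : nonincreasing_seq (d x) by apply/nonincreasing_seqP => n; exact: d_dec.
have dc : cvgn (d x).
  by apply: nonincreasing_is_cvgn => //; exists 0 => _ [n _ <-].
have dL n : limn (d x) <= d x n.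
  by apply: nonincreasing_cvgn_ge.
apply: (@cvgH_cauchy_sq _ (fun n => d x n - limn (d x))).
  by rewrite -[X in _ --> X](subrr (limn (d x))); apply: cvgB => //; exact: cvg_cst.
move=> m n; rewrite -ripxx !ripE !dD.
have := dL (m + n)%N; have := dL (n + m)%N.
have : d x (m + m) <= d x m by apply: dnon; rewrite leq_addr.
have : d x (n + n) <= d x n by apply: dnon; rewrite leq_addr.
lra.
Qed.

(** With D = 1 - K^2 the numbers <D^n x, x> are decreasing and nonnegative (even
    powers are squares, odd powers use |K| <= 1), so D^n x is Cauchy. Its limit is
    fixed by D, hence annihilated by K. The fourth property holds for each D^n and
    passes to the limit: an operator that kills the range of K does not see the
    difference between x and its projection. *)
Lemma kernel_projection : exists E : H -> H,
  [/\ orthogonal_projection ip E, forall x, K (E x) = 0,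
      forall x, K x = 0 -> E x = x,
      forall L, bounded_operator L -> (forall x, L (K x) = 0) ->
        forall x, L (E x) = L x
    & forall c, bounded_operator c -> commutes c K -> commutes c E].
Proof.
pose E x := sval (cid (ex_E x)).
have EP x : cvgH (fun n => iter n D x) (E x) by exact: (svalP (cid (ex_E x))).
have bK : bounded_operator K.
  by apply/bounded_opP; split=> //; exists 1 => // x; rewrite mul1r.
have lE := lim_linear lDn EP.
have sE := lim_symop sDn EP.
have EE x : rip (E x) (E x) = rip (E x) x.
  have h1 := cvgH_rip ip_norm (EP x) (EP x).
  have h2 := cvgH_rip ip_norm (EP x) (cvgH_cst x).
  rewrite -(cvg_lim (@Rhausdorff R) h1).
  apply: (cvg_lim (@Rhausdorff R)).
  have -> : (fun n => rip (iter n D x) (iter n D x)) = (fun n => d x (n + n)).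
    by apply/funext => n; exact: dD.
  move/cvgrPdist_lt : h2 => h2; apply/cvgrPdist_lt => e /h2[N _ hN].
  by exists N => // n Nn; apply: hN; apply: leq_trans Nn _; rewrite leq_addr.
exists E; split.
- exact: proj_of_rip.
- move=> x; apply/nrm_eq0/eqP; rewrite -sqrf_eq0 -ripxx -sK.
  have -> : K (K (E x)) = 0; last by rewrite rip0l.
  have bD : bounded_operator D.
    apply/bounded_opP; split=> //; exists 2 => // y.
    apply: le_trans (nrmB _ _) _; have := cK y; have := cK (K y); lra.
  have h1 := cvgH_op bD (EP x).
  have h2 := cvgH_shift 1 (EP x).
  have h3 : D (E x) = E x.
    apply: (cvgH_uniq h1); move: h2; rewrite /cvgH.
    by under eq_fun do rewrite addn1.
  by move: h3; rewrite /D => /eqP; rewrite subr_eq addrC -subr_eq subrr => /eqP.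
- move=> x Kx; apply: (cvgH_uniq (EP x)).
  have h n : iter n D x = x.
    by elim: n => [//|n IH]; rewrite iterS IH /D Kx (lin0 lK) subr0.
  rewrite /cvgH; under eq_fun do rewrite h.
  exact: cvgH_cst.
- move=> L bL LK x.
  have lL : linear L by case: bL.
  have h n : L (iter n D x) = L x.
    elim: n => [//|n IH]; rewrite iterS /D (linB lL) LK subr0; exact: IH.
  apply: (cvgH_uniq (cvgH_op bL (EP x))).
  rewrite /cvgH; under eq_fun do rewrite h.
  exact: cvgH_cst.
- move=> c bc cKc.
  have lc : linear c by case: bc.
  apply: lim_commutes EP => // n.
  elim: n => [//|n IH] x /=; rewrite {1}/D (linB lc) !cKc !IH//.
Qed.

End Kernel.

Section AbsoluteValue.
Variable T : H -> H.
Hypothesis lT : linear T.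
Hypothesis sT : symop T.
Hypothesis cT : forall x, nrm (T x) <= nrm x.

(** If A^2 = T^2 and Y = 1 - A, then Y = (1 - T^2 + Y^2) / 2; this is the iteration
    for Y. *)
Fixpoint sqrt_iter n x : H := if n is n'.+1 then
  (2^-1)%:C%C *: (x - T (T x) + sqrt_iter n' (sqrt_iter n' x)) else 0.

(** The scalar iteration for T = 0, which dominates [sqrt_iter] in norm, termwise
    and for differences. *)
Fixpoint sqrt_bound n : R := if n is n'.+1 then
  2^-1 * (1 + sqrt_bound n' ^+ 2) else 0.
Local Notation Y := sqrt_iter.
Local Notation r := sqrt_bound.

Let lY n : linear (Y n).
Proof.
elim: n => [|n IH] k x y /=; first by rewrite scaler0 addr0.
rewrite !(lT k) !(IH k) scalerA [in RHS]mulrC -[in RHS]scalerA -scalerDr.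
congr (_ *: _); rewrite [in RHS]scalerDr scalerBr opprD.
by rewrite (addrACA (k *: x)) [LHS]addrACA.
Qed.

Let sY n : symop (Y n).
Proof.
elim: n => [|n IH] x y /=; first by rewrite !ripE.
by rewrite !ripE 2!sT 2!IH.
Qed.

Let cY n c : bounded_operator c -> commutes c T -> commutes c (Y n).
Proof.
move=> [lc _] cTc; elim: n => [|n IH] x /=; first by rewrite (lin0 lc).
by rewrite (linZ lc) (linD lc) (linB lc) !cTc !IH.
Qed.

Let r_bd n : 0 <= r n <= 1.
Proof.
elim: n => [|n /andP[h1 h2]] /=; first by rewrite lexx ler01.
by apply/andP; split; nra.
Qed.

Let nY n x : nrm (Y n x) <= r n * nrm x.
Proof.
elim: n x => [|n IH] x /=; first by rewrite nrm0 mul0r.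
rewrite nrmZR ger0_norm// -mulrA ler_pM2l// mulrDl mul1r.
apply: le_trans (nrmD _ _) _; apply: lerD; last first.
  apply: le_trans (IH _) _; rewrite expr2 -mulrA ler_wpM2l//.
  by case/andP: (r_bd n).
rewrite -(@ler_pXn2r _ 2) ?nnegrE ?nrm_ge0// -ripxx.
rewrite !ripE -sT !ripxx (ripC _ _ x) -sT ripxx.
have := cT (T x); have := nrm_ge0 (T (T x)); have := nrm_ge0 (T x).
nra.
Qed.

Let r_inc n : r n <= r n.+1.
Proof.
elim: n => [|n IH]; first by case/andP: (r_bd 1).
have e : r n.+1 = 2^-1 * (1 + r n ^+ 2) by [].
change (r n.+2) with (2^-1 * (1 + r n.+1 ^+ 2)); rewrite {1}e.
rewrite ler_pM2l// lerD2l ler_pXn2r// nnegrE.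
  by case/andP: (r_bd n).
by case/andP: (r_bd n.+1).
Qed.

Let nYS n x : nrm (Y n.+1 x - Y n x) <= (r n.+1 - r n) * nrm x.
Proof.
elim: n x => [|n IH] x.
  by rewrite subr0 [r 0]/= subr0; exact: nY.
have -> : Y n.+2 x - Y n.+1 x = (2^-1)%:C%C *:
    ((Y n.+1 (Y n.+1 x) - Y n (Y n.+1 x)) + Y n (Y n.+1 x - Y n x)).
  rewrite (linB (lY n)) [Y n.+2 x]/= [Y n.+1 x in LHS]/= -scalerBr.
  congr (_ *: _); rewrite opprD addrACA subrr add0r.
  by rewrite addrA subrK.
have -> : r n.+2 - r n.+1 = 2^-1 * ((r n.+1 - r n) * r n.+1 + r n * (r n.+1 - r n)).
  have e : r n.+1 = 2^-1 * (1 + r n ^+ 2) by [].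
  change (r n.+2) with (2^-1 * (1 + r n.+1 ^+ 2)).
  by rewrite {2}e; ring.
rewrite nrmZR ger0_norm// -mulrA ler_pM2l// mulrDl.
have /andP[r0 r1] := r_bd n.
have rS : 0 <= r n.+1 - r n by rewrite subr_ge0.
apply: le_trans (nrmD _ _) _; apply: lerD.
  apply: le_trans (IH _) _; rewrite -mulrA ler_wpM2l//; exact: nY.
apply: le_trans (nY _ _) _; rewrite -mulrA ler_wpM2l//.
Qed.

Let nYmn m n x : nrm (Y m x - Y n x) <= `|r m - r n| * nrm x.
Proof.
wlog mn : m n / (n <= m)%N => [hw|].
  by case: (leqP n m) => [/hw//|/ltnW/hw]; rewrite nrmBC distrC.
have h : nrm (Y m x - Y n x) <= (r m - r n) * nrm x.
  rewrite -(subnK mn); elim: (m - n)%N => [|k IH].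
    by rewrite add0n !subrr nrm0 mul0r.
  have -> : Y (k.+1 + n) x - Y n x =
    (Y (k + n).+1 x - Y (k + n) x) + (Y (k + n) x - Y n x).
    by rewrite addrA subrK.
  have -> : r (k.+1 + n) - r n = (r (k + n).+1 - r (k + n)%N) + (r (k + n)%N - r n).
    by rewrite addrA subrK.
  by rewrite mulrDl; apply: le_trans (nrmD _ _) _; rewrite lerD.
by apply: le_trans h _; rewrite ler_wpM2r ?nrm_ge0 ?ler_norm.
Qed.

Let ex_Y x : exists y, cvgH (Y^~ x) y.
Proof.
have rc : cvgn r.
  apply: nondecreasing_is_cvgn; first by apply/nondecreasing_seqP.
  by exists 1 => _ [n _ <-]; case/andP: (r_bd n).
set L := limn r in rc.
apply: (@cvgH_cauchy_sq _ (fun n => 2 * (`|r n - L| * nrm x) ^+ 2)).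
  have -> : 0 = 2 * (0 * nrm x) ^+ 2 :> R by rewrite mul0r expr0n mulr0.
  apply: cvgM; first exact: cvg_cst.
  have h : (fun n => `|r n - L| * nrm x) @ \oo --> 0 * nrm x.
    apply: cvgM; last exact: cvg_cst.
    rewrite -(normr0 R); apply: cvg_norm; rewrite -(subrr L).
    by apply: cvgB => //; exact: cvg_cst.
  under eq_fun do rewrite expr2.
  by rewrite expr2; exact: cvgM.
move=> m n.
have h := nYmn m n x.
have : `|r m - r n| <= `|r m - L| + `|r n - L|.
  by rewrite (distrC (r n)); apply: le_trans (ler_normD _ _); rewrite addrA subrK.
have := nrm_ge0 x; have := nrm_ge0 (Y m x - Y n x).
have := normr_ge0 (r m - L); have := normr_ge0 (r n - L).
move: h; move: (nrm _) (nrm x) (`|_|) (`|r m - L|) (`|r n - L|) => A B C D E h D0 E0 A0 B0 CDE.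
have h2 : A <= D * B + E * B by nra.
have h3 : 0 <= D * B by rewrite mulr_ge0.
have h4 : 0 <= E * B by rewrite mulr_ge0.
move: h2 h3 h4; move: (D * B) (E * B) => p q h2 p0 q0.
have : A ^+ 2 <= (p + q) ^+ 2 by rewrite ler_pXn2r// nnegrE ?addr_ge0.
have := sqr_ge0 (p - q); nra.
Qed.

(** The operators Y n converge because their increments are bounded by those of
    the increasing bounded scalar sequence [sqrt_bound]. *)
Lemma absolute_value : exists A : H -> H,
  [/\ linear A, symop A, forall x, A (A x) = T (T x),
      forall x, nrm (x - A x) <= nrm x
    & forall c, bounded_operator c -> commutes c T -> commutes c A].
Proof.
pose V x := sval (cid (ex_Y x)).
have VP x : cvgH (Y^~ x) (V x) by exact: (svalP (cid (ex_Y x))).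
have lV := lim_linear lY VP.
have sV := lim_symop sY VP.
have nV x : nrm (V x) <= nrm x.
  apply: (nrm_cvg_le (VP x)) => n; apply: le_trans (nY n x) _.
  by rewrite ler_piMl ?nrm_ge0//; case/andP: (r_bd n).
have V2 x : V x = (2^-1)%:C%C *: (x - T (T x) + V (V x)).
  have h1 := cvgH_shift 1 (VP x).
  apply: (cvgH_uniq h1).
  rewrite /cvgH; under eq_fun do rewrite addn1 /=.
  apply: cvgHZ; apply: cvgHD; first exact: cvgH_cst.
  apply: (@cvgH_le _ _ _ _ (fun n => nrm (Y n x - V x) + nrm (Y n (V x) - V (V x)))).
    rewrite -[X in _ --> X](addr0 0); apply: cvgD; exact: VP.
  move=> n; have -> : Y n (Y n x) - V (V x) =
    Y n (Y n x - V x) + (Y n (V x) - V (V x)) by rewrite (linB (lY n)) addrA subrK.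
  apply: le_trans (nrmD _ _) _; rewrite lerD2r; apply: le_trans (nY _ _) _.
  by rewrite ler_piMl ?nrm_ge0//; case/andP: (r_bd n).
exists (fun x => x - V x); split.
- by move=> k x y; rewrite lV scalerBr opprD addrACA.
- by move=> x y; rewrite !ripE sV.
- move=> x; rewrite (linB lV).
  have : V x + V x = x - T (T x) + V (V x).
    rewrite {1 2}V2 -scalerDl -rmorphD /= -[2^-1]mul1r -splitr scale1r//.
  move=> h.
  rewrite opprB.
  have -> : x - V x + (V (V x) - V x) = x + V (V x) - (V x + V x).
    by rewrite addrACA [RHS]/= opprD.
  by rewrite h opprD opprB addrACA subrr addr0 addrC addrNK.
- by move=> x; rewrite opprB addrC subrK.
- move=> c bc cTc x; have [lc _] := bc; rewrite (linB lc); congr (_ - _).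
  have := lim_commutes bc _ VP; apply => n; exact: cY.
Qed.

End AbsoluteValue.

(** After scaling, |T| <= 1. Let A be the absolute value of T and E the projection
    onto the kernel of A + T. On the range of E one has T = - A <= 0. Since
    (A - T) (A + T) = A^2 - T^2 = 0, the operator A - T vanishes on the complement,
    where T = A >= 0. If <T x, x> = 0 there, then A x = 0 because A is nonnegative,
    so x lies in the kernel of A + T as well and is 0. *)
Lemma sign_projection (T : H -> H) : bounded_operator T -> symop T ->
  exists E : H -> H,
  [/\ orthogonal_projection ip E,
      forall x, E x = x -> rip (T x) x <= 0,
      forall x, E x = 0 -> 0 <= rip (T x) x,
      forall x, E x = 0 -> rip (T x) x = 0 -> x = 0
    & forall c, bounded_operator c -> commutes c T -> commutes c E].
Proof.
move=> /bounded_opP[lT0 [M M0 TM]] sT0.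
(* M + 1 rather than M, which may be 0 *)
pose e := ((M + 1)^-1)%:C%C : R[i].
have M1 : 0 < M + 1 by rewrite ltr_wpDl.
pose T1 x := e *: T x.
have lT : linear T1.
  by move=> k x y; rewrite /T1 lT0 scalerDr !scalerA mulrC.
have sT : symop T1 by move=> x y; rewrite /T1 !ripE sT0.
have cT x : nrm (T1 x) <= nrm x.
  rewrite /T1 nrmZR ger0_norm ?invr_ge0 ?(ltW M1)// ler_pdivrMl// mulrDl mul1r.
  by apply: le_trans (TM x) _; rewrite lerDl nrm_ge0.
have [A [lA sA AA nA cA]] := absolute_value lT sT cT.
have bT : bounded_operator T1.
  by apply/bounded_opP; split=> //; exists 1 => // x; rewrite mul1r.
have nA2 x : nrm (A x) <= 2 * nrm x.
  have := nA x; have := nrmB x (x - A x).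
  by rewrite opprB addrCA subrr addr0; lra.
have AT : commutes T1 A by apply: cA.
have A0 x : 0 <= rip (A x) x.
  have : rip (x - A x) x <= nrm x ^+ 2.
    apply: le_trans (ler_norm _) _; apply: le_trans (rip_CS ip_norm _ _) _.
    by rewrite expr2 ler_wpM2r ?nrm_ge0.
  by rewrite !ripE ripxx; lra.
have A1 x : rip (A x) x = 0 -> A x = 0.
  move=> h; apply/nrm_eq0/eqP; rewrite -sqrf_eq0.
  have : nrm (x - A x) ^+ 2 <= nrm x ^+ 2 by rewrite ler_pXn2r// nnegrE nrm_ge0.
  rewrite -!ripxx !ripE (ripC _ x) h => h1.
  have h2 := sqr_ge0 (nrm (A x)); rewrite -ripxx in h2 *.
  by apply/eqP; lra.
(* |A| <= 2 and |T1| <= 1, so the factor 1/4 makes K a contraction *)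
pose K x := (4^-1)%:C%C *: (A x + T1 x).
have lK : linear K.
  move=> k x y; rewrite /K lA lT !scalerDr !scalerA !(mulrC k).
  by rewrite addrACA.
have sK : symop K by move=> x y; rewrite /K ripZl ripZr ripDl ripDr sA sT.
have cK x : nrm (K x) <= nrm x.
  rewrite /K nrmZR ger0_norm ?invr_ge0// ler_pdivrMl//.
  have := nrmD (A x) (T1 x); have := cT x; have := nA2 x; have := nrm_ge0 x; lra.
have [E [pE KE EK LE cE]] := kernel_projection lK sK cK.
have K0 x : K x = 0 -> A x = - T1 x.
  move=> /eqP; rewrite /K scaler_eq0 => /orP[|]; last by rewrite addr_eq0 => /eqP.
  by rewrite -(rmorph0 (real_complex R)) => /eqP/complexI/eqP; rewrite invr_eq0 pnatr_eq0.
have TT x : rip (T x) x = (M + 1) * rip (T1 x) x.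
  by rewrite /T1 ripE mulrA divff ?mul1r// gt_eqF.
have AT0 x : E x = 0 -> A x = T1 x.
  move=> Ex.
  pose L x := A x - T1 x.
  have bL : bounded_operator L.
    apply/bounded_opP; split.
      by move=> k y z; rewrite /L lA lT scalerBr opprD addrACA.
    exists 3 => // y; apply: le_trans (nrmB _ _) _.
    by have := cT y; have := nA2 y; lra.
  have LK y : L (K y) = 0.
    rewrite /L /K (linZ lA) (linZ lT) -scalerBr (linD lA) (linD lT) AA AT.
    by rewrite (addrC (A _)) subrr scaler0.
  have := LE L bL LK x; rewrite Ex /L (lin0 lA) (lin0 lT) subrr => /esym/eqP.
  by rewrite subr_eq0 => /eqP.
exists E; split => //.
- move=> x Ex; have := KE x; rewrite Ex => /K0 h.
  have := A0 x; rewrite h TT ripE; nra.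
- by move=> x /AT0 h; have := A0 x; rewrite h TT; nra.
- move=> x Ex; rewrite TT => /eqP; rewrite mulf_eq0 gt_eqF//= => /eqP h.
  have h1 := AT0 _ Ex.
  have h2 : A x = 0 by apply: A1; rewrite h1.
  by rewrite -Ex EK// /K h2 -h1 h2 addr0 scaler0.
- move=> c bc cTc.
  have [lc _] := bc.
  have cT1 : commutes c T1 by move=> x; rewrite /T1 (linZ lc) cTc.
  apply: cE => // x; rewrite /K (linZ lc) (linD lc) cT1; congr (_ *: (_ + _)).
  exact: cA.
Qed.

End SignProjection.

(** * Monotone sequences of orthogonal projections *)

Section Projections.
Context {R : realType} {H : completeNormedModType R[i]}.
Variable ip : {dot H for Num.conj}.
Hypothesis ip_norm : forall x : H, `|x| ^+ 2 = ip x x.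
Implicit Types (x y z : H) (k : R[i]) (E F : H -> H) (u v : nat -> H).
Local Notation rip := (rip ip).
Local Notation symop := (symop ip).
Local Notation proj := (orthogonal_projection ip).
Let ripxx := ripxx ip_norm.

Lemma proj_bop E : proj E -> bounded_operator E. Proof. by case. Qed.
Lemma proj_lin E : proj E -> linear E. Proof. by case=> -[]. Qed.
Lemma projK E x : proj E -> E (E x) = E x.
Proof. by case=> _ h _; exact: (congr1 (fun f => f x) h). Qed.
Lemma proj_sym E : proj E -> symop E.
Proof. by case=> _ _ h x y; rewrite !ripRe h. Qed.
Lemma proj_rip E x : proj E -> rip (E x) x = nrm (E x) ^+ 2.
Proof. by move=> pE; rewrite -ripxx (proj_sym pE x (E x)) (projK x pE) ripC. Qed.
Lemma proj_nrm E x : proj E -> nrm (E x) <= nrm x.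
Proof.
move=> pE; rewrite -[leRHS]mul1r; apply: nrm_le_of_sq => //.
rewrite mul1r -proj_rip//; apply: le_trans (ler_norm _) _; exact: rip_CS.
Qed.

Lemma proj_id : proj id.
Proof. by split=> //; apply/bounded_opP; split=> //; exists 1 => // x; rewrite mul1r. Qed.

Lemma projC E : proj E -> proj (fun x => x - E x).
Proof.
move=> pE; apply: (proj_of_rip ip_norm).
- by move=> k x y; rewrite (proj_lin pE k) scalerBr opprD addrACA.
- by move=> x y; rewrite !ripE (proj_sym pE).
- move=> x; rewrite !ripE (ripC _ x (E x)).
  have := proj_rip x pE; rewrite -ripxx; lra.
Qed.

(** |p n x|^2 increases and is bounded by |x|^2, and for m <= n its increments are
    the squared distances |p n x - p m x|^2. *)
Lemma increasing_projections (p : nat -> H -> H) :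
  (forall n, proj (p n)) -> (forall m n x, (m <= n)%N -> p m (p n x) = p m x) ->
  exists2 q, proj q & forall x, cvgH (p^~ x) (q x).
Proof.
move=> pp pmn.
have ex x : exists y, cvgH (p^~ x) y.
  pose s n := nrm (p n x) ^+ 2.
  have smn m n : (m <= n)%N -> rip (p m x) (p n x) = s m.
    by move=> mn; rewrite (proj_sym (pp m)) pmn// ripC proj_rip.
  have snd : nondecreasing_seq s.
    move=> m n mn; have := sqr_ge0 (nrm (p m x - p n x)).
    rewrite -ripxx !ripE (ripC _ (p n x) (p m x)) !smn// /s.
    by have := smn m n mn; have := smn n n (leqnn n); rewrite /s; lra.
  have sc : cvgn s.
    apply: nondecreasing_is_cvgn => //; exists (nrm x ^+ 2) => _ [n _ <-].
    by rewrite /s ler_pXn2r ?nnegrE ?nrm_ge0 ?proj_nrm.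
  set L := limn s in sc.
  have sL n : s n <= L by apply: nondecreasing_cvgn_le.
  apply: (@cvgH_cauchy_sq _ _ _ (fun n => L - s n)).
    rewrite -[X in _ --> X](subrr L); apply: cvgB => //; exact: cvg_cst.
  move=> m n; wlog mn : m n / (m <= n)%N => [hw|].
    by case: (leqP m n) => [/hw//|/ltnW/hw h]; rewrite nrmBC [leRHS]addrC.
  rewrite -ripxx !ripE (ripC _ (p n x) (p m x)) !smn//.
  have := sL m; have := sL n; lra.
pose q x := sval (cid (ex x)).
have qP x : cvgH (p^~ x) (q x) by exact: (svalP (cid (ex x))).
exists q => //; apply: (proj_of_rip ip_norm).
- by apply: lim_linear qP => n; exact: proj_lin.
- by apply: lim_symop qP => // n; exact: proj_sym.
- move=> x; have h1 := cvgH_rip ip_norm (qP x) (qP x).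
  have h2 := cvgH_rip ip_norm (qP x) (cvgH_cst x).
  rewrite -(cvg_lim (@Rhausdorff R) h1) -(cvg_lim (@Rhausdorff R) h2).
  congr (lim (_ @ \oo)); apply/funext => n.
  by rewrite proj_rip// ripxx.
Qed.

Lemma decreasing_projections (p : nat -> H -> H) :
  (forall n, proj (p n)) -> (forall m n x, (m <= n)%N -> p m (p n x) = p n x) ->
  exists2 q, proj q & forall x, cvgH (p^~ x) (q x).
Proof.
move=> pp pmn.
have [||q pq qP] := @increasing_projections (fun n x => x - p n x).
- by move=> n; apply: projC.
- move=> m n x mn; rewrite (linB (proj_lin (pp m))) pmn//.
  by rewrite opprB addrA subrK.
exists (fun x => x - q x); first exact: projC.
move=> x; have := cvgHB (cvgH_cst x) (qP x).
by rewrite /cvgH; under eq_fun do rewrite subKr.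
Qed.

End Projections.

(** * Resolvents, cuts and the spectral family of a self-adjoint operator *)

Section SelfAdjoint.
Context {R : realType} {H : completeNormedModType R[i]}.
Variable ip : {dot H for Num.conj}.
Hypothesis ip_norm : forall x : H, `|x| ^+ 2 = ip x x.
Variable a : operator H.
Hypothesis a_linear : linear_operator a.
Hypothesis a_dense : dense (dom a).
Hypothesis a_sa : self_adjoint ip a.
Implicit Types (x y z v w : H) (k l : R[i]) (E F J : H -> H).
Local Notation rip := (rip ip).
Local Notation symop := (symop ip).
Local Notation proj := (orthogonal_projection ip).
Local Notation D := (dom a).
Let ripxx := ripxx ip_norm.

Lemma dom0 : D 0. Proof. by case: a_linear. Qed.
Lemma app0 : a 0 = 0.
Proof.
have [_ /(_ 1 0 0 dom0 dom0)[_]] := a_linear.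
by rewrite !scale1r addr0 => /esym/(canRL (addrK _)); rewrite subrr.
Qed.
Lemma domZ k v : D v -> D (k *: v).
Proof. by move=> Dv; have [_ /(_ k v 0 Dv dom0)[]] := a_linear; rewrite addr0. Qed.
Lemma appZ k v : D v -> a (k *: v) = k *: a v.
Proof.
move=> Dv; have [_ /(_ k v 0 Dv dom0)[_]] := a_linear.
by rewrite app0 !addr0.
Qed.
Lemma domD v w : D v -> D w -> D (v + w).
Proof. by move=> Dv Dw; have [_ /(_ 1 v w Dv Dw)[]] := a_linear; rewrite scale1r. Qed.
Lemma appD v w : D v -> D w -> a (v + w) = a v + a w.
Proof.
by move=> Dv Dw; have [_ /(_ 1 v w Dv Dw)[_]] := a_linear; rewrite !scale1r.
Qed.
Lemma domN v : D v -> D (- v). Proof. by rewrite -scaleN1r; exact: domZ. Qed.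
Lemma appN v : D v -> a (- v) = - a v.
Proof. by move=> Dv; rewrite -scaleN1r appZ// scaleN1r. Qed.
Lemma domB v w : D v -> D w -> D (v - w).
Proof. by move=> Dv Dw; apply: domD => //; exact: domN. Qed.
Lemma appB v w : D v -> D w -> a (v - w) = a v - a w.
Proof. by move=> Dv Dw; rewrite appD ?appN//; exact: domN. Qed.

Lemma sa_sym v w : D v -> D w -> ip (a v) w = ip v (a w).
Proof.
move=> Dv Dw; have [domE valE] := a_sa.
rewrite -(valE w Dw); move: (Dw); rewrite -domE => -[z hz].
by have := xgetI 0 hz; apply.
Qed.

Lemma sa_symR v w : D v -> D w -> rip (a v) w = rip v (a w).
Proof. by move=> Dv Dw; rewrite !ripRe sa_sym. Qed.

Lemma dense_separates x y : (forall v, D v -> rip v x = rip v y) -> x = y.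
Proof.
move=> h; apply: (rip_separates ip_norm) => z.
have [v Dv vz] := dense_seq a_dense z.
have h1 := cvgH_rip ip_norm vz (cvgH_cst x).
have h2 := cvgH_rip ip_norm vz (cvgH_cst y).
rewrite (ripC _ x) (ripC _ y).
rewrite -(cvg_lim (@Rhausdorff R) h1) -(cvg_lim (@Rhausdorff R) h2).
by congr (lim (_ @ \oo)); apply/funext => n; exact: h.
Qed.

(** A self-adjoint operator has no proper symmetric extension: y is in the domain
    of the adjoint, hence in the domain of a. Testing with real parts is enough as
    the domain is stable under multiplication by i. *)
Lemma sa_max y z : (forall v, D v -> rip (a v) y = rip v z) -> D y /\ a y = z.
Proof.
move=> h; have [domE valE] := a_sa.
have hz : forall v, D v -> ip (a v) y = ip v z.
  move=> v Dv; rewrite ip_rip [RHS]ip_rip h//; congr (_ +i* _)%C.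
  have e u w : rip u ('i%C *: w) = rip ((- 'i%C) *: u) w.
    by rewrite !ripRe ipZr ipZl; case: (ip u w) => p q /=; ring.
  by rewrite !e -appZ// h//; exact: domZ.
have Dy : D y by rewrite -domE; exists z.
split=> //; apply: dense_separates => v Dv.
by rewrite -sa_symR// h.
Qed.

Lemma sa_closed (v : nat -> H) x z : (forall n, D (v n)) ->
  cvgH v x -> cvgH (fun n => a (v n)) z -> D x /\ a x = z.
Proof.
move=> Dv vx avz; apply: sa_max => w Dw.
have h1 := cvgH_rip ip_norm (cvgH_cst (a w)) vx.
have h2 := cvgH_rip ip_norm (cvgH_cst w) avz.
rewrite -(cvg_lim (@Rhausdorff R) h1) -(cvg_lim (@Rhausdorff R) h2).
by congr (lim (_ @ \oo)); apply/funext => n; rewrite sa_symR.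
Qed.

Lemma rip_conj k x y : rip (k *: x) y = rip x ((k^*)%C *: y).
Proof.
by rewrite !ripRe ipZr ipZl; case: (ip x y) => p q; case: k => r s /=; ring.
Qed.

(** A quadratic polynomial without constant term that is nonnegative has no linear
    term; p / (q + 1) is a value of t that avoids division by 0. *)
Lemma linear_term_eq0 (p q : R) : 0 <= q -> (forall t : R, 0 <= t ^+ 2 * q - 2 * t * p) ->
  p = 0.
Proof.
move=> q0 h; have := h (p / (q + 1)).
have q1 : 0 < q + 1 by rewrite ltr_wpDl.
have -> : (p / (q + 1)) ^+ 2 * q - 2 * (p / (q + 1)) * p =
  - (p ^+ 2 * (q + 2)) / (q + 1) ^+ 2 by field; rewrite gt_eqF.
rewrite pmulr_lge0 ?invr_gt0 ?exprn_gt0// oppr_ge0 => h1.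
apply/eqP; rewrite -sqrf_eq0; apply/eqP.
by have := sqr_ge0 p; nra.
Qed.

Lemma min_orthogonal x y :
  (forall t : R, nrm y ^+ 2 <= nrm (y - t%:C%C *: x) ^+ 2) -> rip x y = 0.
Proof.
move=> h; apply: (@linear_term_eq0 _ (nrm x ^+ 2)); first exact: sqr_ge0.
by move=> t; have := h t; rewrite -!ripxx !ripE (ripC _ y x); lra.
Qed.

Lemma parallelogram y p q : nrm (p - q) ^+ 2 =
  2 * nrm (y - p) ^+ 2 + 2 * nrm (y - q) ^+ 2
  - 4 * nrm (y - (2^-1)%:C%C *: (p + q)) ^+ 2.
Proof.
rewrite -!ripxx !ripE (ripC _ q p) (ripC _ p y) (ripC _ q y).
by field.
Qed.

(** The lower bound makes the range of b = l - a closed. The best approximation b x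
    of a given y in this range exists by the parallelogram identity, and the error
    y - b x is orthogonal to the range, hence an eigenvector of a for the
    conjugate of l, hence 0. *)
Lemma regular_value_of_lower_bound l (c : R) : 0 < c ->
  (forall v, D v -> c * nrm v <= nrm (l *: v - a v)) ->
  (forall w, D w -> a w = (l^*)%C *: w -> w = 0) ->
  regular_value a l.
Proof.
move=> c0 hc hl.
pose b v := l *: v - a v.
have bB v w : D v -> D w -> b v - b w = b (v - w).
  by move=> Dv Dw; rewrite /b appB// scalerBr opprD !opprK opprD opprK addrACA.
split.
- move=> v w; rewrite !inE => Dv Dw e.
  have e' : b v = b w := e.
  have := hc (v - w) (domB Dv Dw); rewrite -/(b _) -bB// e' subrr nrm0.
  rewrite pmulr_rle0// => h; apply/eqP; rewrite -subr_eq0; apply/eqP/nrm_eq0.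
  by apply/eqP; rewrite eq_le h nrm_ge0.
- move=> y _.
  pose S := [set nrm (y - b v) | v in D].
  have S0 : S !=set0 by exists (nrm (y - b 0)), 0 => //; exact: dom0.
  have Slb : has_lbound S by exists 0 => _ [v _ <-]; exact: nrm_ge0.
  pose d := inf S.
  have dS v : D v -> d <= nrm (y - b v).
    by move=> Dv; apply: ge_inf => //; exists v.
  have d0 : 0 <= d by apply: lb_le_inf => // _ [v _ <-]; exact: nrm_ge0.
  have ex n : {v | D v /\ nrm (y - b v) < d + n.+1%:R^-1}.
    apply: cid; have [|_ [v Dv <-] hv] := @inf_adherent _ S n.+1%:R^-1 _ (conj S0 Slb).
      by rewrite invr_gt0.
    by exists v.
  pose v n := sval (ex n).
  have Dv n : D (v n) by case: (svalP (ex n)).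
  have hv n : nrm (y - b (v n)) < d + n.+1%:R^-1 by case: (svalP (ex n)).
  (* phi n bounds the share of v n in the parallelogram identity, whose last
     term is at most - 4 d^2 *)
  pose phi n := 2 * ((d + n.+1%:R^-1) * (d + n.+1%:R^-1) - d * d).
  have phi0 : phi @ \oo --> (0 : R).
    have -> : 0 = 2 * ((d + 0) * (d + 0) - d * d) :> R by ring.
    have h : (fun n => d + n.+1%:R^-1) @ \oo --> d + 0.
      by apply: cvgD; [exact: cvg_cst|exact: cvg_harmonic].
    apply: cvgM; first exact: cvg_cst.
    by apply: cvgB; [exact: cvgM|exact: cvg_cst].
  have hb m n : nrm (b (v m) - b (v n)) ^+ 2 <= phi m + phi n.
    pose h := (2^-1)%:C%C *: (v m + v n).
    have Dh : D h by apply: domZ; exact: domD.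
    have e : b h = (2^-1)%:C%C *: (b (v m) + b (v n)).
      rewrite /b /h appZ ?appD//; last exact: domD.
      rewrite scalerA mulrC -scalerA -scalerBr; congr (_ *: _).
      by rewrite scalerDr opprD addrACA.
    have := dS h Dh; rewrite e.
    have := hv m; have := hv n.
    set p := b (v m); set q := b (v n).
    rewrite (parallelogram y) /phi; move: (nrm_ge0 (y - p)) (nrm_ge0 (y - q)).
    set A := nrm (y - p); set B := nrm (y - q); set C := nrm (y - _ *: _).
    move=> A0 B0 hB hA hC.
    have : d ^+ 2 <= C ^+ 2 by rewrite ler_pXn2r ?nnegrE// (le_trans d0).
    have : A ^+ 2 <= (d + m.+1%:R^-1) ^+ 2.
      by rewrite !expr2; apply: ler_pM => //; exact: ltW.
    have : B ^+ 2 <= (d + n.+1%:R^-1) ^+ 2.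
      by rewrite !expr2; apply: ler_pM => //; exact: ltW.
    rewrite -!expr2; move: (A ^+ 2) (B ^+ 2) (C ^+ 2) (d ^+ 2)
      ((d + m.+1%:R^-1) ^+ 2) ((d + n.+1%:R^-1) ^+ 2) => *; lra.
  have [z bz] := cvgH_cauchy_sq phi0 hb.
  have [x vx] : exists x, cvgH v x.
    apply: (@cvgH_cauchy_sq _ _ v (fun n => c ^- 2 * phi n)).
      by rewrite -[X in _ --> X](mulr0 (c ^- 2)); apply: cvgM => //; exact: cvg_cst.
    move=> m n; rewrite -mulrDr ler_pdivlMl ?exprn_gt0// -exprMn.
    apply: le_trans (hb m n).
    rewrite ler_pXn2r ?nnegrE ?nrm_ge0// ?mulr_ge0 ?nrm_ge0 ?(ltW c0)// bB//.
    by apply: hc; exact: domB.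
  have [Dx ax] : D x /\ a x = l *: x - z.
    apply: (sa_closed Dv vx).
    have := cvgHB (cvgHZ l vx) bz.
    by rewrite /cvgH /b; under eq_fun do rewrite subKr.
  have bx : b x = z by rewrite /b ax subKr.
  have rd : nrm (y - b x) <= d.
    rewrite bx; have h := cvgH_nrm (cvgHB (cvgH_cst y) bz).
    have h2 : (fun n => d + n.+1%:R^-1) @ \oo --> d.
      rewrite -[X in _ --> X]addr0.
      by apply: cvgD; [exact: cvg_cst|exact: cvg_harmonic].
    apply: (@ler_cvg_to _ _ _ _ _ _ _ _ h h2).
    by apply: nearW => n; rewrite ltW.
  pose r := y - b x.
  have ro u : D u -> rip (b u) r = 0.
    move=> Du; apply: min_orthogonal => t.
    have Dxu : D (x + t%:C%C *: u) by apply: domD => //; exact: domZ.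
    have e : y - b (x + t%:C%C *: u) = r - t%:C%C *: b u.
      rewrite /r /b appD ?appZ//; last exact: domZ.
      rewrite scalerDr scalerBr !scalerA (mulrC l).
      by rewrite -[RHS]addrA -opprD; congr (y - _); rewrite opprD addrACA.
    have : d <= nrm (r - t%:C%C *: b u) by rewrite -e dS.
    move=> h; rewrite ler_pXn2r ?nnegrE ?nrm_ge0//.
    exact: le_trans rd h.
  have [Dr ar] : D r /\ a r = (l^*)%C *: r.
    apply: sa_max => u Du; rewrite -rip_conj.
    by have := ro u Du; rewrite /b !ripE; lra.
  exists x => //; rewrite -/(b x); apply/esym/eqP; rewrite -subr_eq0.
  by apply/eqP/(hl r).
- exists c^-1 => v Dv; rewrite !nrmE -rmorphM lecR.
  by rewrite ler_pdivlMl//; exact: hc.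
Qed.

(** The cross term <(Re l - a) v, i v> is imaginary by symmetry of a. *)
Lemma nonreal_lower_bound l v : D v ->
  nrm (l *: v - a v) ^+ 2 =
  nrm ((complex.Re l)%:C%C *: v - a v) ^+ 2 + (complex.Im l * nrm v) ^+ 2.
Proof.
move=> Dv; case: l => s t /=.
have -> : (s +i* t)%C *: v = s%:C%C *: v + t%:C%C *: ('i%C *: v).
  rewrite scalerA -scalerDl; congr (_ *: _).
  by apply/eqP; rewrite eq_complex /=; apply/andP; split; apply/eqP; ring.
have h1 : rip v ('i%C *: v) = 0.
  by rewrite !ripRe ipZr (ipxx ip_norm) /= mul0r mulr0 subrr.
have h2 : rip (a v) ('i%C *: v) = 0.
  have := sa_sym Dv Dv; rewrite !ripRe ipZr [RHS]ipC.
  by case: (ip (a v) v) => p q [] /=; lra.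
have h3 : rip ('i%C *: v) ('i%C *: v) = nrm v ^+ 2.
  rewrite !ripRe ipZr ipZl (ipxx ip_norm) /=; ring.
rewrite exprMn -h3 -!ripxx !ripE (ripC _ ('i%C *: v) v) (ripC _ ('i%C *: v) (a v)) h1 h2.
by ring.
Qed.

Lemma nonreal_regular l : complex.Im l != 0 -> regular_value a l.
Proof.
move=> l0.
have h k v : complex.Im k != 0 -> D v -> `|complex.Im k| * nrm v <= nrm (k *: v - a v).
  move=> k0 Dv; rewrite -(@ler_pXn2r _ 2) ?nnegrE ?mulr_ge0 ?nrm_ge0//.
  rewrite nonreal_lower_bound// !exprMn real_normK ?num_real//.
  by rewrite lerDr sqr_ge0.
apply: (@regular_value_of_lower_bound _ `|complex.Im l|).
- by rewrite normr_gt0.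
- by move=> v; exact: h.
- move=> w Dw aw; have := h (l^*)%C w; rewrite aw subrr nrm0.
  have -> : complex.Im (l^*)%C = - complex.Im l by case: (l).
  rewrite oppr_eq0 normrN => /(_ l0 Dw); rewrite pmulr_rle0 ?normr_gt0// => h1.
  by apply: nrm_eq0; apply/eqP; rewrite eq_le h1 nrm_ge0.
Qed.

Lemma spectrum_real l : spectrum a l -> l = (complex.Re l)%:C%C.
Proof.
case: l => s t h; have [->//|t0] := eqVneq t 0.
by exfalso; apply: h; exact: nonreal_regular.
Qed.

(** For real t the lower bound also excludes eigenvectors for the conjugate of
    t, which is t itself. *)
Lemma real_regularP (t : R) : regular_value a t%:C%C <->
  exists2 c : R, 0 < c & forall v, D v -> c * nrm v <= nrm (a v - t%:C%C *: v).
Proof.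
split=> [[_ _ [M hM]]|[c c0 hc]].
- exists (`|M| + 1)^-1; first by rewrite invr_gt0 ltr_wpDl.
  move=> v Dv; rewrite ler_pdivrMl ?ltr_wpDl// nrmBC.
  have := hM v Dv; rewrite !nrmE -rmorphM lecR => h; apply: le_trans h _.
  apply: ler_wpM2r; first exact: nrm_ge0.
  by have := ler_norm M; lra.
- apply: (@regular_value_of_lower_bound _ c) => //.
    by move=> v Dv; rewrite nrmBC; exact: hc.
  move=> w Dw aw; have := hc w Dw.
  have -> : a w = t%:C%C *: w.
    by rewrite aw; congr (_ *: _); apply/eqP; rewrite eq_complex /= oppr0 !eqxx.
  rewrite subrr nrm0 pmulr_rle0// => h1.
  by apply: nrm_eq0; apply/eqP; rewrite eq_le h1 nrm_ge0.
Qed.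

(** The sign is that of (a - l)^-1, opposite to the one in [regular_value]. *)
Definition resolvent l J := forall y, D (J y) /\ a (J y) - l *: J y = y.

Lemma resolvent_ex l : complex.Im l != 0 -> exists J, resolvent l J.
Proof.
move=> /nonreal_regular[_ sur _].
have h y : {v | D v /\ a v - l *: v = y}.
  apply: cid; have [v Dv e] := sur (- y) I.
  by exists v; split=> //; rewrite -opprB e opprK.
by exists (fun y => sval (h y)) => y; exact: (svalP (h y)).
Qed.

Section Resolvent.
Variables (l : R[i]) (J : H -> H).
Hypothesis l0 : complex.Im l != 0.
Hypothesis JP : resolvent l J.

Lemma resD y : D (J y). Proof. by case: (JP y). Qed.
Lemma resE y : a (J y) - l *: J y = y. Proof. by case: (JP y). Qed.
Lemma aresE y : a (J y) = y + l *: J y. Proof. by rewrite -{2}(resE y) subrK. Qed.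

Lemma res_inj v : D v -> a v = l *: v -> v = 0.
Proof.
move=> Dv av; have [inj _ _] := nonreal_regular l0.
apply: inj; rewrite ?inE//; first exact: dom0.
by rewrite av subrr scaler0 app0 subrr.
Qed.

Lemma resK v : D v -> J (a v - l *: v) = v.
Proof.
move=> Dv; apply/eqP; rewrite -subr_eq0; apply/eqP/res_inj.
  by apply: domB => //; exact: resD.
rewrite appB//; last exact: resD.
by rewrite aresE scalerBr [RHS]addrC addrAC (addrAC (a v)) subrr add0r.
Qed.

Lemma res_lin : linear J.
Proof.
move=> k x y; rewrite -[RHS]resK; last first.
  by apply: domD; [apply: domZ|]; exact: resD.
congr J; rewrite appD ?appZ; try by [exact: resD|apply: domZ; exact: resD].
by rewrite !aresE !scalerDr !scalerA (mulrC k) addrACA addrK.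
Qed.

Lemma res_nrm y : `|complex.Im l| * nrm (J y) <= nrm y.
Proof.
rewrite -(@ler_pXn2r _ 2) ?nnegrE ?mulr_ge0 ?nrm_ge0//.
have := nonreal_lower_bound l (resD y).
rewrite -(nrmBC (a _)) resE => ->; rewrite !exprMn real_normK ?num_real//.
by rewrite lerDr sqr_ge0.
Qed.

Lemma res_bop : bounded_operator J.
Proof.
apply/bounded_opP; split; first exact: res_lin.
exists `|complex.Im l|^-1; first by rewrite invr_ge0.
by move=> x; rewrite ler_pdivlMl ?normr_gt0// res_nrm.
Qed.

(** The domain of a is the range of J, so commuting with J controls the domain as
    well. *)
Lemma res_commutantP c : bounded_operator c ->
  (op_commutant a c <-> commutes c J).
Proof.
move=> bc; have [lc _] := bc; split=> [[_ h] x|h].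
- have [DcJ e] := h _ (resD x).
  rewrite -[LHS]resK//; congr J.
  by rewrite -e aresE (linD lc) (linZ lc) addrK.
- split=> // v Dv.
  have e : c v = J (c (a v - l *: v)) by rewrite -h resK.
  split; first by rewrite e; exact: resD.
  rewrite [in RHS]e aresE -e -(linZ lc) -(linD lc); congr c.
  by rewrite subrK.
Qed.

Lemma res_commutant : op_commutant a J.
Proof. by apply/res_commutantP => //; exact: res_bop. Qed.

End Resolvent.

(** Symmetry of a moves l to its conjugate across the inner product. *)
Lemma res_adjoint l J J' : resolvent l J -> resolvent (l^*)%C J' ->
  forall x y, rip (J' x) y = rip x (J y).
Proof.
move=> JP JP' x y.
rewrite -{1}(resE JP y) -{2}(resE JP' x) !ripE.
rewrite sa_symR; [|exact: (resD JP')|exact: (resD JP)].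
rewrite rip_conj; congr (_ - rip _ (_ *: _)).
by case: (l) => p q /=; rewrite opprK.
Qed.

Lemma dense_op0 f : bounded_operator f -> (forall v, D v -> f v = 0) ->
  forall x, f x = 0.
Proof.
move=> bf h x; have [v Dv vx] := dense_seq a_dense x.
apply: (cvgH_uniq (cvgH_op bf vx)).
rewrite /cvgH; under eq_fun do rewrite h//.
exact: cvgH_cst.
Qed.

Lemma commutant_lim (p : nat -> H -> H) q : (forall n, op_commutant a (p n)) ->
  bounded_operator q -> (forall x, cvgH (p^~ x) (q x)) -> op_commutant a q.
Proof.
move=> pa bq pq; split=> // v Dv.
have [|||Dq aq] := @sa_closed (p^~ v) (q v) (q (a v)) => //.
  by move=> n; have [_ /(_ v Dv)[]] := pa n.
apply: (cvgH_le (pq (a v))) => n.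
by have [_ /(_ v Dv)[_ <-]] := pa n.
Qed.

(** E splits H into a part where the form of a is at most t and a part where it
    exceeds t. The last, strict clause assigns a possible eigenvalue t to the first
    part and makes E unique. *)
Definition cut (t : R) E := [/\ proj E, op_commutant a E,
  forall v, D v -> E v = v -> rip (a v) v <= t * nrm v ^+ 2,
  forall v, D v -> E v = 0 -> t * nrm v ^+ 2 <= rip (a v) v
  & forall v, D v -> E v = 0 -> rip (a v) v = t * nrm v ^+ 2 -> v = 0].

Lemma Imi_neq0 : complex.Im ('i%C : R[i]) != 0.
Proof. by rewrite /= oner_eq0. Qed.
Lemma Imci_neq0 : complex.Im (('i%C : R[i])^*)%C != 0.
Proof. by rewrite /= oppr_eq0 oner_eq0. Qed.

(** The negative projection of T = J' (a - t) J, where J' is the resolvent at the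
    conjugate point and so the adjoint of J. With v = J x this gives
    <T x, x> = <(a - t) v, v>, and the sign properties of T become those of a - t. *)
Lemma cut_ex t : exists E, cut t E /\ forall c, op_commutant a c -> commutes c E.
Proof.
have [J JP] := resolvent_ex Imi_neq0.
have [J' JP'] := resolvent_ex Imci_neq0.
have bJ := res_bop Imi_neq0 JP; have bJ' := res_bop Imci_neq0 JP'.
pose T x := J' (x + ('i%C - t%:C%C) *: J x).
have TE x : T x = J' (a (J x) - t%:C%C *: J x).
  by rewrite /T (aresE JP) scalerBl addrA.
have bT : bounded_operator T by apply: bop_comp => //; apply: bop_lin => //; exact: bop_id.
have sT : symop T.
  move=> x y; rewrite !TE (res_adjoint JP JP') [RHS]ripC (res_adjoint JP JP').
  rewrite [RHS]ripC !ripE (sa_symR (resD JP x) (resD JP y)); congr (_ - _).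
have cT c : op_commutant a c -> commutes c T.
  move=> ca x; have bc : bounded_operator c by case: ca.
  have [lc _] := bc.
  have cJ := (res_commutantP Imi_neq0 JP bc).1 ca.
  have cJ' := (res_commutantP Imci_neq0 JP' bc).1 ca.
  by rewrite /T cJ' (linD lc) (linZ lc) cJ.
have [E [pE Eneg Epos Estr cE]] := sign_projection ip_norm bT sT.
have bE : bounded_operator E by case: pE.
have EJ : commutes J E by apply: cE => //; apply: cT; exact: (res_commutant Imi_neq0 JP).
have Ea : op_commutant a E by apply/(res_commutantP Imi_neq0 JP bE) => x; rewrite EJ.
have lE := proj_lin pE.
pose x v := a v - 'i%C *: v.
have Tx v : D v -> rip (T (x v)) (x v) = rip (a v) v - t * nrm v ^+ 2.
  move=> Dv; rewrite TE (resK Imi_neq0 JP Dv) (res_adjoint JP JP').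
  by rewrite (resK Imi_neq0 JP Dv) !ripE ripxx.
have Ex v : D v -> E (x v) = x (E v).
  by move=> Dv; rewrite /x (linB lE) (linZ lE); have [_ /(_ v Dv)[_ ->]] := Ea.
exists E; split; last by move=> c ca; apply: cE; [case: ca|exact: cT].
split => //.
- move=> v Dv Ev; have := Eneg (x v); rewrite Ex// Ev Tx// => /(_ erefl); lra.
- move=> v Dv Ev; have := Epos (x v); rewrite Ex// Ev Tx// /x scaler0 (app0) subr0.
  by move=> /(_ erefl); lra.
- move=> v Dv Ev eq; rewrite -(resK Imi_neq0 JP Dv).
  rewrite -/(x v) (Estr (x v)) ?(lin0 (res_lin Imi_neq0 JP))//.
    by rewrite Ex// Ev /x scaler0 app0 subr0.
  by rewrite Tx// eq subrr.
Qed.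

(** For v in the domain, w = E (v - F v) lies in the range of E, where the form is
    at most s |w|^2, and in the kernel of F, where it is at least t |w|^2; so w = 0
    by the strict clause. *)
Lemma cut_le s t E F : s <= t -> cut s E -> cut t F -> commutes E F ->
  forall x, E (F x) = E x.
Proof.
move=> st [pE Ea En _ _] [pF Fa _ Fp Fs] EF x.
have lE := proj_lin pE; have lF := proj_lin pF.
apply/eqP; rewrite eq_sym -subr_eq0; apply/eqP.
apply: (@dense_op0 (fun x => E x - E (F x))) => {x}.
  by apply: bop_sub; [case: pE|apply: bop_comp; [case: pE|case: pF]].
move=> v Dv; rewrite -(linB lE); set w := E _.
have DF : D (F v) by have [_ /(_ v Dv)[]] := Fa.
have Dw : D w by have [_ /(_ (v - F v) (domB Dv DF))[]] := Ea.
have Ew : E w = w by rewrite /w (projK _ pE).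
have Fw : F w = 0 by rewrite /w -EF (linB lF) (projK _ pF) subrr (lin0 lE).
have h1 := En w Dw Ew; have h2 := Fp w Dw Fw.
apply: Fs => //; apply/eqP; rewrite eq_le h2 andbT; apply: le_trans h1 _.
by rewrite ler_wpM2r// sqr_ge0.
Qed.

Lemma cut_uniq t E F : cut t E -> cut t F -> commutes E F -> E =1 F.
Proof.
move=> hE hF EF x; rewrite -(cut_le (lexx t) hE hF EF) EF.
by rewrite (cut_le (lexx t) hF hE).
Qed.

Definition spectral_family t : H -> H := sval (cid (cut_ex t)).
Local Notation E := spectral_family.

Lemma family_cut t : cut t (E t).
Proof. by have [] := svalP (cid (cut_ex t)). Qed.

Lemma family_bicommutant t c : op_commutant a c -> commutes c (E t).
Proof. by have [_] := svalP (cid (cut_ex t)); apply. Qed.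

Lemma family_proj t : proj (E t). Proof. by case: (family_cut t). Qed.
Lemma family_commutant t : op_commutant a (E t).
Proof. by case: (family_cut t). Qed.
Lemma family_commutes s t : commutes (E s) (E t).
Proof. exact: family_bicommutant (family_commutant s). Qed.

Lemma family_le s t x : s <= t -> E s (E t x) = E s x.
Proof.
by move=> st; apply: (cut_le st (family_cut _) (family_cut _)); exact: family_commutes.
Qed.
Lemma family_ge s t x : s <= t -> E t (E s x) = E s x.
Proof. by move=> st; rewrite family_commutes family_le. Qed.

Lemma family_uniq t F : cut t F -> F =1 E t.
Proof.
move=> hF; apply: (cut_uniq hF (family_cut t)).
by apply: family_bicommutant; case: hF.
Qed.

Lemma harmonic_le (m n : nat) : (m <= n)%N -> n.+1%:R^-1 <= m.+1%:R^-1 :> R.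
Proof. by move=> mn; rewrite lef_pV2 ?posrE ?ltr0n// ler_nat. Qed.

(** The limit q of E (t + 1/n) is itself a cut at t, hence equals E t. *)
Lemma family_right_continuous t x : cvgH (fun n => E (t + n.+1%:R^-1) x) (E t x).
Proof.
have [||q pq qP] := @decreasing_projections _ _ _ ip_norm (fun n => E (t + n.+1%:R^-1)).
- by move=> n; exact: family_proj.
- by move=> m n y mn; apply: family_ge; rewrite lerD2l harmonic_le.
have qa : op_commutant a q.
  apply: commutant_lim qP; last by case: pq.
  by move=> n; exact: family_commutant.
have Eq y : E t (q y) = E t y.
  have h := cvgH_op (proj_bop (family_proj t)) (qP y).
  apply: (cvgH_uniq h).
  rewrite /cvgH; under eq_fun do rewrite family_le ?lerDl ?invr_ge0//.
  exact: cvgH_cst.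
have qE n y : E (t + n.+1%:R^-1) (q y) = q y.
  have h := cvgH_op (proj_bop (family_proj (t + n.+1%:R^-1))) (qP y).
  apply: (cvgH_uniq h); have := qP y.
  move=> /cvgHP qy; apply/cvgHP => e /qy[N hN]; exists (maxn N n) => m.
  rewrite geq_max => /andP[Nm nm].
  by rewrite family_ge ?lerD2l ?harmonic_le// hN.
suff hq : cut t q by have := qP x; rewrite (family_uniq hq).
split => //.
- move=> v Dv qv.
  have h1 : (fun n => (t + n.+1%:R^-1) * nrm v ^+ 2) @ \oo --> (t + 0) * nrm v ^+ 2.
    apply: cvgM; last exact: cvg_cst.
    by apply: cvgD; [exact: cvg_cst|exact: cvg_harmonic].
  rewrite -[X in X * _]addr0.
  apply: (@ler_cvg_to _ _ _ _ _ _ _ _ (cvg_cst _) h1); apply: nearW => n.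
  have [_ _ h _ _] := family_cut (t + n.+1%:R^-1); apply: h => //.
  by rewrite -{1}qv qE.
- move=> v Dv qv; have [_ _ _ h _] := family_cut t; apply: h => //.
  by rewrite -Eq qv (lin0 (proj_lin (family_proj t))).
- move=> v Dv qv; have [_ _ _ _ h] := family_cut t; apply: h => //.
  by rewrite -Eq qv (lin0 (proj_lin (family_proj t))).
Qed.

(** A vector w of the domain in the kernel of all E n would satisfy
    n |w|^2 <= <a w, w> for every n. *)
Lemma family_pinfty x : cvgH (fun n => E n%:R x) x.
Proof.
have [||q pq qP] := @increasing_projections _ _ _ ip_norm (fun n => E n%:R).
- by move=> n; exact: family_proj.
- by move=> m n y mn; apply: family_le; rewrite ler_nat.
have qa : op_commutant a q.
  apply: commutant_lim qP; last by case: pq.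
  by move=> n; exact: family_commutant.
have Eq n y : E n%:R (q y) = E n%:R y.
  have h := cvgH_op (proj_bop (family_proj n%:R)) (qP y).
  apply: (cvgH_uniq h); apply/cvgHP => e e0; exists n => m nm.
  by rewrite family_le ?ler_nat// subrr nrm0.
suff q1 y : q y = y by rewrite -{2}(q1 x).
apply/eqP; rewrite eq_sym -subr_eq0; apply/eqP.
apply: (@dense_op0 (fun y => y - q y)) => {y}.
  by apply: bop_sub; [exact: bop_id|case: pq].
move=> v Dv; set w := v - q v.
have Dw : D w by apply: domB => //; have [_ /(_ v Dv)[]] := qa.
have Ew n : E n%:R w = 0.
  by rewrite /w (linB (proj_lin (family_proj _))) Eq subrr.
apply: nrm_eq0; apply/eqP; rewrite -sqrf_eq0; apply/negPn/negP => w0.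
have w1 : 0 < nrm w ^+ 2 by rewrite lt_neqAle eq_sym w0 sqr_ge0.
have h n : n%:R * nrm w ^+ 2 <= rip (a w) w.
  by have [_ _ _ h _] := family_cut n%:R; apply: h.
have := h (Num.truncn (rip (a w) w / nrm w ^+ 2)).+1.
by rewrite -ler_pdivlMr// leNgt truncnS_gt.
Qed.

Lemma family_ninfty x : cvgH (fun n => E (- n%:R) x) 0.
Proof.
have [||q pq qP] := @decreasing_projections _ _ _ ip_norm (fun n => E (- n%:R)).
- by move=> n; exact: family_proj.
- by move=> m n y mn; apply: family_ge; rewrite lerN2 ler_nat.
have qa : op_commutant a q.
  apply: commutant_lim qP; last by case: pq.
  by move=> n; exact: family_commutant.
have Eq n y : E (- n%:R) (q y) = q y.
  have h := cvgH_op (proj_bop (family_proj (- n%:R))) (qP y).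
  apply: (cvgH_uniq h); have := qP y.
  move=> /cvgHP qy; apply/cvgHP => e /qy[N hN]; exists (maxn N n) => m.
  by rewrite geq_max => /andP[Nm nm]; rewrite family_ge ?lerN2 ?ler_nat// hN.
suff q1 y : q y = 0 by rewrite -(q1 x).
apply: (@dense_op0 q) => {y}; first by case: pq.
move=> v Dv; set w := q v.
have Dw : D w by have [_ /(_ v Dv)[]] := qa.
have Ew n : E (- n%:R) w = w by rewrite /w Eq.
apply: nrm_eq0; apply/eqP; rewrite -sqrf_eq0; apply/negPn/negP => w0.
have w1 : 0 < nrm w ^+ 2 by rewrite lt_neqAle eq_sym w0 sqr_ge0.
have h n : rip (a w) w <= - n%:R * nrm w ^+ 2.
  by have [_ _ h _ _] := family_cut (- n%:R); apply: h.
have := h (Num.truncn (- rip (a w) w / nrm w ^+ 2)).+1.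
by rewrite mulNr lerNr -ler_pdivlMr// leNgt truncnS_gt.
Qed.

(** On the range of E t - E s the form of S = a - m, with m the midpoint, is
    bounded by d = (t - s) / 2. The parallelogram identity turns this into
    2 Re <S w, u> <= d (|w|^2 + |u|^2); by density it also holds for u = S w / d,
    which need not lie in the domain. *)
Lemma family_window s t w : s < t -> D w -> E t w = w -> E s w = 0 ->
  nrm (a w - ((s + t) / 2)%:C%C *: w) <= (t - s) / 2 * nrm w.
Proof.
move=> st Dw Etw Esw.
set m := (s + t) / 2; set d := (t - s) / 2.
have d0 : 0 < d by rewrite divr_gt0// subr_gt0.
have [pt [bt at_] hneg _ _] := family_cut t.
have [ps [bs as_] _ hpos _] := family_cut s.
have lt := proj_lin pt; have ls := proj_lin ps.
pose S v := a v - m%:C%C *: v.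
have SK u : D u -> E t u = u -> E s u = 0 -> `|rip (S u) u| <= d * nrm u ^+ 2.
  move=> Du /(hneg _ Du) h1 /(hpos _ Du) h2.
  rewrite /S !ripE ripxx ler_norml /m /d; apply/andP; split; lra.
have pol u : D u -> E t u = u -> E s u = 0 ->
    2 * rip (S w) u <= d * (nrm w ^+ 2 + nrm u ^+ 2).
  move=> Du Etu Esu.
  have := SK (w + u); have := SK (w - u).
  rewrite (linB lt) (linB ls) (linD lt) (linD ls) Etu Etw Esu Esw subr0 addr0.
  move=> /(_ (domB Dw Du) erefl erefl) h1 /(_ (domD Dw Du) erefl erefl) h2.
  move: h1 h2; rewrite /S !ler_norml => /andP[h1 _] /andP[_ h2].
  move: h1 h2; rewrite appB// appD//.
  rewrite -!ripxx !ripE (sa_symR Du Dw) (ripC _ u (a w)) (ripC _ u w); lra.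
pose P z := E t z - E s z.
have PK z : E t (P z) = P z /\ E s (P z) = 0.
  rewrite /P (linB lt) (linB ls) (projK z pt) (projK z ps).
  by rewrite family_ge ?(ltW st)// family_le ?(ltW st)// subrr.
have bP : bounded_operator P by exact: bop_sub.
have PD z : D z -> D (P z).
  by move=> Dz; apply: domB; [have [] := at_ z Dz|have [] := as_ z Dz].
have polK y : P y = y -> 2 * rip (S w) y <= d * (nrm w ^+ 2 + nrm y ^+ 2).
  move=> Py; have [u Du uy] := dense_seq a_dense y.
  have Puy := cvgH_op bP uy; rewrite Py in Puy.
  have h1 : (fun n => 2 * rip (S w) (P (u n))) @ \oo --> 2 * rip (S w) y.
    by apply: cvgM; [exact: cvg_cst|exact: (cvgH_rip ip_norm (cvgH_cst _) Puy)].
  have h2 : (fun n => d * (nrm w ^+ 2 + rip (P (u n)) (P (u n)))) @ \oo -->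
     d * (nrm w ^+ 2 + rip y y).
    apply: cvgM; [exact: cvg_cst|apply: cvgD; first exact: cvg_cst].
    exact: (cvgH_rip ip_norm Puy Puy).
  rewrite -(ripxx y).
  apply: (@ler_cvg_to _ _ _ _ _ _ _ _ h1 h2); apply: nearW => n.
  by rewrite ripxx; apply: pol; [exact: PD|case: (PK (u n))|case: (PK (u n))].
have SwK : P (S w) = S w.
  rewrite /P /S (linB lt) (linB ls) (linZ lt) (linZ ls) (at_ w Dw).2 (as_ w Dw).2.
  by rewrite Etw Esw scaler0 app0 !subr0.
(* u = S w / d balances the two squares on the right-hand side *)
have := polK ((d^-1)%:C%C *: S w).
rewrite (linZ bP.1) SwK => /(_ erefl).
rewrite ripZr ripxx nrmZR ger0_norm ?invr_ge0 ?(ltW d0)// => h.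
rewrite -/(S w) -(@ler_pXn2r _ 2) ?nnegrE ?nrm_ge0//; last first.
  by rewrite mulr_ge0 ?nrm_ge0 ?(ltW d0).
move: h; move: (nrm (S w)) => n; rewrite exprMn => h.
have h2 : d * (2 * (d^-1 * n ^+ 2)) <= d * (d * (nrm w ^+ 2 + d^-1 ^+ 2 * n ^+ 2)).
  by rewrite ler_pM2l.
have e1 : d * (2 * (d^-1 * n ^+ 2)) = 2 * n ^+ 2 by field; rewrite gt_eqF.
have e2 : d * (d * (nrm w ^+ 2 + d^-1 ^+ 2 * n ^+ 2)) = d ^+ 2 * nrm w ^+ 2 + n ^+ 2.
  by field; rewrite gt_eqF.
by rewrite exprMn; rewrite e1 e2 in h2; lra.
Qed.

(** If |(a - t0) v| >= c |v|, then by [family_window] the range of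
    E (t0 + c/4) - E (t0 - c/4) meets the domain only in 0; by density it is 0. *)
Lemma family_const_near_regular (t0 : R) : regular_value a t0%:C%C ->
  exists2 e : R, 0 < e & E (t0 - e) =1 E (t0 + e).
Proof.
move=> /real_regularP[c c0 hc].
have c4 : 0 < c / 4 by rewrite divr_gt0.
exists (c / 4) => // x; apply/eqP; rewrite eq_sym -subr_eq0; apply/eqP.
have st : t0 - c / 4 < t0 + c / 4 by lra.
set s := t0 - c / 4 in st *; set t := t0 + c / 4 in st *.
have pt := family_proj t; have ps := family_proj s.
apply: (@dense_op0 (fun x => E t x - E s x)) => {x}.
  by apply: bop_sub; [case: pt|case: ps].
move=> v Dv; set w := E t v - E s v.
have Dw : D w.
  apply: domB; first by have [_ /(_ v Dv)[]] := family_commutant t.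
  by have [_ /(_ v Dv)[]] := family_commutant s.
have := family_window st Dw.
have -> : (s + t) / 2 = t0 by rewrite /s /t; field.
have -> : (t - s) / 2 = c / 4 by rewrite /s /t; field.
rewrite {1 2 3}/w (linB (proj_lin pt)) (linB (proj_lin ps)) !(projK _ pt, projK _ ps).
rewrite family_ge ?(ltW st)// family_le ?(ltW st)// subrr => /(_ erefl erefl).
have := hc w Dw; have := nrm_ge0 w => h1 h2 h3.
by apply: nrm_eq0; apply/eqP; rewrite eq_le h1 andbT; nra.
Qed.

End SelfAdjoint.

(** * From spectral families to projection-valued measures on the line *)

Lemma stieltjes_measure (R : realType) (f : R -> R) : nondecreasing f ->
  right_continuous f ->
  exists mu : {measure set (measurableTypeR R) -> \bar R},
    forall s t, s <= t -> mu `]s, t]%classic = (f t - f s)%:E.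
Proof.
move=> nd rc.
pose F : cumulative R R := HB.pack f (isCumulative.Build R _ R f nd rc).
exists (lebesgue_stieltjes_measure F) => s t st.
transitivity (wlength F `]s, t]%classic).
  by apply: measurable_mu_extE; exact: is_ocitv.
by rewrite wlength_itv_bnd.
Qed.

Lemma measurableR_gen (R : realType) :
  @measurable _ (measurableTypeR R) = <<s @RGenOInfty.G R >>.
Proof. exact: RGenOInfty.measurableE. Qed.

Section ProjectionValuedMeasure.
Context {R : realType} {H : completeNormedModType R[i]}.
Variable ip : {dot H for Num.conj}.
Hypothesis ip_norm : forall x : H, `|x| ^+ 2 = ip x x.
Implicit Types (x y z : H) (p q : H -> H) (B : set (measurableTypeR R)).
Local Notation rip := (rip ip).
Local Notation proj := (orthogonal_projection ip).
Let ripxx := ripxx ip_norm.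

Lemma projD p q : proj p -> proj q -> (forall x, p (q x) = 0) -> proj (fun x => p x + q x).
Proof.
move=> pp pq pq0; apply: (proj_of_rip ip_norm).
- by move=> k x y; rewrite (proj_lin pp k) (proj_lin pq k) scalerDr addrACA.
- by move=> x y; rewrite !ripE (proj_sym pp) (proj_sym pq).
- move=> x; have c0 : rip (p x) (q x) = 0 by rewrite (proj_sym pp) pq0 rip0r.
  rewrite !ripE (ripC _ (q x) (p x)) c0 !ripxx -!(proj_rip ip_norm)//; lra.
Qed.

Lemma proj0 : proj (fun=> 0).
Proof.
apply: (proj_of_rip ip_norm) => [k x y|x y|x]; rewrite ?scaler0 ?addr0//.
  by rewrite !ripE.
by rewrite !ripE.
Qed.

Lemma measureC_fin d (T : measurableType d) (mu : {measure set T -> \bar R}) (c : R)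
  (S : set T) (r : R) : measurable S -> mu [set: T] = c%:E -> mu S = r%:E ->
  mu (~` S) = (c - r)%:E.
Proof.
move=> mS mT mSr.
have : mu [set: T] = (mu S + mu (~` S))%E.
  rewrite -measureU//; [by rewrite setUv|exact: measurableC|by rewrite setICr].
rewrite mT mSr; case: (mu (~` S)) => //= s [->].
by congr (_%:E); ring.
Qed.

(** The vector y uses up the whole mass of mu on B', so the mass of B, which is
    |p y|^2, is 0. *)
Lemma disjoint_projections d (T : measurableType d) (mu : {measure set T -> \bar R})
    (B B' : set T) p p' y : measurable B -> measurable B' -> B `&` B' = set0 ->
  proj p -> proj p' -> p' y = y -> mu [set: T] = (nrm y ^+ 2)%:E ->
  mu B = (rip (p y) y)%:E -> mu B' = (rip (p' y) y)%:E -> p y = 0.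
Proof.
move=> mB mB' BB' pp pp' p'y muT mup mup'.
have : (mu (B `|` B') <= mu setT)%E by apply: le_measure; rewrite ?inE//; exact: measurableU.
have -> : mu (B `|` B') = (mu B + mu B')%E by rewrite measureU.
rewrite muT mup mup' -EFinD lee_fin.
rewrite (proj_rip ip_norm)// (proj_rip ip_norm)// p'y.
rewrite gerDr => h; apply/nrm_eq0/eqP; rewrite -sqrf_eq0.
by rewrite eq_le h sqr_ge0.
Qed.

Section Family.
Variable E : R -> H -> H.
Hypothesis E_proj : forall t, proj (E t).
Hypothesis E_le : forall s t x, s <= t -> E s (E t x) = E s x.
Hypothesis E_right : forall t x, cvgH (fun n => E (t + n.+1%:R^-1) x) (E t x).
Hypothesis E_pinfty : forall x, cvgH (fun n => E n%:R x) x.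
Hypothesis E_ninfty : forall x, cvgH (fun n => E (- n%:R) x) 0.

Let F x t : R := nrm (E t x) ^+ 2.

Let FE x t : F x t = rip (E t x) x.
Proof. by rewrite (proj_rip ip_norm). Qed.

Let F_nd x : nondecreasing (F x).
Proof.
move=> s t st; rewrite /F -(E_le x st) ler_pXn2r ?nnegrE ?nrm_ge0//.
exact: proj_nrm.
Qed.

Let cvg_sq (u : nat -> H) x : cvgH u x ->
  (fun n => nrm (u n) ^+ 2) @ \oo --> nrm x ^+ 2.
Proof.
move=> ux; rewrite -ripxx; under eq_fun do rewrite -ripxx.
exact: (cvgH_rip ip_norm).
Qed.

Let F_rc x : right_continuous (F x).
Proof.
move=> t; apply/cvgrPdist_lt => e e0.
have /cvgrPdist_lt/(_ e e0)[N _ hN] := cvg_sq (E_right t x).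
have hN' := hN N (leqnn N).
near=> s; apply: le_lt_trans hN'.
have ts : t <= s by near: s; exact: nbhs_right_ge.
have sN : s <= t + N.+1%:R^-1.
  by near: s; apply: nbhs_right_le; rewrite ltrDl invr_gt0.
have h1 := F_nd x ts; have h2 := F_nd x sN.
rewrite distrC ger0_norm ?subr_ge0// distrC ger0_norm ?subr_ge0; last first.
  exact: le_trans h1 h2.
by rewrite lerB.
Unshelve. all: by end_near.
Qed.

Let mu_ex x : exists mu : {measure set (measurableTypeR R) -> \bar R},
  mu [set: R] = (nrm x ^+ 2)%:E /\
  forall t, mu `]t, +oo[%classic = (rip (x - E t x) x)%:E.
Proof.
have [mu hmu] := stieltjes_measure (F_nd x) (@F_rc x).
have ub t : mu `]t, +oo[%classic = (nrm x ^+ 2 - F x t)%:E.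
  pose I n : set R := `]t, t + n%:R]%classic.
  have cupI : \bigcup_n I n = `]t, +oo[%classic.
    apply/seteqP; split=> [s [n _]|s] /=; rewrite /I /= !in_itv /= ?andbT.
      by case/andP.
    move=> ts; exists (Num.truncn (s - t)).+1 => //=.
    rewrite in_itv /= ts /= -lerBlDl ltW// truncnS_gt//.
  have mI n : measurable (I n : set (measurableTypeR R)) by exact: measurable_itv.
  have : mu (I n) @[n --> \oo] --> mu (\bigcup_n I n).
    apply: nondecreasing_cvg_mu => //; first exact: bigcup_measurable.
    by move=> m n mn; apply/subsetPset/subset_itv; rewrite // leBSide/= lerD2l ler_nat.
  rewrite cupI => h1.
  have h2 : mu (I n) @[n --> \oo] --> (nrm x ^+ 2 - F x t)%:E.
    have -> : (fun n => mu (I n)) = (fun n => (F x (t + n%:R) - F x t)%:E).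
      by apply/funext => n; rewrite hmu// lerDl.
    apply: cvg_EFin; first exact: nearW.
    apply: cvgB; last exact: cvg_cst.
    have /cvgrPdist_lt hF := cvg_sq (E_pinfty x).
    apply/cvgrPdist_lt => e /hF[N _ hN].
    exists (N + (Num.truncn (- t)).+1)%N => // n /= nN.
    apply: le_lt_trans (hN N (leqnn N)).
    have hE s : F x s <= nrm x ^+ 2.
      by rewrite /F ler_pXn2r ?nnegrE ?nrm_ge0//; exact: proj_nrm.
    rewrite !ger0_norm ?subr_ge0 ?hE// lerB// F_nd//.
    have : (N%:R + (Num.truncn (- t)).+1%:R <= n%:R :> R) by rewrite -natrD ler_nat.
    by have := truncnS_gt (- t); lra.
  exact: (cvg_unique _ h1 h2).
pose I n : set R := `]- n%:R, +oo[%classic.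
have cupI : \bigcup_n I n = [set: R].
  apply/seteqP; split=> // s _; exists (Num.truncn (- s)).+1 => //.
  by rewrite /I /= in_itv /= andbT ltrNl truncnS_gt.
have mI n : measurable (I n : set (measurableTypeR R)) by exact: measurable_itv.
exists mu; split=> [|t]; last first.
  by rewrite ub FE !ripE ripxx.
have : mu (I n) @[n --> \oo] --> mu (\bigcup_n I n).
  apply: nondecreasing_cvg_mu => //; first exact: bigcup_measurable.
  by move=> m n mn; apply/subsetPset/subset_itv; rewrite // leBSide/= lerN2 ler_nat.
rewrite cupI => h1.
have h2 : mu (I n) @[n --> \oo] --> (nrm x ^+ 2)%:E.
  under eq_fun do rewrite ub.
  apply: cvg_EFin; first exact: nearW.
  rewrite -[X in _ --> X]subr0; apply: cvgB; first exact: cvg_cst.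
  by have := cvg_sq (E_ninfty x); rewrite nrm0 expr0n.
exact: (cvg_unique _ h1 h2).
Qed.

Let good B p := [/\ proj p,
  forall c, bounded_operator c -> (forall t, commutes c (E t)) -> commutes c p
  & forall x, sval (cid (mu_ex x)) B = (rip (p x) x)%:E].

Let mu x := sval (cid (mu_ex x)).
Let muT x : mu x [set: R] = (nrm x ^+ 2)%:E.
Proof. by have [] := svalP (cid (mu_ex x)). Qed.
Let muI x t : mu x `]t, +oo[%classic = (rip (x - E t x) x)%:E.
Proof. by have [_] := svalP (cid (mu_ex x)). Qed.

Let good_setC B : measurable B -> (exists p, good B p) -> exists p, good (~` B) p.
Proof.
move=> mB [p [pp cp mup]]; exists (fun x => x - p x); split.
- exact: projC.
- by move=> c bc cE x; rewrite (linB bc.1) cp.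
- move=> x; rewrite !ripE ripxx.
  by have := measureC_fin mB (muT x) (mup x).
Qed.

Let good_bigcup (B : (set (measurableTypeR R))^nat) :
  (forall n, measurable (B n)) -> trivIset [set: nat] B ->
  (forall n, exists p, good (B n) p) -> exists p, good (\bigcup_n B n) p.
Proof.
move=> mB tB /choice[p gp].
have pp n : proj (p n) by case: (gp n).
have p0 m n x : m != n -> p m (p n x) = 0.
  move=> mn; have [_ _ gm] := gp m; have [_ _ gn] := gp n.
  apply: (disjoint_projections (mB m) (mB n) _ (pp m) (pp n) _ (muT _) (gm _) (gn _)).
    by move/trivIsetP : tB; apply.
  exact: projK.
pose S := fix S (n : nat) (x : H) {struct n} : H :=
  if n is k.+1 then S k x + p k x else 0.
have S0 n k x : (n <= k)%N -> p k (S n x) = 0.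
  elim: n k => [|n IH] k nk /=; first by rewrite (lin0 (proj_lin (pp k))).
  rewrite (linD (proj_lin (pp k))) IH 1?ltnW// p0 ?addr0//.
  by rewrite gtn_eqF.
have S0' n k x : (n <= k)%N -> S n (p k x) = 0.
  elim: n k => [//|n IH] k nk /=.
  rewrite IH 1?ltnW// p0 ?addr0//.
  by rewrite ltn_eqF.
have pS n : proj (S n).
  elim: n => [|n IH]; first exact: proj0.
  by apply: projD => // x; exact: S0'.
have SS m n x : (m <= n)%N -> S m (S n x) = S m x.
  move=> mn; rewrite -(subnK mn); elim: (n - m)%N => [|k IH].
    by rewrite (projK _ (pS m)).
  by rewrite addSn /= (linD (proj_lin (pS m))) IH S0' ?addr0// leq_addl.
have [q pq qP] := increasing_projections ip_norm pS SS.
exists q; split => //.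
- move=> c bc cE; apply: (lim_commutes bc) qP => n.
  elim: n => [|n IH] x /=; first by rewrite (lin0 bc.1).
  by rewrite (linD bc.1) IH; case: (gp n) => _ -> .
- move=> x.
  have h1 : (fun n => \sum_(0 <= i < n) mu x (B i))%E @ \oo --> mu x (\bigcup_n B n).
    exact: measure_sigma_additive mB tB.
  have h2 : (fun n => \sum_(0 <= i < n) mu x (B i))%E @ \oo --> (rip (q x) x)%:E.
    have -> : (fun n => \sum_(0 <= i < n) mu x (B i))%E = (fun n => (rip (S n x) x)%:E).
      apply/funext => n; elim: n => [|n IH]; first by rewrite big_geq// ripE.
      rewrite big_nat_recr//= IH ripDl EFinD; congr (_ + _)%E.
      by have [_ _ ->] := gp n.
    apply: cvg_EFin; first exact: nearW.
    exact: (cvgH_rip ip_norm (qP x) (cvgH_cst x)).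
  exact: (cvg_unique _ h1 h2).
Qed.

(** Dynkin induction on B. Complements are clear; for a disjoint union the
    projections are mutually orthogonal by [disjoint_projections], so their partial
    sums are increasing projections and converge. *)
Lemma projection_valued_measure : exists P : set (measurableTypeR R) -> H -> H,
  exists mu : H -> {measure set (measurableTypeR R) -> \bar R},
  [/\ forall B, measurable B -> proj (P B),
      forall B c, measurable B -> bounded_operator c ->
         (forall t, commutes c (E t)) -> commutes c (P B),
      forall B x, measurable B -> mu x B = (rip (P B x) x)%:E,
      forall x, mu x setT = (nrm x ^+ 2)%:E
    & forall t x, mu x `]t, +oo[%classic = (rip (x - E t x) x)%:E].
Proof.
have h B : exists p, measurable B -> good B p.
  have [mB|nB] := pselect (measurable B); last by exists id => /nB.
  suff [p hp] : exists p, good B p by exists p.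
  move: mB; rewrite measurableR_gen; move: B.
  apply: (@dynkin_induction _ (measurableTypeR R) (@RGenOInfty.G R)
    (fun B => exists p, good B p)).
  - exact: measurableR_gen.
  - move=> _ _ [s ->] [t ->]; exists (Num.max s t).
    apply/seteqP; split=> u /=; rewrite !in_itv/= !andbT gt_max.
      by case=> -> ->.
    by move=> /andP[].
  - exists id; split=> //; first exact: proj_id.
    by move=> x; rewrite [LHS]muT ripxx.
  - move=> _ [t ->]; exists (fun x => x - E t x); split.
    + exact: projC.
    + by move=> c bc cE x; rewrite (linB bc.1) cE.
    + by move=> x; exact: muI.
  - exact: good_setC.
  - exact: good_bigcup.
have [P hP] := choice h.
exists P, mu; split=> //.
- by move=> B /hP[].
- by move=> B c /hP[_ + _]; apply.
- by move=> B x /hP[_ _ h1]; exact: h1.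
Qed.

End Family.
End ProjectionValuedMeasure.

(** * Bounded functional calculus of a spectral measure *)

Import HBNNSimple.

(** Lets the set function [diag P x], meaningful on measurable sets only, be
    replaced by a measure under the integral. *)
Lemma eq_setfun_integral d (T : measurableType d) (R : realType)
    (mu nu : set T -> \bar R) D f : (forall A, measurable A -> mu A = nu A) ->
  (\int[mu]_(x in D) f x = \int[nu]_(x in D) f x)%E.
Proof.
move=> h.
suff e : forall g : {nnsfun T >-> R}, sintegral mu g = sintegral nu g.
  rewrite /integral; congr (ereal_sup _ - ereal_sup _)%E;
    by apply/seteqP; split=> _ [g gf <-]; exists g.
move=> g; rewrite !sintegralET; apply: eq_fsbigr => r _.
by rewrite h//; exact: measurable_funPTI.
Qed.

Section BoundedMeasurable.
Context {R : realType} d {T : measurableType d}.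
Implicit Types (g : T -> R).

(** The functions for which the calculus is defined; see [cbmeas] for complex
    values. *)
Definition bmeas g := measurable_fun [set: T] g /\ exists M : R, forall t, `|g t| <= M.

Lemma bmeas_cst (r : R) : bmeas (fun=> r).
Proof. by split; [exact: measurable_cst|exists `|r|]. Qed.

Lemma bmeasD g1 g2 : bmeas g1 -> bmeas g2 -> bmeas (fun t => g1 t + g2 t).
Proof.
move=> [m1 [M1 h1]] [m2 [M2 h2]]; split; first exact: measurable_funD.
by exists (M1 + M2) => t; apply: le_trans (ler_normD _ _) _; rewrite lerD.
Qed.

Lemma bmeasM g1 g2 : bmeas g1 -> bmeas g2 -> bmeas (fun t => g1 t * g2 t).
Proof.
move=> [m1 [M1 h1]] [m2 [M2 h2]]; split; first exact: measurable_funM.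
by exists (M1 * M2) => t; rewrite normrM ler_pM.
Qed.

Lemma bmeasZ (r : R) g : bmeas g -> bmeas (fun t => r * g t).
Proof. by move=> bg; apply: (bmeasM _ bg); exact: bmeas_cst. Qed.

Lemma bmeasN g : bmeas g -> bmeas (fun t => - g t).
Proof.
move=> /(bmeasZ (-1)); congr bmeas; apply/funext => t; by rewrite mulN1r.
Qed.

Lemma bmeasB g1 g2 : bmeas g1 -> bmeas g2 -> bmeas (fun t => g1 t - g2 t).
Proof. by move=> b1 /bmeasN; exact: bmeasD. Qed.

Lemma bmeas_indic (A : set T) : measurable A -> bmeas (\1_A : T -> R).
Proof.
move=> mA; split; first exact: measurable_indic.
by exists 1 => t; rewrite indicE; case: (t \in A); rewrite ?normr1 ?normr0.
Qed.

Section Integral.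
Variable mu : {measure set T -> \bar R}.
Variable c : R.
Hypothesis muT : mu [set: T] = c%:E.
Local Notation L := (Rintegral mu [set: T]).

Lemma bmeas_integrable g : bmeas g -> mu.-integrable [set: T] (EFin \o g).
Proof.
move=> [mg [M hM]]; apply: measurable_bounded_integrable => //.
  by rewrite [X in (X < _)%E]muT ltry.
exists M; split; first exact: num_real.
by move=> x Mx t _ /=; apply: le_trans (hM t) (ltW Mx).
Qed.

Lemma bmeas_RintegralD g1 g2 : bmeas g1 -> bmeas g2 -> L (fun t => g1 t + g2 t) = L g1 + L g2.
Proof. by move=> b1 b2; rewrite RintegralD//; exact: bmeas_integrable. Qed.

Lemma bmeas_RintegralZ (r : R) g : bmeas g -> L (fun t => r * g t) = r * L g.
Proof. by move=> b; rewrite RintegralZl//; exact: bmeas_integrable. Qed.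

Lemma bmeas_Rintegral_lin (r : R) g1 g2 : bmeas g1 -> bmeas g2 ->
  L (fun t => g1 t + r * g2 t) = L g1 + r * L g2.
Proof. by move=> b1 b2; rewrite bmeas_RintegralD ?bmeas_RintegralZ//; exact: bmeasZ. Qed.

Lemma bmeas_RintegralB g1 g2 : bmeas g1 -> bmeas g2 -> L (fun t => g1 t - g2 t) = L g1 - L g2.
Proof.
move=> b1 b2; rewrite -[RHS]/(_ + - _) -[- L g2]mulN1r -bmeas_Rintegral_lin//.
by congr (L _); apply/funext => t; rewrite mulN1r.
Qed.

Lemma bmeas_Rintegral_cst (r : R) : L (fun=> r) = r * c.
Proof. by rewrite Rintegral_cst// [fine _]/= muT. Qed.

Lemma bmeas_Rintegral_le g1 g2 : bmeas g1 -> bmeas g2 -> (forall t, g1 t <= g2 t) -> L g1 <= L g2.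
Proof.
by move=> b1 b2 h; apply: le_Rintegral => //; exact: bmeas_integrable.
Qed.

Lemma bmeas_Rintegral_norm_le g (M : R) : bmeas g -> (forall t, `|g t| <= M) -> `|L g| <= M * c.
Proof.
move=> bg hM; rewrite ler_norml -mulNr -!bmeas_Rintegral_cst.
by apply/andP; split; apply: bmeas_Rintegral_le => //; try exact: bmeas_cst;
  move=> t; have := hM t; rewrite ler_norml => /andP[].
Qed.

Lemma bmeas_Rintegral_indic (A : set T) : measurable A -> L (\1_A) = fine (mu A).
Proof. by move=> mA; rewrite /Rintegral integral_indic// setIT. Qed.

End Integral.
End BoundedMeasurable.

Section Calculus.
Context {R : realType} {H : completeNormedModType R[i]}.
Variable ip : {dot H for Num.conj}.
Hypothesis ip_norm : forall x : H, `|x| ^+ 2 = ip x x.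
Context d {T : measurableType d}.
Variable P : set T -> H -> H.
Hypothesis sP : spectral_measure ip P.
Implicit Types (x y z : H) (A B : set T) (g : T -> R) (b c : H -> H).
Local Notation rip := (rip ip).
Local Notation symop := (symop ip).
Local Notation proj := (orthogonal_projection ip).
Let ripxx := ripxx ip_norm.

Lemma spm_proj A : measurable A -> proj (P A). Proof. by case: sP => + _ _; exact. Qed.

Lemma spmT x : P [set: T] x = x. Proof. by case: sP => _ -> _. Qed.

(** A measure that agrees with [diag P x] on measurable sets. *)
Definition spm x : {measure set T -> \bar R} :=
  sval (cid (let: And3 _ _ h := sP in h x)).

Lemma spm_diag x A : measurable A -> spm x A = diag ip P x A.
Proof. by rewrite /spm; case: cid => /= mu; apply. Qed.

Lemma spmE x A : measurable A -> spm x A = (rip (P A x) x)%:E.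
Proof. exact: spm_diag. Qed.

Lemma spmE2 x A : measurable A -> spm x A = (nrm (P A x) ^+ 2)%:E.
Proof. by move=> mA; rewrite spmE// (proj_rip ip_norm)//; exact: spm_proj. Qed.

Lemma spm_setT x : spm x [set: T] = (nrm x ^+ 2)%:E.
Proof. by rewrite spmE2// spmT. Qed.

Lemma spm_disjoint A B x : measurable A -> measurable B -> A `&` B = set0 ->
  P A (P B x) = 0.
Proof.
move=> mA mB AB; have pA := spm_proj mA; have pB := spm_proj mB.
apply: (disjoint_projections ip_norm mA mB AB pA pB (projK x pB) (spm_setT _)).
  exact: spmE.
exact: spmE.
Qed.

Lemma symop_ext b c : linear b -> linear c -> symop b -> symop c ->
  (forall x, rip (b x) x = rip (c x) x) -> b =1 c.
Proof.
move=> lb lc sb sc h; apply: (polarize_eq ip_norm) => // x.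
have real f : linear f -> symop f -> ip (f x) x = (rip (f x) x)%:C%C.
  move=> lf sf; rewrite ripRe; have := symop_ip lf sf x x; rewrite [RHS]ipC.
  by case: (ip (f x) x) => p q /= [] q0; congr (_ +i* _)%C; lra.
by rewrite !real// h.
Qed.

Lemma spmU A B x : measurable A -> measurable B -> A `&` B = set0 ->
  P (A `|` B) x = P A x + P B x.
Proof.
move=> mA mB AB.
have mAB : measurable (A `|` B) by exact: measurableU.
have pA := spm_proj mA; have pB := spm_proj mB; have pAB := spm_proj mAB.
have pD := projD ip_norm pA pB (fun x => spm_disjoint x mA mB AB).
move: x; apply: (symop_ext (proj_lin pAB) (proj_lin pD) (proj_sym pAB) (proj_sym pD)).
move=> x; have : spm x (A `|` B) = (spm x A + spm x B)%E by rewrite measureU.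
by rewrite !spmE// -EFinD ripDl => -[].
Qed.

(** Splitting A and B along their intersection reduces multiplicativity to the
    orthogonality of disjoint sets. *)
Lemma spmI A B x : measurable A -> measurable B -> P A (P B x) = P (A `&` B) x.
Proof.
move=> mA mB.
have mI := measurableI _ _ mA mB.
have mBA := measurableD mB mA; have mAB := measurableD mA mB.
have e1 y : P B y = P (A `&` B) y + P (B `\` A) y.
  rewrite -spmU//; first by rewrite setIC setUIDK.
  by rewrite -subset0 => t [[? _] []].
have e2 y : P A y = P (A `&` B) y + P (A `\` B) y.
  rewrite -spmU//; first by rewrite setUIDK.
  by rewrite -subset0 => t [[_ ?] []].
have d1 : A `&` (B `\` A) = set0 by rewrite -subset0 => t [? []].
have d2 : (A `\` B) `&` (A `&` B) = set0 by rewrite -subset0 => t [[_ ?] []].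
rewrite e1 (linD (proj_lin (spm_proj mA))) (spm_disjoint x mA mBA d1) addr0.
by rewrite e2 (projK _ (spm_proj mI)) (spm_disjoint x mAB mI d2) addr0.
Qed.

Lemma spm_commutes A B : measurable A -> measurable B -> commutes (P A) (P B).
Proof. by move=> mA mB x; rewrite !spmI// setIC. Qed.

Lemma spm_commutant A : measurable A -> measure_commutant P (P A).
Proof.
move=> mA; split; first exact: proj_bop (spm_proj mA).
by move=> w mw; apply/funext => x /=; exact: spm_commutes.
Qed.

Local Notation L x := (Rintegral (spm x) [set: T]).

(** Pairs of a simple function and its operator. Keeping both in one relation
    avoids proving that the operator depends on the function only. *)
Inductive simple_calc : (T -> R) -> (H -> H) -> Prop :=
| SimpleIndic A : measurable A -> simple_calc (\1_A) (P A)
| SimpleLin (r : R) g b g' b' : simple_calc g b -> simple_calc g' b' ->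
    simple_calc (fun t => g t + r * g' t) (fun x => b x + r%:C%C *: b' x).

Lemma simple_bmeas g b : simple_calc g b -> bmeas g.
Proof.
elim=> [A mA|r g1 b1 g2 b2 _ h1 _ h2]; first exact: bmeas_indic.
by apply: bmeasD => //; exact: bmeasZ.
Qed.

Lemma simple_bop g b : simple_calc g b -> bounded_operator b.
Proof.
elim=> [A mA|r g1 b1 g2 b2 _ h1 _ h2]; first exact: proj_bop (spm_proj mA).
exact: bop_lin.
Qed.

Lemma simple_sym g b : simple_calc g b -> symop b.
Proof.
elim=> [A mA|r g1 b1 g2 b2 _ h1 _ h2]; first exact: proj_sym (spm_proj mA).
by move=> x y; rewrite !ripE h1 h2.
Qed.

Lemma simple_commutant g b c : simple_calc g b -> measure_commutant P c -> commutes c b.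
Proof.
move=> + [bc cP]; elim=> [A mA x|r g1 b1 g2 b2 _ h1 _ h2 x].
  by have := congr1 (fun f => f x) (cP A mA).
by rewrite (linD bc.1) (linZ bc.1) h1 h2.
Qed.

(** Bilinearity reduces this to indicators, where it is [spmI]. *)
Lemma simple_rip g b g' b' x : simple_calc g b -> simple_calc g' b' ->
  rip (b x) (b' x) = L x (fun t => g t * g' t).
Proof.
move=> sb sb'; have bg' := simple_bmeas sb'.
elim: sb => [A mA|r g1 b1 g2 b2 s1 h1 s2 h2]; last first.
  have bg1 := simple_bmeas s1; have bg2 := simple_bmeas s2.
  rewrite !ripE h1 h2 -(bmeas_Rintegral_lin (spm_setT x)); try exact: bmeasM.
  by congr (L x _); apply/funext => t; rewrite mulrDl mulrA.
elim: sb' {bg'} => [B mB|r g1 b1 g2 b2 s1 h1 s2 h2]; last first.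
  have bg1 := simple_bmeas s1; have bg2 := simple_bmeas s2.
  have bA : bmeas (\1_A : T -> R) by exact: bmeas_indic.
  rewrite !ripE h1 h2 -(bmeas_Rintegral_lin (spm_setT x)); try exact: bmeasM.
  by congr (L x _); apply/funext => t; rewrite mulrDr; ring.
have -> : (fun t : T => \1_A t * \1_B t) = \1_(A `&` B) :> (T -> R).
  by apply/funext => t; rewrite !indicE in_setI -natrM mulnb.
have mI := measurableI _ _ mA mB.
rewrite bmeas_Rintegral_indic// spmE// /= -spmI// (spm_commutes mA mB).
by rewrite (proj_sym (spm_proj mB)) ripC.
Qed.

Lemma simple_rip1 g b x : simple_calc g b -> rip (b x) x = L x g.
Proof.
elim=> [A mA|r g1 b1 g2 b2 s1 h1 s2 h2]; first by rewrite bmeas_Rintegral_indic// spmE.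
by rewrite !ripE h1 h2 (bmeas_Rintegral_lin (spm_setT x))//; [exact: simple_bmeas s1|exact: simple_bmeas s2].
Qed.

(** The integer part of g, bounded by N, is the sum of the indicators of
    {g >= k} for k = 1, ..., N. *)
Lemma simple_truncn g (N : nat) : measurable_fun [set: T] g ->
  (forall t, 0 <= g t) -> exists2 s, (exists b, simple_calc s b) &
    forall t, g t <= N%:R -> s t = (Num.truncn (g t))%:R.
Proof.
move=> mg g0.
suff [s [b sb] hs] : exists2 s, (exists b, simple_calc s b) & forall t,
    s t = (minn N (Num.truncn (g t)))%:R.
  exists s; first by exists b.
  move=> t gN; rewrite hs; congr (_%:R); apply/minn_idPr.
  by rewrite -(ler_nat R); apply: le_trans gN; rewrite truncn_le.
elim: N => [|N [s [b sb] hs]].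
  exists (\1_set0); first by exists (P set0); exact: SimpleIndic.
  by move=> t; rewrite indicE in_set0 min0n.
pose A := [set t | N.+1%:R <= g t].
have mA : measurable A.
  have -> : A = [set: T] `&` g @^-1` `[N.+1%:R, +oo[%classic.
    by rewrite setTI; apply/seteqP; split=> t; rewrite /A /= in_itv /= andbT.
  by apply: mg => //; exact: measurable_itv.
exists (fun t => s t + 1 * \1_A t).
  by eexists; exact: SimpleLin sb (SimpleIndic mA).
move=> t; rewrite hs mul1r indicE -natrD; congr (_%:R).
have -> : (t \in A) = (N < Num.truncn (g t))%N.
  rewrite truncn_ge_nat; last exact: g0.
  by apply/idP/idP; rewrite inE.
by case: ltnP; lia.
Qed.

(** Rescaling g by n + 1 turns its integer part into an approximation up to
    1 / (n + 1). *)
Lemma simple_approx g (n : nat) : bmeas g ->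
  exists s, exists2 b, simple_calc s b & forall t, `|s t - g t| <= n.+1%:R^-1.
Proof.
move=> [mg [M hM]].
have n0 : 0 < n.+1%:R :> R by rewrite ltr0n.
(* adding M makes the function nonnegative *)
pose g' t := n.+1%:R * (g t + M).
have mg' : measurable_fun [set: T] g'.
  apply: measurable_funM; first exact: measurable_cst.
  by apply: measurable_funD => //; exact: measurable_cst.
have g0 t : 0 <= g' t.
  by rewrite mulr_ge0//; have := hM t; rewrite ler_norml => /andP[]; lra.
have gN t : g' t <= (Num.truncn (n.+1%:R * (M + M))).+1%:R.
  apply: ltW; apply: le_lt_trans (truncnS_gt _).
  by rewrite ler_pM2l//; have := hM t; rewrite ler_norml => /andP[]; lra.
have [s [b sb] hs] := simple_truncn (Num.truncn (n.+1%:R * (M + M))).+1 mg' g0.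
(* the indicator of the empty set stands for the zero function *)
have s1 := SimpleLin n.+1%:R^-1 (SimpleIndic measurable0) sb.
have s2 := SimpleLin (- M) s1 (SimpleIndic (@measurableT _ T)).
eexists; eexists; [exact: s2|move=> t /=].
rewrite (hs t (gN t)) !indicE in_set0 in_setT add0r mulr1.
have /andP[h1 h2] := truncn_itv (g0 t).
have e : g t = n.+1%:R^-1 * g' t - M by rewrite /g' mulKf ?gt_eqF//; ring.
have -> : n.+1%:R^-1 * (Num.truncn (g' t))%:R + - M - g t =
   n.+1%:R^-1 * ((Num.truncn (g' t))%:R - g' t).
  by rewrite e; ring.
rewrite normrM ger0_norm ?invr_ge0 ?ler0n// ler_piMr ?invr_ge0 ?ler0n//.
rewrite -natr1 in h2; rewrite ler_norml; apply/andP; split; lra.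
Qed.

Lemma Rintegral_uniform_cvg (s : nat -> T -> R) g (e : nat -> R) x :
  (forall n, bmeas (s n)) -> bmeas g -> e @ \oo --> (0 : R) ->
  (forall n t, `|s n t - g t| <= e n) ->
  (fun n => L x (s n)) @ \oo --> L x g.
Proof.
move=> bs bg e0 h; apply: cvg_zero; apply: norm_cvg0 => /=.
apply: (@squeeze_cvgr _ _ _ _ (fun=> 0) (fun n => e n * nrm x ^+ 2)).
- apply: nearW => n; rewrite normr_ge0 /= !fctE -(bmeas_RintegralB (spm_setT x))//.
  by apply: (bmeas_Rintegral_norm_le (spm_setT x)); [exact: bmeasB|exact: h].
- exact: cvg_cst.
- by rewrite -[X in _ --> X](mul0r (nrm x ^+ 2)); apply: cvgM => //; exact: cvg_cst.
Qed.

Definition calc_seq g (s : nat -> T -> R) (f : nat -> H -> H) :=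
  forall n, simple_calc (s n) (f n) /\ forall t, `|s n t - g t| <= n.+1%:R^-1.

(** By [simple_rip] the L2 distance of simple functions is the distance of the
    operators applied to x, so uniform approximations give Cauchy sequences. *)
Lemma calc_ex g : bmeas g -> exists b, [/\ bounded_operator b, symop b,
   forall c, measure_commutant P c -> commutes c b &
   exists s f, calc_seq g s f /\ forall x, cvgH (f^~ x) (b x)].
Proof.
move=> bg.
have /choice[s /choice[f sf]] : forall n, exists s, exists b, simple_calc s b /\
    forall t, `|s t - g t| <= n.+1%:R^-1.
  by move=> n; have [s [b sb h]] := simple_approx n bg; exists s, b.
have bs n : bmeas (s n) by apply: simple_bmeas (sf n).1.
have lf n := (simple_bop (sf n).1).1.
have hmn m n x : nrm (f m x - f n x) <= (m.+1%:R^-1 + n.+1%:R^-1) * nrm x.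
  rewrite -(@ler_pXn2r _ 2) ?nnegrE ?mulr_ge0 ?addr_ge0 ?nrm_ge0 ?invr_ge0//.
  have bb : bmeas (fun t => (s m t - s n t) * (s m t - s n t)).
    by apply: bmeasM; exact: bmeasB.
  have -> : nrm (f m x - f n x) ^+ 2 = L x (fun t => (s m t - s n t) * (s m t - s n t)).
    rewrite -ripxx !ripE (ripC _ (f n x) (f m x)).
    rewrite !(simple_rip _ (sf _).1 (sf _).1).
    have -> : (fun t => (s m t - s n t) * (s m t - s n t)) =
       (fun t => (s m t * s m t - s m t * s n t) - (s m t * s n t - s n t * s n t)).
      by apply/funext => t; ring.
    have b1 := bmeasM (bs m) (bs m); have b2 := bmeasM (bs m) (bs n).
    have b3 := bmeasM (bs n) (bs n).
    rewrite (bmeas_RintegralB (spm_setT x)); [|exact: bmeasB|exact: bmeasB].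
    by rewrite !(bmeas_RintegralB (spm_setT x))//; ring.
  apply: le_trans (ler_norm _) _; rewrite exprMn.
  apply: (bmeas_Rintegral_norm_le (spm_setT x)) => // t.
  rewrite -expr2 normrX ler_pXn2r ?nnegrE ?addr_ge0//.
  have := (sf m).2 t; have := (sf n).2 t.
  have := ler_normD (s m t - g t) (g t - s n t); rewrite addrA subrK (distrC (g t)).
  by move: (m.+1%:R^-1) (n.+1%:R^-1) => *; lra.
have fc x : exists y, cvgH (f^~ x) y.
  have h0 : (fun n => 2 * nrm x ^+ 2 * n.+1%:R^-1) @ \oo --> (0 : R).
    rewrite -[X in _ --> X](mulr0 (2 * nrm x ^+ 2)).
    by apply: cvgM; [exact: cvg_cst|exact: cvg_harmonic].
  apply: (cvgH_cauchy_sq h0) => m n.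
  have := hmn m n x; move: (nrm_ge0 (f m x - f n x)) (nrm_ge0 x).
  have hi (k : nat) : 0 <= (k.+1%:R^-1 : R) <= 1.
    by rewrite invr_ge0 ler0n invf_le1 ?ltr0n// ler1n.
  move: (hi m) (hi n); move: (m.+1%:R^-1) (n.+1%:R^-1) (nrm x) => p q N.
  move: (nrm _) => Z /andP[p0 p1] /andP[q0 q1] Z0 N0 hZ.
  have h1 : Z ^+ 2 <= ((p + q) * N) ^+ 2.
    by rewrite !expr2; apply: ler_pM.
  apply: le_trans h1 _; rewrite exprMn.
  have : (p + q) ^+ 2 <= 2 * (p + q) by nra.
  move=> h2; apply: le_trans (ler_wpM2r (sqr_ge0 N) h2) _.
  by rewrite le_eqVlt; apply/orP; left; apply/eqP; ring.
have [b hb] := choice fc.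
have lb := lim_linear lf hb.
exists b; split.
- apply/bounded_opP; split=> //.
  have [_ [M0 hM0 hM]] := (bounded_opP (f 0%N)).1 (simple_bop (sf 0%N).1).
  exists (M0 + 2); first by rewrite addr_ge0.
  move=> x; apply: nrm_cvg_le (hb x) _ => n.
  have := nrmD (f n x - f 0%N x) (f 0%N x); rewrite subrK.
  have := hM x; have := hmn n 0%N x; have := nrm_ge0 x.
  have : n.+1%:R^-1 <= 1 :> R by rewrite invf_le1 ?ltr0n// ler1n.
  have -> : (1%:R^-1 : R) = 1 by rewrite invr1.
  by move: (n.+1%:R^-1) (nrm x) => *; nra.
- by apply: lim_symop hb => // n; exact: simple_sym (sf n).1.
- move=> c cP; apply: (lim_commutes cP.1) hb => n.
  exact: simple_commutant (sf n).1 cP.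
- by exists s, f; split.
Qed.

(** The calculus for real functions, in which all operators are symmetric; the
    identity [rpi_rip1] then determines them. *)
Definition rpi g : H -> H :=
  if pselect (bmeas g) is left bg then sval (cid (calc_ex bg)) else fun=> 0.

Lemma rpiP g : bmeas g -> [/\ bounded_operator (rpi g), symop (rpi g),
   forall c, measure_commutant P c -> commutes c (rpi g) &
   exists s f, calc_seq g s f /\ forall x, cvgH (f^~ x) (rpi g x)].
Proof. by move=> bg; rewrite /rpi; case: pselect => // bg'; case: cid. Qed.

Lemma rpi_bop g : bmeas g -> bounded_operator (rpi g).
Proof. by case/rpiP. Qed.
Lemma rpi_sym g : bmeas g -> symop (rpi g).
Proof. by case/rpiP. Qed.
Lemma rpi_lin g : bmeas g -> linear (rpi g).
Proof. by move/rpi_bop => -[]. Qed.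
Lemma rpi_commutant g c : bmeas g -> measure_commutant P c -> commutes c (rpi g).
Proof. by move=> /rpiP[_ _ h _]; exact: h. Qed.

Lemma rpi_rip1 g x : bmeas g -> rip (rpi g x) x = L x g.
Proof.
move=> bg; have [_ _ _ [s [f [sf fg]]]] := rpiP bg.
have h1 := cvgH_rip ip_norm (fg x) (cvgH_cst x).
have bs n : bmeas (s n) := simple_bmeas (sf n).1.
have h2 := Rintegral_uniform_cvg (x := x) bs bg (@cvg_harmonic R) (fun n => (sf n).2).
rewrite -(cvg_lim (@Rhausdorff R) h1) -(cvg_lim (@Rhausdorff R) h2).
congr (lim (_ @ \oo)); apply/funext => n.
exact: simple_rip1 (sf n).1.
Qed.

(** The isometry property. It yields multiplicativity [rpiM] through
    [rpi_uniq]. *)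
Lemma rpi_rip g g' x : bmeas g -> bmeas g' ->
  rip (rpi g x) (rpi g' x) = L x (fun t => g t * g' t).
Proof.
move=> bg bg'; have [_ _ _ [s [f [sf fg]]]] := rpiP bg.
have [_ _ _ [s' [f' [sf' fg']]]] := rpiP bg'.
have h1 := cvgH_rip ip_norm (fg x) (fg' x).
have bs n : bmeas (s n) := simple_bmeas (sf n).1.
have bs' n : bmeas (s' n) := simple_bmeas (sf' n).1.
have [_ [M hM]] := bg; have [_ [M' hM']] := bg'.
pose e n : R := (`|M| + `|M'| + 1) * n.+1%:R^-1.
have e0 : e @ \oo --> (0 : R).
  rewrite -[X in _ --> X](mulr0 (`|M| + `|M'| + 1)).
  by apply: cvgM; [exact: cvg_cst|exact: cvg_harmonic].
have h2 := Rintegral_uniform_cvg (x := x) (fun n => bmeasM (bs n) (bs' n)) (bmeasM bg bg') e0.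
have {}h2 : (fun n => L x (fun t => s n t * s' n t)) @ \oo -->
  L x (fun t => g t * g' t).
  apply: h2 => n t.
  have -> : s n t * s' n t - g t * g' t =
    (s n t - g t) * (s' n t - g' t) + (s n t - g t) * g' t + g t * (s' n t - g' t).
    by ring.
  apply: le_trans (ler_normD _ _) _.
  apply: le_trans (lerD (ler_normD _ _) (lexx _)) _; rewrite !normrM.
  have := (sf n).2 t; have := (sf' n).2 t.
  have := le_trans (hM t) (ler_norm M); have := le_trans (hM' t) (ler_norm M').
  have : n.+1%:R^-1 <= 1 :> R by rewrite invf_le1 ?ltr0n// ler1n.
  have : 0 <= n.+1%:R^-1 :> R by [].
  rewrite /e; move: (normr_ge0 (s n t - g t)) (normr_ge0 (s' n t - g' t)) (normr_ge0 (g t)) (normr_ge0 (g' t)).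
  move: (`|s n t - g t|) (`|s' n t - g' t|) (`|g t|) (`|g' t|) (`|M|) (`|M'|) (n.+1%:R^-1).
  move=> p q u v N N' z p0 q0 u0 v0 z0 z1 vN uN qz pz.
  have k1 : p * q <= z * 1 by apply: ler_pM => //; apply: le_trans qz z1.
  have k2 : p * v <= z * N' by apply: ler_pM.
  have k3 : u * q <= N * z by apply: ler_pM.
  by lra.
rewrite -(cvg_lim (@Rhausdorff R) h1) -(cvg_lim (@Rhausdorff R) h2).
congr (lim (_ @ \oo)); apply/funext => n.
exact: simple_rip (sf n).1 (sf' n).1.
Qed.

Lemma rpi_uniq g b : bmeas g -> linear b -> symop b ->
  (forall x, rip (b x) x = L x g) -> b =1 rpi g.
Proof.
move=> bg lb sb h; apply: symop_ext => //; try exact: rpi_lin; try exact: rpi_sym.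
by move=> x; rewrite h rpi_rip1.
Qed.

Lemma rpi_measure_commutant g : bmeas g -> measure_commutant P (rpi g).
Proof.
move=> bg; split; first exact: rpi_bop.
move=> w mw; apply/funext => x /=; apply/esym.
exact: (rpi_commutant bg (spm_commutant mw)).
Qed.

Lemma rpi_commutes g g' : bmeas g -> bmeas g' -> commutes (rpi g) (rpi g').
Proof. by move=> bg bg'; apply: rpi_commutant => //; exact: rpi_measure_commutant. Qed.

Lemma rpiM g g' x : bmeas g -> bmeas g' ->
  rpi g (rpi g' x) = rpi (fun t => g t * g' t) x.
Proof.
move=> bg bg'; move: x; apply: rpi_uniq; first exact: bmeasM.
- by move=> k y z; rewrite (rpi_lin bg') (rpi_lin bg).
- move=> y z; rewrite (rpi_sym bg) (rpi_sym bg').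
  by rewrite (rpi_commutes bg bg').
- by move=> y; rewrite (rpi_sym bg) ripC rpi_rip.
Qed.

Lemma rpi_linE (r : R) g g' x : bmeas g -> bmeas g' ->
  rpi (fun t => g t + r * g' t) x = rpi g x + r%:C%C *: rpi g' x.
Proof.
move=> bg bg'; apply/esym; move: x; apply: rpi_uniq.
- by apply: bmeasD => //; exact: bmeasZ.
- exact: (bop_lin _ (rpi_bop bg) (rpi_bop bg')).1.
- by move=> y z; rewrite !ripE (rpi_sym bg) (rpi_sym bg').
- by move=> y; rewrite !ripE !rpi_rip1// (bmeas_Rintegral_lin (spm_setT y)).
Qed.

Lemma rpi_indic A x : measurable A -> rpi (\1_A) x = P A x.
Proof.
move=> mA; apply/esym; move: x; apply: rpi_uniq.
- exact: bmeas_indic.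
- exact: proj_lin (spm_proj mA).
- exact: proj_sym (spm_proj mA).
- by move=> y; rewrite bmeas_Rintegral_indic// spmE.
Qed.

Lemma rpi_cst (r : R) x : rpi (fun=> r) x = r%:C%C *: x.
Proof.
apply/esym; move: x; apply: rpi_uniq.
- exact: bmeas_cst.
- by move=> k y z; rewrite scalerDr !scalerA mulrC.
- by move=> y z; rewrite !ripE.
- by move=> y; rewrite !ripE ripxx (bmeas_Rintegral_cst (spm_setT y)).
Qed.

Implicit Types (h : T -> R[i]).
Local Notation Re := complex.Re.
Local Notation Im := complex.Im.
Local Notation normc := ComplexField.Normc.normc.

Definition cbmeas h := bmeas (fun t => Re (h t)) /\ bmeas (fun t => Im (h t)).

(** The operator of the complex function h; by [pi_op_cpi] it is the one denoted
    by pi_op. *)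
Definition cpi h x := rpi (fun t => Re (h t)) x + 'i%C *: rpi (fun t => Im (h t)) x.

Lemma cpi_bop h : cbmeas h -> bounded_operator (cpi h).
Proof. by move=> [b1 b2]; apply: bop_lin; exact: rpi_bop. Qed.

Lemma cpi_commutant h c : cbmeas h -> measure_commutant P c -> commutes c (cpi h).
Proof.
move=> [b1 b2] cP x; rewrite /cpi (linD cP.1.1) (linZ cP.1.1).
by rewrite !(rpi_commutant _ cP).
Qed.

Lemma cbmeasM h h' : cbmeas h -> cbmeas h' -> cbmeas (fun t => h t * h' t).
Proof.
move=> [b1 b2] [b1' b2']; split.
  have -> : (fun t => Re (h t * h' t)) = (fun t => Re (h t) * Re (h' t) - Im (h t) * Im (h' t)).
    by apply/funext => t; case: (h t); case: (h' t).
  by apply: bmeasB; exact: bmeasM.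
have -> : (fun t => Im (h t * h' t)) = (fun t => Re (h t) * Im (h' t) + Im (h t) * Re (h' t)).
  by apply/funext => t; case: (h t); case: (h' t).
by apply: bmeasD; exact: bmeasM.
Qed.

Lemma cbmeasB h h' : cbmeas h -> cbmeas h' -> cbmeas (fun t => h t - h' t).
Proof.
move=> [b1 b2] [b1' b2']; split.
  have -> : (fun t => Re (h t - h' t)) = (fun t => Re (h t) - Re (h' t)).
    by apply/funext => t; case: (h t); case: (h' t).
  exact: bmeasB.
have -> : (fun t => Im (h t - h' t)) = (fun t => Im (h t) - Im (h' t)).
  by apply/funext => t; case: (h t); case: (h' t).
exact: bmeasB.
Qed.

Lemma cbmeas_real g : bmeas g -> cbmeas (fun t => (g t)%:C%C).
Proof. by move=> bg; split=> //; exact: bmeas_cst. Qed.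

Lemma cbmeas_cst k : cbmeas (fun=> k).
Proof. by split; exact: bmeas_cst. Qed.

Lemma cpi_real g x : bmeas g -> cpi (fun t => (g t)%:C%C) x = rpi g x.
Proof.
by move=> bg; rewrite /cpi /= rpi_cst !scalerA mulr0 scale0r addr0.
Qed.

Lemma cpi_cst k x : cpi (fun=> k) x = k *: x.
Proof.
rewrite /cpi !rpi_cst scalerA -scalerDl; congr (_ *: _).
by rewrite [RHS]complexE.
Qed.

Lemma rpiB g g' x : bmeas g -> bmeas g' ->
  rpi (fun t => g t - g' t) x = rpi g x - rpi g' x.
Proof.
move=> bg bg'; have := rpi_linE (-1) x bg bg'.
rewrite rmorphN1 scaleN1r => <-; congr (rpi _ x).
by apply/funext => t; rewrite mulN1r.
Qed.

Lemma rpiD g g' x : bmeas g -> bmeas g' ->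
  rpi (fun t => g t + g' t) x = rpi g x + rpi g' x.
Proof.
move=> bg bg'; have := rpi_linE 1 x bg bg'.
rewrite scale1r => <-; congr (rpi _ x).
by apply/funext => t; rewrite mul1r.
Qed.

Lemma cpiB h h' x : cbmeas h -> cbmeas h' ->
  cpi (fun t => h t - h' t) x = cpi h x - cpi h' x.
Proof.
move=> [b1 b2] [b1' b2']; rewrite /cpi.
have -> : (fun t => Re (h t - h' t)) = (fun t => Re (h t) - Re (h' t)).
  by apply/funext => t; case: (h t); case: (h' t).
have -> : (fun t => Im (h t - h' t)) = (fun t => Im (h t) - Im (h' t)).
  by apply/funext => t; case: (h t); case: (h' t).
by rewrite !rpiB// scalerBr opprD addrACA.
Qed.

Lemma cpiM h h' x : cbmeas h -> cbmeas h' ->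
  cpi h (cpi h' x) = cpi (fun t => h t * h' t) x.
Proof.
move=> [b1 b2] [b1' b2']; rewrite /cpi.
have -> : (fun t => Re (h t * h' t)) = (fun t => Re (h t) * Re (h' t) - Im (h t) * Im (h' t)).
  by apply/funext => t; case: (h t); case: (h' t).
have -> : (fun t => Im (h t * h' t)) = (fun t => Re (h t) * Im (h' t) + Im (h t) * Re (h' t)).
  by apply/funext => t; case: (h t); case: (h' t).
rewrite rpiB ?rpiD; try exact: bmeasM.
rewrite (linD (rpi_lin b1)) (linD (rpi_lin b2)) (linZ (rpi_lin b1)) (linZ (rpi_lin b2)).
rewrite !rpiM// scalerDr scalerA -expr2 sqr_i scaleN1r scalerDr.
by rewrite -!addrA; congr (_ + _); rewrite [RHS]addrC -addrA.
Qed.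

Lemma cpi_indic A x : measurable A -> cpi (fun t => (\1_A t)%:C%C) x = P A x.
Proof. by move=> mA; rewrite cpi_real ?rpi_indic//; exact: bmeas_indic. Qed.

Lemma cpi_ip h x : cbmeas h ->
  ip (cpi h x) x = (L x (fun t => Re (h t)) +i* L x (fun t => Im (h t)))%C.
Proof.
move=> [b1 b2]; rewrite /cpi ipDl ipZl.
have real g : bmeas g -> ip (rpi g x) x = (L x g)%:C%C.
  move=> bg; rewrite -rpi_rip1// ripRe.
  have := symop_ip (rpi_lin bg) (rpi_sym bg) x x; rewrite [RHS]ipC.
  by case: (ip (rpi g x) x) => p q /= [] q0; congr (_ +i* _)%C; lra.
by rewrite !real// [RHS]complexE.
Qed.

(** The mixed terms vanish since commuting symmetric operators have a real
    product. *)
Lemma cpi_rip h h' x : cbmeas h -> cbmeas h' ->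
  rip (cpi h x) (cpi h' x) = L x (fun t => Re (h t) * Re (h' t) + Im (h t) * Im (h' t)).
Proof.
move=> [b1 b2] [b1' b2']; rewrite /cpi.
have uv0 g g' : bmeas g -> bmeas g' -> rip (rpi g x) ('i%C *: rpi g' x) = 0.
  move=> bg bg'; set u := rpi g x; set v := rpi g' x.
  have vu : ip v u = ip u v.
    rewrite /u /v (symop_ip (rpi_lin bg') (rpi_sym bg')).
    rewrite (rpi_commutes bg' bg) -(symop_ip (rpi_lin bg) (rpi_sym bg)).
    by [].
  move: vu; rewrite ripRe ipZr [LHS]ipC.
  by case: (ip u v) => p q /= [] ?; lra.
have vv u v : rip ('i%C *: u) ('i%C *: v) = rip u v.
  by rewrite !ripRe ipZr ipZl; case: (ip u v) => p q /=; ring.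
rewrite !ripDl !ripDr uv0// (ripC _ ('i%C *: _)) uv0// vv !rpi_rip//.
rewrite addr0 add0r -(bmeas_RintegralD (spm_setT x))//; exact: bmeasM.
Qed.

Lemma cpi_nrm h x : cbmeas h ->
  nrm (cpi h x) ^+ 2 = L x (fun t => normc (h t) ^+ 2).
Proof.
move=> bh; rewrite -ripxx cpi_rip//; congr (L x _); apply/funext => t.
by case: (h t) => p q /=; rewrite sqr_sqrtr ?addr_ge0 ?sqr_ge0// !expr2.
Qed.

Lemma bmeas_normc2 h : cbmeas h -> bmeas (fun t => normc (h t) ^+ 2).
Proof.
move=> [b1 b2].
have -> : (fun t => normc (h t) ^+ 2) = (fun t => Re (h t) * Re (h t) + Im (h t) * Im (h t)).
  apply/funext => t; case: (h t) => p q /=.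
  by rewrite sqr_sqrtr ?addr_ge0 ?sqr_ge0// !expr2.
by apply: bmeasD; exact: bmeasM.
Qed.

Lemma cpi_sq_integral h x : cbmeas h ->
  sq_integral (spm x) h = (nrm (cpi h x) ^+ 2)%:E.
Proof.
move=> bh; rewrite cpi_nrm// /Rintegral fineK//.
exact/integrable_fin_num/(bmeas_integrable (spm_setT x))/bmeas_normc2.
Qed.

Lemma cpi_is_bounded_integral h : cbmeas h -> is_bounded_integral ip P h (cpi h).
Proof.
move=> bh; split; first exact: cpi_bop.
move=> x; rewrite cpi_ip// /cintegral; congr (fine _ +i* fine _)%C;
  by apply: eq_setfun_integral => A mA; rewrite spm_diag.
Qed.

(** Both operators have the same quadratic form. *)
Lemma pi_op_cpi h : cbmeas h -> pi_op ip P h = cpi h.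
Proof.
move=> bh; have hb := cpi_is_bounded_integral bh.
have [bb hx] : is_bounded_integral ip P h (pi_op ip P h) := xgetI (fun=> 0) hb.
apply/funext; apply: (polarize_eq ip_norm); [exact: bb.1|exact: hb.1.1|].
by move=> x; rewrite hx hb.2.
Qed.

Lemma sq_integral_diag x h : sq_integral (diag ip P x) h = sq_integral (spm x) h.
Proof. by apply: eq_setfun_integral => A mA; rewrite spm_diag. Qed.

End Calculus.

(** * Measurability of complex functions *)

Section ComplexMeasurability.
Context {R : realType}.
Local Notation normc := ComplexField.Normc.normc.
Local Notation Re := (@complex.Re R).
Local Notation Im := (@complex.Im R).

Lemma normc_Re (z : R[i]) : `|Re z| <= normc z.
Proof.
case: z => p q /=; rewrite -(sqrtr_sqr p) ler_wsqrtr// lerDl sqr_ge0//.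
Qed.
Lemma normc_Im (z : R[i]) : `|Im z| <= normc z.
Proof.
case: z => p q /=; rewrite -(sqrtr_sqr q) ler_wsqrtr// lerDr sqr_ge0//.
Qed.

Lemma continuous_Re : continuous (@complex.Re R : R[i] -> R).
Proof.
move=> z A /nbhs_ballP[e /= e0 eA].
have hb : nbhs z (ball z e%:C%C) by apply: nbhsx_ballx; rewrite ltcR.
apply: (filterS (P := ball z e%:C%C)) hb => w.
rewrite -ball_normE /= normcE ltcR => h; apply: eA; apply: le_lt_trans h.
by have := normc_Re (z - w); case: (z); case: (w).
Qed.

Lemma continuous_Im : continuous (@complex.Im R : R[i] -> R).
Proof.
move=> z A /nbhs_ballP[e /= e0 eA].
have hb : nbhs z (ball z e%:C%C) by apply: nbhsx_ballx; rewrite ltcR.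
apply: (filterS (P := ball z e%:C%C)) hb => w.
rewrite -ball_normE /= normcE ltcR => h; apply: eA; apply: le_lt_trans h.
by have := normc_Im (z - w); case: (z); case: (w).
Qed.

Lemma continuous_real_complex : continuous (real_complex R : R -> R[i]).
Proof.
move=> z; apply/cvgrPdist_lt => e /complex_gt0[r r0 ->].
have hb : nbhs z (ball z r) by exact: nbhsx_ballx.
apply: filterS hb => w; rewrite -ball_normE /= => h.
by rewrite -rmorphB normcE ltcR /= expr0n addr0 sqrtr_sqr.
Qed.

(** Half-lines generate the Borel sets of the line. *)
Lemma measurable_to_real d (T : measurableType d) (f : T -> R) :
  (forall x, measurable (f @^-1` `]x, +oo[)) -> measurable_fun [set: T] f.
Proof.
move=> h mD; apply: (measurability _ (RGenOInfty.measurableE R)) => //.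
by move=> _ [_ [x ->] <-]; rewrite setTI; exact: h.
Qed.

Lemma open_measurable_borel (X : ptopologicalType) (U : set X) : open U ->
  measurable (U : set (borel X)).
Proof. by move=> oU; apply: sub_sigma_algebra. Qed.

Lemma continuous_measurable_borel (X : ptopologicalType) (f : X -> R) :
  continuous f -> measurable_fun [set: borel X] (f : borel X -> R).
Proof.
move=> cf; apply: measurable_to_real => x; apply: open_measurable_borel.
by move/continuousP: cf; apply; exact: interval_open.
Qed.

Lemma cbmeas_of_bounded d (T : measurableType d) (h : T -> R[i]) :
  cmeasurable h -> cbounded h -> cbmeas h.
Proof.
move=> mh [M hM]; split; split.
- exact: (measurableT_comp (continuous_measurable_borel continuous_Re) mh).
- by exists M => t; exact: le_trans (normc_Re _) (hM t).
- exact: (measurableT_comp (continuous_measurable_borel continuous_Im) mh).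
- by exists M => t; exact: le_trans (normc_Im _) (hM t).
Qed.

End ComplexMeasurability.

(** * Integrals of unbounded functions by way of the resolvent *)

Section Multiplication.
Context {R : realType} {H : completeNormedModType R[i]}.
Variable ip : {dot H for Num.conj}.
Hypothesis ip_norm : forall x : H, `|x| ^+ 2 = ip x x.
Variable a : operator H.
Hypothesis a_linear : linear_operator a.
Hypothesis a_dense : dense (dom a).
Hypothesis a_sa : self_adjoint ip a.
Variable J : H -> H.
Hypothesis JP : resolvent a 'i%C J.
Context d {T : measurableType d}.
Variable P : set T -> H -> H.
Hypothesis sP : spectral_measure ip P.
Variable lam : T -> R.
Hypothesis mlam : measurable_fun [set: T] lam.
Hypothesis clam : cmeasurable (fun t => (lam t)%:C%C).
Implicit Types (x y z v : H) (h f : T -> R[i]) (n : nat).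
Local Notation rip := (rip ip).
Local Notation symop := (symop ip).
Local Notation proj := (orthogonal_projection ip).
Local Notation normc := ComplexField.Normc.normc.
Local Notation Re := (@complex.Re R).
Local Notation Im := (@complex.Im R).
Local Notation D := (dom a).
Local Notation fsp := (fun t => (lam t)%:C%C : R[i]).
Local Notation cpi := (cpi ip_norm sP).
Local Notation spm := (spm sP).
Let ripxx := ripxx ip_norm.
Let bJ : bounded_operator J := res_bop ip_norm a_linear a_dense a_sa Imi_neq0 JP.

Let nrm_sub x y : nrm (x - y) ^+ 2 = nrm x ^+ 2 - 2 * rip y x + nrm y ^+ 2.
Proof. by rewrite -!ripxx !ripE (ripC _ x y); ring. Qed.

(** Truncation to these sets makes the unbounded function lam bounded; they
    increase to the whole space. *)
Definition window n := [set t | `|lam t| <= n%:R].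

Lemma measurable_window n : measurable (window n).
Proof.
have -> : window n = [set: T] `&` lam @^-1` `[- n%:R, n%:R]%classic.
  by rewrite setTI; apply/seteqP; split=> t; rewrite /window /= in_itv /= ler_norml.
by apply: mlam => //; exact: measurable_itv.
Qed.

Definition trunc n f t := f t * (\1_(window n) t)%:C%C.

Lemma trunc_in n f t : window n t -> trunc n f t = f t.
Proof. by move=> w; rewrite /trunc indicE mem_set// mulr1. Qed.

Lemma trunc_out n f t : ~ window n t -> trunc n f t = 0.
Proof. by move=> w; rewrite /trunc indicE memNset// mulr0. Qed.

Lemma cbmeas_window n : cbmeas (fun t => (\1_(window n) t)%:C%C : R[i]).
Proof. by apply: cbmeas_real; apply: bmeas_indic; exact: measurable_window. Qed.

Lemma cbmeas_trunc n f : cbmeas f -> cbmeas (trunc n f).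
Proof. by move=> bf; apply: cbmeasM => //; exact: cbmeas_window. Qed.

Lemma bmeas_trunc_lam n : bmeas (fun t => lam t * \1_(window n) t).
Proof.
split.
  by apply: measurable_funM => //; apply: measurable_indic; exact: measurable_window.
exists n%:R => t; have [w|w] := pselect (window n t).
  by rewrite indicE mem_set// mulr1.
by rewrite indicE memNset// mulr0 normr0.
Qed.

Lemma cbmeas_trunc_fsp n : cbmeas (trunc n fsp).
Proof.
have -> : trunc n fsp = fun t => (lam t * \1_(window n) t)%:C%C.
  by apply/funext => t; rewrite /trunc rmorphM.
by apply: cbmeas_real; exact: bmeas_trunc_lam.
Qed.

(** Componentwise measurability, which is what the integrals use. *)
Definition cmeas f := measurable_fun [set: T] (fun t => Re (f t)) /\
  measurable_fun [set: T] (fun t => Im (f t)).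

Lemma cbmeas_cmeas f : cbmeas f -> cmeas f.
Proof. by move=> [[? _] [? _]]. Qed.

Lemma cmeas_fsp : cmeas fsp.
Proof. by split=> //; exact: measurable_cst. Qed.

Lemma cmeasB f h : cmeas f -> cmeas h -> cmeas (fun t => f t - h t).
Proof.
move=> [b1 b2] [b1' b2']; split.
  have -> : (fun t => Re (f t - h t)) = (fun t => Re (f t) - Re (h t)).
    by apply/funext => t; case: (f t); case: (h t).
  exact: measurable_funB.
have -> : (fun t => Im (f t - h t)) = (fun t => Im (f t) - Im (h t)).
  by apply/funext => t; case: (f t); case: (h t).
exact: measurable_funB.
Qed.

Lemma cmeas_normc2 f : cmeas f -> measurable_fun [set: T] (fun t => (normc (f t) ^+ 2)%:E).
Proof.
move=> [b1 b2].
have -> : (fun t => (normc (f t) ^+ 2)%:E) =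
    (fun t => (Re (f t) * Re (f t) + Im (f t) * Im (f t))%:E).
  apply/funext => t; case: (f t) => p q /=.
  by rewrite sqr_sqrtr ?addr_ge0 ?sqr_ge0// !expr2.
apply/measurable_EFinP.
by apply: measurable_funD; exact: measurable_funM.
Qed.

(** Monotone convergence: the truncations increase to f in modulus. *)
Lemma sq_integral_trunc f x : cmeas f -> (forall n, cbmeas (trunc n f)) ->
  (fun n => (nrm (cpi (trunc n f) x) ^+ 2)%:E) @ \oo --> sq_integral (spm x) f.
Proof.
move=> mf bf.
pose g n t : \bar R := (normc (trunc n f t) ^+ 2)%:E.
have gE t : (fun n => g n t) @ \oo --> (normc (f t) ^+ 2)%:E.
  apply: cvg_near_cst; exists (Num.truncn `|lam t|).+1 => // n /= nt.
  rewrite /g trunc_in// /window /=; apply: le_trans (ltW (truncnS_gt _)) _.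
  by rewrite ler_nat.
have := @cvg_monotone_convergence _ _ _ (spm x) setT measurableT g.
have -> : (fun t => limn (g^~ t)) = (fun t => (normc (f t) ^+ 2)%:E).
  by apply/funext => t; apply/cvg_lim => //; exact: gE.
have -> : (fun n => (nrm (cpi (trunc n f) x) ^+ 2)%:E) =
    (fun n => sq_integral (spm x) (trunc n f)).
  by apply/funext => n; rewrite cpi_sq_integral.
apply.
- by move=> n; apply: cmeas_normc2; exact: cbmeas_cmeas.
- by move=> n t _; rewrite lee_fin sqr_ge0.
- move=> t _ m n mn; rewrite lee_fin.
  have [w|w] := pselect (window m t).
    rewrite !trunc_in//; apply: le_trans w _; by rewrite ler_nat.
  by rewrite (trunc_out _ w) ComplexField.Normc.normc0 expr0n sqr_ge0.
Qed.

Lemma window_cvg x : cvgH (fun n => P (window n) x) x.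
Proof.
have b1 : cbmeas (fun=> 1 : R[i]) := @cbmeas_cst _ _ T 1.
have h := sq_integral_trunc (x := x) (cbmeas_cmeas b1) (fun n => cbmeas_trunc n b1).
have e n : cpi (trunc n (fun=> 1)) x = P (window n) x.
  rewrite -(cpi_indic ip_norm sP x (measurable_window n)); congr (cpi _ x).
  by apply/funext => t; rewrite /trunc mul1r.
move: h; rewrite cpi_sq_integral// cpi_cst// scale1r.
under eq_fun do rewrite e.
move=> /fine_cvg /= h; apply/cvgHP => eps e0.
move/cvgrPdist_lt : h => /(_ (eps ^+ 2)); rewrite exprn_gt0// => /(_ isT)[N _ hN].
exists N => n Nn; have := hN n Nn.
have pn := spm_proj sP (measurable_window n).
have -> : nrm x ^+ 2 - nrm (P (window n) x) ^+ 2 = nrm (P (window n) x - x) ^+ 2.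
  rewrite -[in RHS]ripxx !ripE (ripC _ x (P _ x)) (proj_rip ip_norm)//.
  by rewrite !ripxx; ring.
rewrite ger0_norm ?sqr_ge0// ltr_pXn2r ?nnegrE ?nrm_ge0//.
exact: ltW.
Qed.

(** The function 1 / (l - i), to which the resolvent of a will correspond. *)
Definition jfun t : R[i] := (fsp t - 'i%C)^-1.

Lemma jfunE t : jfun t = ((lam t / (lam t ^+ 2 + 1)) +i* (lam t ^+ 2 + 1)^-1)%C.
Proof.
have e : (lam t)%:C%C - 'i%C = (lam t +i* -1)%C :> R[i].
  by apply/eqP; rewrite eq_complex /= subr0 sub0r !eqxx.
rewrite /jfun e; apply/eqP; rewrite eq_complex /= sqrrN expr1n.
by rewrite mulN1r opprK !eqxx.
Qed.

Lemma lam1_gt0 t : 0 < lam t ^+ 2 + 1.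
Proof. by rewrite ltr_wpDl// sqr_ge0. Qed.

Lemma jfunK t : (fsp t - 'i%C) * jfun t = 1.
Proof.
rewrite /jfun mulfV//; apply/eqP => /(congr1 Im) /=; lra.
Qed.

Lemma bmeas_inv : bmeas (fun t => (lam t ^+ 2 + 1)^-1).
Proof.
split.
  have ci : continuous (fun s : R => (s ^+ 2 + 1)^-1).
    move=> s; apply: cvgV; first by rewrite gt_eqF// ltr_wpDl// sqr_ge0.
    by apply: cvgD; [exact: exprn_continuous|exact: cvg_cst].
  exact: (measurableT_comp (continuous_measurable_fun ci) mlam).
exists 1 => t; rewrite ger0_norm ?invr_ge0 ?(ltW (lam1_gt0 t))//.
by rewrite invf_le1 ?lam1_gt0// lerDr sqr_ge0.
Qed.

Lemma bmeas_lam_inv : bmeas (fun t => lam t * (lam t ^+ 2 + 1)^-1).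
Proof.
split; first by apply: measurable_funM => //; case: bmeas_inv.
exists 1 => t; rewrite normrM (ger0_norm (x := _^-1)) ?invr_ge0 ?(ltW (lam1_gt0 t))//.
rewrite ler_pdivrMr ?lam1_gt0// mul1r.
by rewrite ler_norml; apply/andP; split; nra.
Qed.

Lemma cbmeas_jfun : cbmeas jfun.
Proof.
split.
  have -> : (fun t => Re (jfun t)) = (fun t => lam t * (lam t ^+ 2 + 1)^-1).
    by apply/funext => t; rewrite jfunE.
  exact: bmeas_lam_inv.
have -> : (fun t => Im (jfun t)) = (fun t => (lam t ^+ 2 + 1)^-1).
  by apply/funext => t; rewrite jfunE.
exact: bmeas_inv.
Qed.

Lemma fsp_jfun t : fsp t * jfun t = 1 + 'i%C * jfun t.
Proof. by have := jfunK t; rewrite mulrBl => <-; rewrite subrK. Qed.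

Lemma cbmeas_fsp_jfun : cbmeas (fun t => fsp t * jfun t).
Proof.
have -> : (fun t => fsp t * jfun t) = (fun t => 1 - (- 'i%C) * jfun t).
  by apply/funext => t; rewrite fsp_jfun mulNr opprK.
apply: cbmeasB; first exact: cbmeas_cst.
by apply: cbmeasM cbmeas_jfun; exact: cbmeas_cst.
Qed.

Lemma cpi_ext f h x : f =1 h -> cpi f x = cpi h x.
Proof. by move=> /funext ->. Qed.

(** From l / (l - i) = 1 + i / (l - i). *)
Lemma cpi_fsp_jfun y : cpi (fun t => fsp t * jfun t) y = y + 'i%C *: cpi jfun y.
Proof.
have bc := cbmeas_cst (T := T) (- 'i%C : R[i]).
have b1 := cbmeas_cst (T := T) (1 : R[i]).
have e : (fun t => fsp t * jfun t) =1 (fun t => 1 - (- 'i%C) * jfun t).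
  by move=> t; rewrite fsp_jfun mulNr opprK.
rewrite (cpi_ext _ e) cpiB//; last exact: cbmeasM cbmeas_jfun.
rewrite cpi_cst// scale1r -cpiM//; last exact: cbmeas_jfun.
by rewrite cpi_cst// scaleNr opprK.
Qed.

Lemma cpi_trunc n f x : cbmeas f -> cpi (trunc n f) x = P (window n) (cpi f x).
Proof.
move=> bf; rewrite -(cpi_indic ip_norm sP _ (measurable_window n)).
rewrite cpiM//; last exact: cbmeas_window.
by apply: cpi_ext => t; rewrite /trunc mulrC.
Qed.

Lemma truncM n f h : trunc n (fun t => f t * h t) =1 (fun t => trunc n f t * h t).
Proof. by move=> t; rewrite /trunc mulrAC. Qed.

Lemma cbmeas_trunc_sub n h : cbmeas h -> cbmeas (trunc n (fun t => fsp t - h t)).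
Proof.
move=> bh.
have -> : trunc n (fun t => fsp t - h t) = (fun t => trunc n fsp t - trunc n h t).
  by apply/funext => t; rewrite /trunc mulrBl.
by apply: cbmeasB; [exact: cbmeas_trunc_fsp|exact: cbmeas_trunc].
Qed.

Section FromResolvent.
Hypothesis Jcpi : forall y, J y = cpi jfun y.

(** A vector x of the domain is J y with y = (a - i) x, so applying l - h to x is
    applying (l - h) / (l - i) to y. The latter function is bounded and its
    operator sends y to a x - h x; truncating l - h therefore truncates this
    vector, and the truncations converge by [window_cvg]. *)
Lemma sq_integral_graph x h : D x -> cbmeas h ->
  sq_integral (spm x) (fun t => fsp t - h t) = (nrm (a x - cpi h x) ^+ 2)%:E.
Proof.
move=> Dx bh; set y := a x - 'i%C *: x.
have xJ : x = J y by rewrite /y (resK ip_norm a_linear a_dense a_sa Imi_neq0 JP).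
have b1 := cbmeas_fsp_jfun; have b2 := cbmeasM bh cbmeas_jfun.
have bf : cbmeas (fun t => (fsp t - h t) * jfun t).
  have -> : (fun t => (fsp t - h t) * jfun t) =
     (fun t => fsp t * jfun t - h t * jfun t) by apply/funext => t; rewrite mulrBl.
  exact: cbmeasB.
have e : cpi (fun t => (fsp t - h t) * jfun t) y = a x - cpi h x.
  have e1 : (fun t => (fsp t - h t) * jfun t) =1 (fun t => fsp t * jfun t - h t * jfun t).
    by move=> t; rewrite mulrBl.
  rewrite (cpi_ext _ e1) cpiB// cpi_fsp_jfun -cpiM//; last exact: cbmeas_jfun.
  by rewrite -!Jcpi -xJ /y subrK.
have h1 := sq_integral_trunc (x := x) (cmeasB cmeas_fsp (cbmeas_cmeas bh))
  (fun n => cbmeas_trunc_sub n bh).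
have e2 n : cpi (trunc n (fun t => fsp t - h t)) x = P (window n) (a x - cpi h x).
  rewrite {1}xJ Jcpi cpiM//; [|exact: cbmeas_trunc_sub|exact: cbmeas_jfun].
  by rewrite -e -cpi_trunc//; apply: cpi_ext => t; rewrite truncM.
move: h1; under eq_fun do rewrite e2; move=> h1.
have h2 : (fun n => (nrm (P (window n) (a x - cpi h x)) ^+ 2)%:E) @ \oo -->
    (nrm (a x - cpi h x) ^+ 2)%:E.
  apply: cvg_EFin; first exact: nearW.
  rewrite -ripxx; under eq_fun do rewrite -ripxx.
  by apply: (cvgH_rip ip_norm); exact: window_cvg.
exact: (cvg_unique _ h1 h2).
Qed.

(** The vectors p n = (l 1_{|l| <= n}) x are Cauchy because their squared norms
    converge to the integral of l^2. As J (p n - i P(|l| <= n) x) = P(|l| <= n) x,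
    the limit shows that x is in the range of J. *)
Lemma dom_of_square_integrable x : (sq_integral (spm x) fsp < +oo)%E -> D x.
Proof.
move=> sfin.
pose p n := cpi (trunc n fsp) x.
have h1 := sq_integral_trunc (x := x) cmeas_fsp cbmeas_trunc_fsp.
have s0 : (0 <= sq_integral (spm x) fsp)%E.
  by apply: integral_ge0 => t _; rewrite lee_fin sqr_ge0.
have sf : sq_integral (spm x) fsp \is a fin_num by rewrite ge0_fin_numE.
set S := fine (sq_integral (spm x) fsp).
have h2 : (fun n => nrm (p n) ^+ 2) @ \oo --> S.
  by move: h1; rewrite -(fineK sf) => /fine_cvg.
have pmn m n : (m <= n)%N -> P (window m) (p n) = p m.
  move=> mn; rewrite /p -cpi_trunc; last exact: cbmeas_trunc_fsp.
  apply: cpi_ext => t; have [w|w] := pselect (window m t).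
    rewrite !trunc_in//; apply: le_trans w _; by rewrite ler_nat.
  by rewrite !(trunc_out _ w).
have rmn m n : (m <= n)%N -> rip (p m) (p n) = nrm (p m) ^+ 2.
  move=> mn; rewrite -{1}(pmn m n mn) (proj_rip ip_norm) ?pmn//.
  exact: spm_proj (measurable_window m).
have nd : nondecreasing_seq (fun n => nrm (p n) ^+ 2).
  move=> m n mn; have := sqr_ge0 (nrm (p n - p m)).
  by rewrite nrm_sub rmn//; lra.
have sS n : nrm (p n) ^+ 2 <= S.
  have cS : cvgn (fun n => nrm (p n) ^+ 2) by apply/cvg_ex; exists S.
  have := nondecreasing_cvgn_le nd cS n.
  by rewrite (cvg_lim (@Rhausdorff R) h2).
have [q pq] : exists q, cvgH p q.
  apply: (@cvgH_cauchy_sq _ _ _ (fun n => S - nrm (p n) ^+ 2)).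
    by rewrite -[X in _ --> X](subrr S); apply: cvgB => //; exact: cvg_cst.
  move=> m n; wlog mn : m n / (m <= n)%N => [hw|].
    by case: (leqP m n) => [/hw//|/ltnW/hw h]; rewrite nrmBC [leRHS]addrC.
  rewrite nrmBC nrm_sub rmn//.
  by have := sS m; have := sS n; lra.
have Jp n : J (p n - 'i%C *: P (window n) x) = P (window n) x.
  have b1 := cbmeas_trunc_fsp n; have bi := cbmeas_cst (T := T) ('i%C : R[i]).
  have bw := cbmeas_window n; have biw := cbmeasM bi bw.
  have -> : p n - 'i%C *: P (window n) x =
      cpi (fun t => trunc n fsp t - 'i%C * (\1_(window n) t)%:C%C) x.
    rewrite cpiB// -cpiM// cpi_cst// cpi_indic//; exact: measurable_window.
  rewrite Jcpi cpiM//; [|exact: cbmeas_jfun|exact: cbmeasB].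
  rewrite -(cpi_indic ip_norm sP x (measurable_window n)).
  by apply: cpi_ext => t; rewrite /trunc -mulrBl mulrA (mulrC (jfun t)) jfunK mul1r.
have -> : x = J (q - 'i%C *: x).
  have h3 := cvgH_op bJ (cvgHB pq (cvgHZ 'i%C (window_cvg x))).
  apply: (cvgH_uniq (window_cvg x)); move: h3.
  by rewrite /cvgH; under eq_fun do rewrite Jp.
exact: (resD JP).
Qed.

Lemma pointwise_of_resolvent : pointwise_integral ip a P fsp.
Proof.
have b0 := cbmeas_cst (T := T) (0 : R[i]).
split.
  apply/seteqP; split=> x /=.
    move=> Dx; split=> //; rewrite sq_integral_diag//.
    have := sq_integral_graph Dx b0.
    have -> : (fun t => fsp t - 0) = fsp by apply/funext => t; rewrite subr0.
    by move=> ->; rewrite ltry.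
  by move=> [_]; rewrite sq_integral_diag//; exact: dom_of_square_integrable.
move=> x [_]; rewrite sq_integral_diag// => /dom_of_square_integrable Dx h mh bh.
have bmh := cbmeas_of_bounded mh bh.
rewrite pi_op_cpi// sq_integral_diag// sq_integral_graph//= sqrtr_sqr.
by rewrite ger0_norm ?nrm_ge0// nrmE.
Qed.

Lemma integral_zero_null x (g : T -> R) A : bmeas g -> (forall t, 0 <= g t) ->
  measurable A -> (forall t, A t -> 0 < g t) ->
  Rintegral (spm x) setT g = 0 -> P A x = 0.
Proof.
move=> bg g0 mA gA Lg.
have int0 : (\int[spm x]_t `|(g t)%:E| = 0)%E.
  under eq_integral do rewrite gee0_abs ?lee_fin//.
  rewrite -(fineK (x := \int[spm x]_t (g t)%:E)%E).
    by move: Lg; rewrite /Rintegral => ->.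
  exact/integrable_fin_num/(bmeas_integrable (spm_setT ip_norm sP x)).
have [N [mN N0 AN]] := (ae_eq_integral_abs (spm x) measurableT
  (measurableT_comp (@EFin_measurable _ _) bg.1)).1 int0.
have : (spm x A <= spm x N)%E.
  apply: le_measure; rewrite ?inE// => t At; apply: AN => /= /(_ Logic.I) [] g00.
  by have := gA t At; rewrite g00 ltxx.
rewrite N0 spmE2// lee_fin => h; apply/nrm_eq0/eqP; rewrite -sqrf_eq0.
by rewrite eq_le h sqr_ge0.
Qed.

Definition sublevel (t : R) := [set s | lam s <= t].

Lemma measurable_sublevel t : measurable (sublevel t).
Proof.
have -> : sublevel t = [set: T] `&` lam @^-1` `]-oo, t]%classic.
  by rewrite setTI; apply/seteqP; split=> s; rewrite /sublevel /= in_itv.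
by apply: mlam => //; exact: measurable_itv.
Qed.

(** With X = (a - i) v, so that v = J X, the number <a v, v> - t |v|^2 is the
    integral of (l - t) / (l^2 + 1) against the measure of X, and its sign on
    {l <= t} and on the complement is that of l - t. *)
Lemma cut_of_resolvent t : cut ip a t (P (sublevel t)).
Proof.
set A := sublevel t; have mA := measurable_sublevel t.
set q := P A; have pq : proj q := spm_proj sP mA.
have bj := cbmeas_jfun; have bfj := cbmeas_fsp_jfun.
have qa : op_commutant a q.
  apply/(res_commutantP ip_norm a_linear a_dense a_sa Imi_neq0 JP (proj_bop pq)) => x.
  rewrite !Jcpi; apply: cpi_commutant => //; exact: spm_commutant.
pose X v := a v - 'i%C *: v.
have Xq v : D v -> q (X v) = X (q v).
  move=> Dv; rewrite /X (linB (proj_lin pq)) (linZ (proj_lin pq)).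
  by have [_ /(_ v Dv)[_ ->]] := qa.
have XJ v : D v -> v = cpi jfun (X v).
  by move=> Dv; rewrite -Jcpi (resK ip_norm a_linear a_dense a_sa Imi_neq0 JP).
have Xa v : D v -> a v = cpi (fun s => fsp s * jfun s) (X v).
  by move=> Dv; rewrite cpi_fsp_jfun -XJ// subrK.
pose k s := (lam s ^+ 2 + 1)^-1.
pose G s := lam s * k s - t * k s.
have bk : bmeas k := bmeas_inv.
have bG : bmeas G by apply: bmeasB; [exact: bmeas_lam_inv|exact: bmeasZ].
have k0 s : 0 < k s by rewrite invr_gt0 lam1_gt0.
have GE s : G s = (lam s - t) * k s by rewrite /G mulrBl.
have main v : D v -> rip (a v) v - t * nrm v ^+ 2 = Rintegral (spm (X v)) setT G.
  move=> Dv; rewrite {1}(Xa v Dv) {2 3}(XJ v Dv) cpi_rip// -ripxx cpi_rip//.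
  rewrite -(bmeas_RintegralZ (spm_setT ip_norm sP (X v))); last first.
    by case: bj => b1 b2; apply: bmeasD; exact: bmeasM.
  rewrite -(bmeas_RintegralB (spm_setT ip_norm sP (X v))); last 2 first.
  - by case: bj => b1 b2; case: bfj => b1' b2'; apply: bmeasD; exact: bmeasM.
  - by apply: bmeasZ; case: bj => b1 b2; apply: bmeasD; exact: bmeasM.
  congr (Rintegral _ _ _); apply/funext => s; rewrite jfunE /=.
  rewrite /G /k; have := lam1_gt0 s => /lt0r_neq0 h; field.
  exact: h.
have supp x B : measurable B -> P B x = x ->
    Rintegral (spm x) setT G = Rintegral (spm x) setT (fun s => G s * \1_B s).
  move=> mB Bx; have bB := bmeas_indic (R := R) mB.
  rewrite -!(rpi_rip1 ip_norm sP)//; last exact: bmeasM.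
  by rewrite -rpiM// rpi_indic// Bx.
have mAC : measurable (~` A) by exact: measurableC.
have bGC : bmeas (fun s => G s * \1_(~` A) s).
  by apply: bmeasM => //; exact: bmeas_indic.
have GC s : 0 <= G s * \1_(~` A) s.
  rewrite indicE; case: (boolP (s \in ~` A)) => [|_]; last by rewrite mulr0.
  rewrite inE /A /sublevel /= => /negP; rewrite -ltNge => h.
  by rewrite mulr1 GE mulr_ge0 ?(ltW (k0 s))// subr_ge0 ltW.
have Xc v : D v -> q v = 0 -> P (~` A) (X v) = X v.
  move=> Dv qv; have := spmU ip_norm sP (X v) mA mAC (setICr A).
  rewrite setUv (spmT sP) -/q Xq// qv /X (app0 a_linear) scaler0 subr0 add0r.
  by move=> <-.
split => //.
- move=> v Dv qv; rewrite -subr_le0 main// (supp _ A)//; last by rewrite -/q Xq// qv.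
  have -> : (0 : R) = 0 * nrm (X v) ^+ 2 by rewrite mul0r.
  rewrite -(bmeas_Rintegral_cst (spm_setT ip_norm sP (X v)) 0).
  apply: (bmeas_Rintegral_le (spm_setT ip_norm sP (X v))).
  + by apply: bmeasM => //; exact: bmeas_indic.
  + exact: bmeas_cst.
  + move=> s; rewrite indicE; case: (boolP (s \in A)) => [|_]; last by rewrite mulr0.
    rewrite inE /A /sublevel /= => h.
    by rewrite mulr1 GE mulr_le0_ge0 ?(ltW (k0 s))// subr_le0.
- move=> v Dv qv; rewrite -subr_ge0 main// (supp _ (~` A))//; last exact: Xc.
  have -> : (0 : R) = 0 * nrm (X v) ^+ 2 by rewrite mul0r.
  rewrite -(bmeas_Rintegral_cst (spm_setT ip_norm sP (X v)) 0).
  by apply: (bmeas_Rintegral_le (spm_setT ip_norm sP (X v))) => //; exact: bmeas_cst.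
- move=> v Dv qv eq; have := main v Dv; rewrite eq subrr => /esym.
  rewrite (supp _ (~` A))//; last exact: Xc.
  move=> /(integral_zero_null bGC GC mAC) h.
  have x0 : X v = 0.
    rewrite -(Xc v Dv qv); apply: h => s ns; rewrite indicE mem_set// mulr1 GE.
    by rewrite mulr_gt0// subr_gt0 ltNge; exact/negP.
  by rewrite (XJ v Dv) x0 -Jcpi (lin0 bJ.1).
Qed.

End FromResolvent.

(** Taking for h the truncations of l in the pointwise integral shows that their
    operators at v = J y converge to a v. On the truncations the identity
    J (l - i) = 1 is part of the bounded calculus, and it passes to the limit. *)
Lemma resolvent_of_pointwise : pointwise_integral ip a P fsp ->
  forall y, J y = cpi jfun y.
Proof.
move=> [domE pw] y; set v := J y.
have Dv : D v by exact: (resD JP).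
have dv : integral_dom ip P fsp v by rewrite -domE.
have sfin : (sq_integral (spm v) fsp < +oo)%E by case: dv; rewrite sq_integral_diag.
have h1 := sq_integral_trunc (x := v) cmeas_fsp cbmeas_trunc_fsp.
have s0 : (0 <= sq_integral (spm v) fsp)%E.
  by apply: integral_ge0 => t _; rewrite lee_fin sqr_ge0.
have sf : sq_integral (spm v) fsp \is a fin_num by rewrite ge0_fin_numE.
pose hn n := trunc n fsp.
have bhn n : cbmeas (hn n) := cbmeas_trunc_fsp n.
have mhn n : cmeasurable (hn n).
  move=> _ B mB; rewrite setTI.
  have -> : hn n @^-1` B = (window n `&` fsp @^-1` B) `|` (~` window n `&` (fun=> 0 : R[i]) @^-1` B).
    apply/seteqP; split=> t; rewrite /preimage /=.
      have [w|w] := pselect (window n t); first by rewrite /hn trunc_in//; left.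
      by rewrite /hn trunc_out//; right.
    case=> -[w]; first by rewrite /hn trunc_in.
    by rewrite /hn trunc_out.
  have mw := measurable_window n.
  apply: measurableU; apply: measurableI => //.
  - by have := clam measurableT mB; rewrite setTI.
  - exact: measurableC.
  - by have := @measurable_cst _ _ T (borel R[i]) setT 0 measurableT B mB; rewrite setTI.
have cb n : cbounded (hn n).
  exists n%:R => t; have [w|w] := pselect (window n t).
    by rewrite /hn trunc_in//= expr0n addr0 sqrtr_sqr.
  by rewrite /hn trunc_out// ComplexField.Normc.normc0.
have e n : nrm (a v - cpi (hn n) v) ^+ 2 =
   fine (sq_integral (spm v) fsp) - nrm (cpi (hn n) v) ^+ 2.
  have := pw v dv (hn n) (mhn n) (cb n).
  rewrite pi_op_cpi// sq_integral_diag// nrmE => -[->].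
  rewrite sqr_sqrtr; last first.
    by apply: fine_ge0; apply: integral_ge0 => t _; rewrite lee_fin sqr_ge0.
  have add : sq_integral (spm v) fsp = (sq_integral (spm v) (fun t => (fsp t - hn n t)%R) +
      sq_integral (spm v) (hn n))%E.
    rewrite -ge0_integralD//; try by move=> t _; rewrite lee_fin sqr_ge0.
    - apply: eq_integral => t _; rewrite -EFinD; congr (_%:E).
      have [w|w] := pselect (window n t).
        by rewrite /hn trunc_in// subrr ComplexField.Normc.normc0 expr0n add0r.
      by rewrite /hn trunc_out// subr0 ComplexField.Normc.normc0 expr0n addr0.
    - by apply: cmeas_normc2; apply: cmeasB; [exact: cmeas_fsp|exact: cbmeas_cmeas].
    - by apply: cmeas_normc2; exact: cbmeas_cmeas.
  have en := cpi_sq_integral ip_norm sP v (bhn n).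
  rewrite en in add; move: sf; rewrite add.
  by case: (sq_integral _ (fun t => _ - _)) => [r|//|//] _ /=; rewrite addrK.
have cv : cvgH (fun n => cpi (hn n) v) (a v).
  apply/cvgHP => eps e0.
  move: h1; rewrite -(fineK sf) => /fine_cvg; rewrite /= => /cvgrPdist_lt /(_ (eps ^+ 2)).
  rewrite exprn_gt0// => /(_ isT)[N _ hN]; exists N => n Nn.
  have := hN n Nn; rewrite /= -e nrmBC ger0_norm ?sqr_ge0//.
  by rewrite ltr_pXn2r ?nnegrE ?nrm_ge0// ltW.
have Jn n : cpi jfun (cpi (hn n) v - 'i%C *: P (window n) v) = P (window n) v.
  have bi := cbmeas_cst (T := T) ('i%C : R[i]).
  have bw := cbmeas_window n; have biw := cbmeasM bi bw.
  have -> : cpi (hn n) v - 'i%C *: P (window n) v =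
      cpi (fun t => hn n t - 'i%C * (\1_(window n) t)%:C%C) v.
    by rewrite cpiB// -cpiM// cpi_cst// cpi_indic//; exact: measurable_window.
  rewrite cpiM//; [|exact: cbmeas_jfun|exact: cbmeasB].
  rewrite -(cpi_indic ip_norm sP v (measurable_window n)).
  by apply: cpi_ext => t; rewrite /hn /trunc -mulrBl mulrA (mulrC (jfun t)) jfunK mul1r.
have bj : bounded_operator (cpi jfun) by apply: cpi_bop; exact: cbmeas_jfun.
have h3 := cvgH_op bj (cvgHB cv (cvgHZ 'i%C (window_cvg v))).
rewrite (resE JP) in h3.
apply: cvgH_uniq h3; rewrite /cvgH; under eq_fun do rewrite Jn.
exact: window_cvg.
Qed.

Section FromFamily.
Local Notation E := (spectral_family ip_norm a_linear a_dense a_sa).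
Hypothesis PE : forall t x, P (sublevel t) x = E t x.

Let Delta y := J y - cpi jfun y.

Let bDelta : bounded_operator Delta.
Proof. by apply: bop_sub => //; apply: cpi_bop; exact: cbmeas_jfun. Qed.

Let Delta_comm t : commutes (E t) Delta.
Proof.
move=> y; rewrite /Delta (linB (proj_lin (family_proj _ _ _ _ t))); congr (_ - _).
  apply/esym; apply: (family_bicommutant ip_norm a_linear a_dense a_sa t).
  exact: (res_commutant ip_norm a_linear a_dense a_sa Imi_neq0 JP).
rewrite -!PE; apply: cpi_commutant; first exact: cbmeas_jfun.
by apply: spm_commutant => //; exact: measurable_sublevel.
Qed.

(** On the range of E t - E s both (a - m) J and the operator of
    (l - m) / (l - i) have norm at most (t - s) / 2, where m is the midpoint. Their
    difference is (i - m) Delta, and |i - m| >= 1. *)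
Let Delta_window s t y : s < t -> E t y = y -> E s y = 0 ->
  nrm (Delta y) <= (t - s) * nrm y.
Proof.
move=> st ty sy.
have Ja := res_commutant ip_norm a_linear a_dense a_sa Imi_neq0 JP.
have bic r : commutes J (E r) by exact: family_bicommutant.
set m := (s + t) / 2.
have m0 : 0 < (t - s) / 2 by rewrite divr_gt0// subr_gt0.
have h1 : nrm (y + ('i%C - m%:C%C) *: J y) <= (t - s) / 2 * nrm y.
  have tw : E t (J y) = J y by rewrite -bic ty.
  have sw : E s (J y) = 0 by rewrite -bic sy (lin0 bJ.1).
  have := family_window st (resD JP y) tw sw.
  rewrite (aresE JP) -/m -addrA -scalerBl => h; apply: le_trans h _.
  rewrite ler_pM2l//; have := res_nrm ip_norm a_sa JP y.
  by rewrite /= normr1 mul1r.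
have h2 : nrm (y + ('i%C - m%:C%C) *: cpi jfun y) <= (t - s) / 2 * nrm y.
  have bj := cbmeas_jfun; have bfj := cbmeas_fsp_jfun.
  have bc := cbmeas_cst (T := T) (m%:C%C : R[i]).
  have bf : cbmeas (fun r => fsp r * jfun r - m%:C%C * jfun r).
    by apply: cbmeasB => //; exact: cbmeasM.
  have e : y + ('i%C - m%:C%C) *: cpi jfun y =
      cpi (fun r => fsp r * jfun r - m%:C%C * jfun r) y.
    rewrite cpiB//; last exact: cbmeasM.
    by rewrite cpi_fsp_jfun -cpiM// cpi_cst// scalerBl addrA.
  pose A := sublevel t `\` sublevel s.
  have mA : measurable A by apply: measurableD; exact: measurable_sublevel.
  have Ay : P A y = y.
    have sub : sublevel s `<=` sublevel t by move=> r /= h; apply: le_trans h (ltW st).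
    have := spmU ip_norm sP y (measurable_sublevel s) mA.
    rewrite /A setDIK setDUK// => /(_ erefl).
    by rewrite !PE ty sy add0r.
  rewrite e -{1}Ay -(cpi_indic ip_norm sP _ mA) cpiM//; last first.
    by apply: cbmeas_real; exact: bmeas_indic.
  have bfA := cbmeasM bf (cbmeas_real (bmeas_indic (R := R) mA)).
  rewrite -(@ler_pXn2r _ 2) ?nnegrE ?nrm_ge0//; last first.
    by rewrite mulr_ge0 ?nrm_ge0 ?(ltW m0).
  rewrite cpi_nrm// exprMn -(bmeas_Rintegral_cst (spm_setT ip_norm sP y)).
  apply: (bmeas_Rintegral_le (spm_setT ip_norm sP y)).
  - exact: bmeas_normc2.
  - exact: bmeas_cst.
  - move=> r; rewrite indicE; case: (boolP (r \in A)) => [|_]; last first.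
      by rewrite mulr0 ComplexField.Normc.normc0 expr0n sqr_ge0.
    rewrite inE => -[rt nrs]; have rs : s < lam r by rewrite ltNge; exact/negP.
    rewrite /sublevel /mkset in rt.
    rewrite mulr1n rmorph1 mulr1 -mulrBl -rmorphB jfunE.
    have l1 := lam1_gt0 r.
    have -> : normc ((lam r - m)%:C%C * ((lam r / (lam r ^+ 2 + 1)) +i* (lam r ^+ 2 + 1)^-1)%C)
        ^+ 2 = (lam r - m) ^+ 2 * (lam r ^+ 2 + 1)^-1.
      rewrite /= sqr_sqrtr ?addr_ge0 ?sqr_ge0//; field.
      exact: lt0r_neq0.
    have : (lam r - m) ^+ 2 <= ((t - s) / 2) ^+ 2.
      by rewrite /m; nra.
    have : (lam r ^+ 2 + 1)^-1 <= 1 by rewrite invf_le1// lerDr sqr_ge0.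
    have : 0 <= (lam r ^+ 2 + 1)^-1 by rewrite invr_ge0 ltW.
    have := sqr_ge0 (lam r - m).
    by move: (_ ^-1) ((lam r - m) ^+ 2) (((t - s) / 2) ^+ 2) => *; nra.
have e : ('i%C - m%:C%C) *: Delta y = (y + ('i%C - m%:C%C) *: J y) -
    (y + ('i%C - m%:C%C) *: cpi jfun y).
  by rewrite /Delta scalerBr opprD addrACA subrr add0r.
have := nrmB (y + ('i%C - m%:C%C) *: J y) (y + ('i%C - m%:C%C) *: cpi jfun y).
rewrite -e nrmZ.
have n1 : 1 <= normc ('i%C - m%:C%C : R[i]).
  by have := normc_Im ('i%C - m%:C%C : R[i]); rewrite /= subr0 normr1.
have := nrm_ge0 (Delta y); move: h1 h2 n1.
move: (normc _) (nrm (Delta y)) (nrm y) (nrm _) (nrm _) => *; nra.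
Qed.

Let pyth (u v : H) r : E r u = u -> E r v = 0 -> nrm (u + v) ^+ 2 = nrm u ^+ 2 + nrm v ^+ 2.
Proof.
move=> ru rv; have uv : rip u v = 0.
  by rewrite -ru (proj_sym (family_proj ip_norm a_linear a_dense a_sa r)) rv rip0r.
by rewrite -!ripxx !ripE (ripC _ v u) uv; ring.
Qed.

Let lE t : linear (E t). Proof. exact: proj_lin (family_proj _ _ _ _ t). Qed.

(** Delta respects the decomposition of the range of E t - E s at the midpoint, so
    squared norms add and the constant improves by a factor 2 at each step. *)
Let Delta_halving k s t x : s < t ->
  nrm (Delta (E t x - E s x)) ^+ 2 <= ((t - s) / 2 ^+ k) ^+ 2 * nrm (E t x - E s x) ^+ 2.
Proof.
elim: k s t => [|k IH] s t st.
  rewrite expr0 divr1 -exprMn ler_pXn2r ?nnegrE ?mulr_ge0 ?nrm_ge0 ?subr_ge0 ?(ltW st)//.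
  apply: Delta_window => //.
    rewrite (linB (lE t)) (projK _ (family_proj _ _ _ _ t)).
    by rewrite (family_ge _ _ _ _ x (ltW st)).
  rewrite (linB (lE s)) (projK _ (family_proj _ _ _ _ s)).
  by rewrite (family_le _ _ _ _ x (ltW st)) subrr.
set m := (s + t) / 2.
have sm : s < m by rewrite /m; lra.
have mt : m < t by rewrite /m; lra.
have e : E t x - E s x = (E m x - E s x) + (E t x - E m x).
  by rewrite [RHS]addrC addrA subrK.
have m1 : E m (E m x - E s x) = E m x - E s x.
  rewrite (linB (lE m)) (projK _ (family_proj _ _ _ _ m)).
  by rewrite (family_ge _ _ _ _ x (ltW sm)).
have m2 : E m (E t x - E m x) = 0.
  rewrite (linB (lE m)) (projK _ (family_proj _ _ _ _ m)).
  by rewrite (family_le _ _ _ _ x (ltW mt)) subrr.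
have d1 : E m (Delta (E m x - E s x)) = Delta (E m x - E s x) by rewrite Delta_comm m1.
have d2 : E m (Delta (E t x - E m x)) = 0 by rewrite Delta_comm m2 (lin0 bDelta.1).
rewrite e (linD bDelta.1) (pyth d1 d2) (pyth m1 m2).
have := IH s m sm; have := IH m t mt.
have -> : (t - m) / 2 ^+ k = (t - s) / 2 ^+ k.+1.
  by rewrite /m exprS; field; rewrite expf_neq0.
have -> : (m - s) / 2 ^+ k = (t - s) / 2 ^+ k.+1.
  by rewrite /m exprS; field; rewrite expf_neq0.
by rewrite mulrDr; lra.
Qed.

Let Delta_slice s t x : s < t -> Delta (E t x - E s x) = 0.
Proof.
move=> st; apply/nrm_eq0/eqP; rewrite -sqrf_eq0; apply/negPn/negP => n0.
set N := nrm _ ^+ 2 in n0; have N0 : 0 < N by rewrite lt_neqAle eq_sym n0 sqr_ge0.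
set M := (t - s) ^+ 2 * nrm (E t x - E s x) ^+ 2.
have h k : N * k%:R <= M.
  have h1 := Delta_halving k x st.
  have k2 : k%:R <= (2 ^+ k) ^+ 2 :> R.
    rewrite -exprM -natrX ler_nat; apply: ltnW.
    by apply: (leq_trans (ltn_expl k (isT : (1 < 2)%N))); rewrite leq_exp2l// leq_pmulr.
  have p0 : 0 < (2 ^+ k) ^+ 2 :> R by rewrite !exprn_gt0.
  move: h1; rewrite -/N expr_div_n mulrAC -/M ler_pdivlMr// => h1.
  by apply: le_trans h1; rewrite ler_pM2l.
have := h (Num.truncn (M / N)).+1.
by rewrite mulrC -ler_pdivlMr// leNgt truncnS_gt.
Qed.

(** Delta vanishes on the range of every E t - E s, and these exhaust H. *)
Lemma resolvent_of_family y : J y = cpi jfun y.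
Proof.
apply/eqP; rewrite -subr_eq0; apply/eqP; rewrite -/(Delta y).
have h := cvgH_op bDelta (cvgHB (cvgH_shift 1 (family_pinfty ip_norm a_linear a_dense a_sa y))
  (cvgH_shift 1 (family_ninfty ip_norm a_linear a_dense a_sa y))).
rewrite subr0 in h; apply: (cvgH_uniq h).
apply: (@cvgH_le _ _ _ _ (fun=> 0)) => [|n]; first exact: cvg_cst.
rewrite Delta_slice ?subrr ?nrm0//.
by rewrite addn1 -subr_gt0 opprK -mulr2n pmulrn_lgt0.
Qed.

End FromFamily.
End Multiplication.

(** * Inner regularity of finite Borel measures on the line *)

Section Regularity.
Context {R : realType}.
Local Notation B_ := (measurableTypeR R).
Variable nu : {measure set (measurableTypeR R) -> \bar R}.
Hypothesis nu_fin : (nu setT < +oo)%E.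

Lemma open_measurableR (U : set R) : open U -> measurable (U : set B_).
Proof. exact: open_measurable. Qed.

Lemma closed_measurableR (F : set R) : closed F -> measurable (F : set B_).
Proof. exact: closed_measurable. Qed.

Let fin (A : set B_) : measurable A -> (nu A < +oo)%E.
Proof. by move=> mA; apply: le_lt_trans nu_fin; apply: le_measure; rewrite ?inE. Qed.

Let approx (A : set B_) (e : R) := exists F U : set R,
  [/\ closed F, open U, F `<=` A, A `<=` U & (nu (U `\` F) < e%:E)%E].

Let decreasing_lt (A : nat -> set B_) (e : \bar R) : (forall n, measurable (A n)) ->
  nonincreasing_seq A -> (nu (\bigcap_n A n) < e)%E -> exists n, (nu (A n) < e)%E.
Proof.
move=> mA dA lte.
have h : nu \o A @ \oo --> nu (\bigcap_n A n).
  by apply: nonincreasing_cvg_mu => //; [exact: fin|exact: bigcap_measurable].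
apply: contrapT => /forallNP nlt; move: lte; rewrite ltNge => /negP; apply.
rewrite -(cvg_lim (@ereal_hausdorff R) h); apply: lime_ge.
  by apply/cvg_ex; exists (nu (\bigcap_n A n)).
by apply: nearW => n /=; rewrite leNgt; exact/negP.
Qed.

(** The sets with such approximations form a sigma-algebra, which contains the
    half-lines. *)
Lemma closed_open_approx (A : set B_) (e : R) : measurable A -> 0 < e -> approx A e.
Proof.
rewrite measurableR_gen => mA; move: e; move: mA.
suff : <<s @RGenOInfty.G R >> `<=` [set A | forall e, 0 < e -> approx A e] by exact.
clear A; apply: smallest_sub; last first.
  move=> _ [t ->] e e0.
  pose F n : set R := `[t + n.+1%:R^-1, +oo[%classic.
  have cF n : closed (F n) by exact: interval_closed.
  have oU : open (`]t, +oo[%classic : set R) by exact: interval_open.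
  have [|||n hn] := @decreasing_lt (fun n => `]t, +oo[%classic `\` F n) e%:E.
  - by move=> n; apply: measurableD; [exact: open_measurableR|exact: closed_measurableR].
  - move=> m n mn; apply/subsetPset => s [ts nF]; split=> // Fm; apply: nF.
    move: Fm; rewrite /F /= !in_itv/= !andbT; apply: le_trans.
    by rewrite lerD2l lef_pV2 ?posrE ?ltr0n// ler_nat.
  - rewrite (_ : \bigcap_n _ = set0) ?measure0 ?lte_fin//.
    rewrite -subset0 => s h; have [] := h 0%N I; rewrite /= in_itv/= andbT => ts _.
    have st : 0 < s - t by rewrite subr_gt0.
    have [N _ /(_ N (leqnn N)) /= hN] := near_infty_natSinv_lt (PosNum st).
    have [_] := h N I; apply; rewrite /F /= in_itv/= andbT.
    by rewrite -lerBrDl ltW.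
  exists (F n), `]t, +oo[%classic; split=> // s; rewrite /F /= !in_itv/= !andbT.
  by apply: lt_le_trans; rewrite ltrDl invr_gt0.
split.
- move=> e e0; exists set0, set0; split=> //; first exact: closed0.
  by rewrite setD0 measure0 lte_fin.
- move=> A hA e /hA[F [U [cF oU FA AU h]]]; exists (~` U), (~` F); split.
  + exact: open_closedC.
  + exact: closed_openC.
  + by move=> s Us; split=> // /AU.
  + by move=> s [_ nA] /FA.
  + by rewrite setDE setCK setIC -setDE.
- move=> A hA e e0.
  have e2 : 0 < e / 2 by rewrite divr_gt0.
  have hn n : {FU : set R * set R | [/\ closed FU.1, open FU.2, FU.1 `<=` A n,
      A n `<=` FU.2 & (nu (FU.2 `\` FU.1) < (e / 2 / (2 ^ n.+1)%:R)%:E)%E]}.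
    apply: cid; have [|F [U h]] := hA n (e / 2 / (2 ^ n.+1)%:R); last by exists (F, U).
    by rewrite divr_gt0// ltr0n expn_gt0.
  pose F n := (sval (hn n)).1; pose U n := (sval (hn n)).2.
  have FU n := svalP (hn n).
  pose V := \bigcup_n U n; pose G (N : nat) := \bigcup_(n in `I_N) F n.
  have oV : open V by apply: bigcup_open => n _; case: (FU n).
  have cG N : closed (G N) by apply: closed_bigcup => // n _; case: (FU n).
  have [|||N hN] := @decreasing_lt (fun N => V `\` G N) e%:E.
  + by move=> N; apply: measurableD; [exact: open_measurableR|exact: closed_measurableR].
  + move=> m n mn; apply/subsetPset => s [Vs nG]; split=> // -[k km Fk].
    by apply: nG; exists k => //; exact: leq_trans km mn.
  + have mD n : measurable (U n `\` F n : set B_).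
      by have [cF oU _ _ _] := FU n; apply: measurableD;
         [exact: open_measurableR|exact: closed_measurableR].
    have mI : measurable (\bigcap_N (V `\` G N) : set B_).
      apply: bigcap_measurable => [|N _]; first by exists 0%N.
      by apply: measurableD; [exact: open_measurableR|exact: closed_measurableR].
    have sub : \bigcap_N (V `\` G N) `<=` \bigcup_n (U n `\` F n).
      move=> s h; have [[n _ Us] _] := h 0%N I.
      exists n => //; split=> // Fs; have [_] := h n.+1 I; apply.
      by exists n => /=.
    apply: le_lt_trans (measure_sigma_subadditive _ mD mI sub) _.
    apply: (@le_lt_trans _ _ (e / 2)%:E); last by rewrite lte_fin gtr_pMr// invf_lt1// ltr1n.
    apply: le_trans _ (@epsilon_trick0 R (e / 2) xpredT (ltW e2)).
    by apply: lee_nneseries => // n _; have [_ _ _ _ /ltW] := FU n.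
  exists (G N), V; split=> //.
    by move=> s [n _ Fs]; exists n => //; have [_ _ + _ _] := FU n; exact.
  by move=> s [n _ As]; exists n => //; have [_ _ _ + _] := FU n; exact.
Qed.

(** A closed set is the increasing union of its bounded parts, which are compact. *)
Lemma compact_inner_approx (A : set B_) (e : R) : measurable A -> 0 < e ->
  exists K : set R, [/\ compact K, K `<=` A & (nu A <= nu K + e%:E)%E].
Proof.
move=> mA e0; have [F [U [cF oU FA AU h]]] := closed_open_approx mA e0.
have mF : measurable (F : set B_) by exact: closed_measurableR.
pose I_ (n : nat) : set R := `[- n%:R, n%:R]%classic.
have mI n : measurable (I_ n : set B_) by exact: measurable_itv.
have [|||n hn] := @decreasing_lt (fun n => A `\` (F `&` I_ n)) e%:E.
- by move=> n; apply: measurableD => //; exact: measurableI.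
- move=> m n mn; apply/subsetPset => s [As nF]; split=> // -[Fs Im]; apply: nF.
  split=> //; move: Im; rewrite /I_ /= !in_itv/= => /andP[h1 h2]; apply/andP; split.
    by apply: le_trans h1; rewrite lerN2 ler_nat.
  by apply: le_trans h2 _; rewrite ler_nat.
- apply: le_lt_trans h; apply: le_measure; rewrite ?inE.
  + by apply: bigcap_measurable => [|n _]; [by exists 0%N|]; apply: measurableD => //; exact: measurableI.
  + by apply: measurableD => //; exact: open_measurableR.
  move=> s hs; have [As _] := hs 0%N I; split; first exact: AU.
  move=> Fs; have [_] := hs (Num.truncn `|s|).+1 I; apply; split=> //.
  by rewrite /I_ /= in_itv/= -ler_norml ltW// truncnS_gt.
exists (F `&` I_ n); split.
- by rewrite setIC; apply: compact_closedI => //; exact: segment_compact.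
- by move=> s [/FA].
have -> : nu A = (nu (F `&` I_ n) + nu (A `\` (F `&` I_ n)))%E.
  rewrite -measureU//; [|exact: measurableI|by apply: measurableD => //; exact: measurableI|exact: setDIK].
  by rewrite setDUK// => s [/FA].
by rewrite leeD2l// ltW.
Qed.

End Regularity.

Lemma image_measure (R : realType) d1 d2 (T1 : measurableType d1)
    (T2 : measurableType d2) (m : {measure set T1 -> \bar R}) (f : T1 -> T2) :
  measurable_fun [set: T1] f ->
  exists nu : {measure set T2 -> \bar R}, forall A, nu A = m (f @^-1` A).
Proof.
by move=> mf; unshelve eexists (pushforward m f); first exact: mf.
Qed.

(** * Closed sets of real numbers as topological and measurable spaces *)

Section RealSpectrum.
Context {R : realType}.
Variable S : set R[i].
Hypothesis S_real : forall z, S z -> z = (complex.Re z)%:C%C.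
Hypothesis S_closed : closed [set t : R | S t%:C%C].
Variable l0 : S.
Local Notation Omega := (pointed_at l0 : ptopologicalType).
Local Notation B_ := (measurableTypeR R).

(** The real number l, for l in a set of complex numbers that are all real. *)
Definition coord (l : Omega) : R := complex.Re (set_val (l : S)).

(** A left inverse of [coord] defined on the whole line; points off the set go to
    l0. *)
Definition uncoord (t : R) : Omega :=
  if pselect (S t%:C%C) is left h then
    exist (fun z => z \in S) t%:C%C (mem_set h) else l0.

Let SR := [set t : R | S t%:C%C].

Lemma coordE (l : Omega) : set_val (l : S) = (coord l)%:C%C.
Proof. by apply: S_real; exact: set_valP. Qed.

Lemma coordP (l : Omega) : S (coord l)%:C%C.
Proof. by rewrite -coordE; exact: set_valP. Qed.

Lemma uncoord_val t : SR t -> set_val (uncoord t : S) = t%:C%C.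
Proof. by rewrite /uncoord; case: pselect. Qed.

Lemma uncoordK t : SR t -> coord (uncoord t) = t.
Proof. by move=> St; rewrite /coord uncoord_val. Qed.

Lemma coordK l : uncoord (coord l) = l.
Proof. by apply: val_inj => /=; rewrite -set_valE uncoord_val ?coordE//; exact: coordP. Qed.

Lemma continuous_set_val : continuous (set_val : Omega -> R[i]).
Proof. exact: (@initial_continuous (set_type S) R[i] set_val). Qed.

Lemma continuous_coord : continuous coord.
Proof.
by move=> l; apply: (continuous_comp (@continuous_set_val l)); exact: continuous_Re.
Qed.

Lemma uncoord_within : {within SR, continuous uncoord}.
Proof.
apply: (@continuous_comp_initial (set_type S) (subspace SR) R[i] set_val).
apply: (@subspace_eq_continuous _ SR _ (real_complex R)).
  by move=> t; rewrite inE => St; rewrite [RHS]uncoord_val.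
by apply: continuous_subspaceT; exact: continuous_real_complex.
Qed.

Lemma measurable_coord : measurable_fun [set: borel Omega] (coord : borel Omega -> R).
Proof. exact: continuous_measurable_borel continuous_coord. Qed.

Lemma cmeasurable_coord : cmeasurable (fun l : borel Omega => (coord l)%:C%C).
Proof.
move=> mD; apply: (@measurability _ _ _ (borel R[i]) _ _ open) => //.
move=> _ [U oU <-]; rewrite setTI; apply: open_measurable_borel.
have -> : (fun l : Omega => (coord l)%:C%C) = (set_val : Omega -> R[i]).
  by apply/funext => l; rewrite coordE.
by move/continuousP: continuous_set_val; exact.
Qed.

(** Continuous on the closed set of the real numbers in S, constant off it. *)
Lemma measurable_uncoord : measurable_fun [set: B_] (uncoord : B_ -> borel Omega).
Proof.
move=> mD; apply: (@measurability _ _ _ (borel Omega) _ _ open) => //.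
move=> _ [U oU <-]; rewrite setTI.
have mS : measurable (SR : set B_) by exact: closed_measurableR.
have -> : uncoord @^-1` U = (SR `&` uncoord @^-1` U) `|` (~` SR `&` uncoord @^-1` U).
  by rewrite -setIUl setUv setTI.
have [W oW WU] := oU.
apply: measurableU.
  rewrite (_ : _ `&` _ = SR `&` real_complex R @^-1` W).
    apply: measurableI => //; apply: open_measurableR.
    by move/continuousP: (@continuous_real_complex R); exact.
  by apply/seteqP; split=> t [St]; rewrite -WU /preimage /= uncoord_val.
have out t : ~ SR t -> uncoord t = l0 by rewrite /uncoord; case: pselect.
have [l0U|l0U] := pselect (U l0).
  rewrite (_ : _ `&` _ = ~` SR); first exact: measurableC.
  by apply/seteqP; split=> t => [[]//|nS]; split=> //; rewrite /preimage /= out.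
rewrite (_ : _ `&` _ = set0)//.
by rewrite -subset0 => t [nS]; rewrite /preimage /= out.
Qed.

(** The image under the continuous map [uncoord] of the part of K that lies in the
    set; closedness of the set makes this part compact. *)
Lemma compact_coord (K : set R) : compact K -> compact (coord @^-1` K : set Omega).
Proof.
move=> cK.
have -> : coord @^-1` K = uncoord @` (K `&` SR).
  apply/seteqP; split=> [l Kl|_ [t [Kt St] <-]]; last by rewrite /preimage /= uncoordK.
  by exists (coord l); [split=> //; exact: coordP|exact: coordK].
apply: continuous_compact; last exact: compact_closedI.
by apply: continuous_subspaceW uncoord_within => t [].
Qed.

Lemma hausdorff_Omega : hausdorff_space Omega.
Proof.
rewrite open_hausdorff => l m lm.
have cm : coord l != coord m by apply: contra_neq lm => h; rewrite -(coordK l) h coordK.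
have := @Rhausdorff R; rewrite open_hausdorff => /(_ _ _ cm)[[A B] /= [lA mB] [oA oB AB]].
exists (coord @^-1` A, coord @^-1` B); first by move: lA mB; rewrite !inE.
split; [by move/continuousP: continuous_coord; exact..|].
by rewrite /= -preimage_setI (eqP AB) preimage_set0.
Qed.

Lemma locally_compact_Omega : locally_compact [set: Omega].
Proof.
move=> l _.
set K := coord @^-1` `[coord l - 1, coord l + 1]%classic.
have cK : compact K by apply: compact_coord; exact: segment_compact.
exists K; last by split=> //; exact: compact_closed hausdorff_Omega cK.
have : nbhs l K; last by apply: filterS => m Km _.
apply: continuous_coord; apply: (@filterS _ _ _ (ball (coord l) 1)).
  by move=> t; rewrite /ball /= in_itv/= ltr_norml => /andP[h1 h2]; apply/andP; split; lra.
exact: nbhsx_ballx.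
Qed.

(** The image of m on the line is inner regular, and [coord] has compact
    preimages of compact sets. *)
Lemma inner_regular_Omega (m : {measure set (borel Omega) -> \bar R})
    (mu : set (borel Omega) -> \bar R) : (m setT < +oo)%E ->
  (forall w, measurable w -> mu w = m w) -> inner_regular mu.
Proof.
move=> mfin mum w mw.
have mcK (K : set Omega) : compact K -> measurable (K : set (borel Omega)).
  move=> cK; rewrite -(setCK K); apply: measurableC; apply: open_measurable_borel.
  exact/closed_openC/(compact_closed hausdorff_Omega cK).
apply/eqP; rewrite eq_le; apply/andP; split; last first.
  apply: ge_ereal_sup => _ [K [cK Kw] <-]; rewrite !mum//; last exact: mcK.
  by apply: le_measure; rewrite ?inE//; exact: mcK.
rewrite mum//; apply/lee_addgt0Pr => e e0.
have [nu nuE] := @image_measure _ _ _ _ B_ m _ measurable_coord.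
have nufin : (nu setT < +oo)%E by rewrite nuE preimage_setT.
have mB : measurable (uncoord @^-1` w : set B_).
  by rewrite -[X in measurable X]setTI; exact: measurable_uncoord.
have [K [cK KB hK]] := compact_inner_approx nufin mB e0.
have wE : coord @^-1` (uncoord @^-1` w) = w.
  by apply/seteqP; split=> l; rewrite /preimage /= coordK.
have cK' := compact_coord cK.
move: hK; rewrite !nuE wE => h; apply: le_trans h _.
rewrite leeD2r//; apply: ereal_sup_ubound; exists (coord @^-1` K) => /=.
  by split=> // l /KB; rewrite /preimage /= coordK.
by rewrite mum//; exact: mcK.
Qed.

End RealSpectrum.

(** * The spectral theorem *)

Section SpectralTheorem.
Context {R : realType} {H : completeNormedModType R[i]}.
Variable ip : {dot H for Num.conj}.
Hypothesis ip_norm : forall x : H, `|x| ^+ 2 = ip x x.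
Local Notation B_ := (measurableTypeR R).
Local Notation rip := (rip ip).
Local Notation proj := (orthogonal_projection ip).

Lemma halfline_compl (t : R) : ~` `]t, +oo[%classic = `]-oo, t]%classic.
Proof.
apply/seteqP; split=> s /=; rewrite !in_itv/= andbT.
  by move/negP; rewrite -leNgt.
by move=> st; apply/negP; rewrite -leNgt.
Qed.

Lemma measure_halfline_eq (m1 m2 : {measure set B_ -> \bar R}) :
  (m1 setT < +oo)%E -> (forall t, m1 `]t, +oo[%classic = m2 `]t, +oo[%classic) ->
  forall B, measurable B -> m1 B = m2 B.
Proof.
move=> fin1 e B mB.
apply: (@measure_unique _ R B_ (@RGenOInfty.G R) (fun k => `]- k%:R, +oo[%classic)) => //.
- exact: measurableR_gen.
- move=> _ _ [s ->] [t ->]; exists (Num.max s t).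
  apply/seteqP; split=> u /=; rewrite !in_itv/= !andbT gt_max.
    by case=> -> ->.
  by move=> /andP[].
- by move=> k; exists (- k%:R).
- apply/seteqP; split=> // s _; exists (Num.truncn `|s|).+1 => //=.
  rewrite in_itv/= andbT ltrNl; apply: le_lt_trans (truncnS_gt _).
  by rewrite -normrN ler_norm.
- by move=> _ [t ->].
- move=> k; apply: le_lt_trans fin1; apply: le_measure; rewrite ?inE//.
Qed.

(** For fixed x both sides give finite Borel measures on the line that agree on
    half-lines. *)
Lemma spectral_measure_eq d (T : measurableType d) (P Q : set T -> H -> H) (lam : T -> R) :
  spectral_measure ip P -> spectral_measure ip Q -> measurable_fun setT lam ->
  (forall t x, P (sublevel lam t) x = Q (sublevel lam t) x) ->
  forall B : set B_, measurable B -> P (lam @^-1` B) = Q (lam @^-1` B).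
Proof.
move=> sP sQ mlam e B mB; apply/funext => x.
have mlB : measurable (lam @^-1` B) by rewrite -[X in measurable X]setTI; exact: mlam.
have pP := spm_proj sP mlB; have pQ := spm_proj sQ mlB.
apply: (symop_ext ip_norm (proj_lin pP) (proj_lin pQ) (proj_sym pP) (proj_sym pQ)) => {}x.
have [m1 m1E] := @image_measure _ _ _ _ B_ (spm sP x) _ mlam.
have [m2 m2E] := @image_measure _ _ _ _ B_ (spm sQ x) _ mlam.
have : m1 B = m2 B.
  apply: measure_halfline_eq => //.
    by rewrite m1E preimage_setT (spm_setT ip_norm) ltry.
  move=> t; have mS := measurable_sublevel mlam t.
  rewrite m1E m2E (_ : _ @^-1` _ = ~` sublevel lam t); last first.
    apply/seteqP; split=> s; rewrite /sublevel /= in_itv/= andbT ltNge.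
      by move/negP.
    by move=> h; exact/negP.
  rewrite (measureC_fin mS (spm_setT ip_norm sP x) (spmE sP x mS)).
  by rewrite (measureC_fin mS (spm_setT ip_norm sQ x) (spmE sQ x mS)) e.
by rewrite m1E m2E !spmE// => -[].
Qed.

Variable a : operator H.
Hypothesis a_linear : linear_operator a.
Hypothesis a_dense : dense (dom a).
Hypothesis a_sa : self_adjoint ip a.
Local Notation E := (spectral_family ip_norm a_linear a_dense a_sa).
Local Notation SR := [set t : R | spectrum a t%:C%C].

(** The lower bound that characterises a real regular value t survives, with half
    the constant, for real numbers near t. *)
Lemma real_spectrum_closed : closed SR.
Proof.
rewrite -[X in closed X]setCK; apply: open_closedC; rewrite openE => t /contrapT.
move=> /(real_regularP ip_norm a_linear a_dense a_sa)[c c0 hc].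
have c2 : 0 < c / 2 by rewrite divr_gt0.
apply: (@filterS _ _ _ (ball t (c / 2))); last exact: nbhsx_ballx.
move=> s; rewrite /ball /= => ts; apply.
apply/(real_regularP ip_norm a_linear a_dense a_sa); exists (c / 2) => // v Dv.
have h1 := hc v Dv.
have e : a v - t%:C%C *: v = (a v - s%:C%C *: v) - (t - s)%:C%C *: v.
  by rewrite rmorphB scalerBl opprB addrA subrK.
have := nrmB (a v - s%:C%C *: v) ((t - s)%:C%C *: v).
rewrite -e nrmZR; move: h1 (nrm_ge0 v) ts.
move: (nrm _) (nrm _) (nrm _) (`|t - s|) => *; nra.
Qed.

Section RealMeasure.
Variable mu : {measure set B_ -> \bar R}.
Variable x : H.
Hypothesis muT : mu setT = (nrm x ^+ 2)%:E.
Hypothesis muI : forall t, mu `]t, +oo[%classic = (rip (x - E t x) x)%:E.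

Lemma regular_interval_null s t : s <= t -> E s x = E t x -> mu `]s, t]%classic = 0%E.
Proof.
move=> st e.
have : mu `]s, +oo[%classic = (mu `]s, t]%classic + mu `]t, +oo[%classic)%E.
  rewrite -measureU//; last first.
    by rewrite -subset0 => u /=; rewrite !in_itv/= andbT => -[/andP[_ h]]; rewrite ltNge h.
  congr (mu _); apply/seteqP; split=> u /=; rewrite !in_itv/= !andbT.
    by move=> ->; have [|] := leP u t; [left|right].
  by case=> [/andP[]//|]; exact: le_lt_trans.
rewrite !muI e; case: (mu `]s, t]%classic) => //= r [] h.
by congr (_%:E); apply: (addIr (rip (x - E t x) x)); rewrite add0r.
Qed.

(** Every regular real number lies in an interval with rational end points on which
    E is constant; such intervals are null and countable in number. *)
Lemma regular_null : mu (~` SR) = 0%E.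
Proof.
pose F (n : nat) : set B_ :=
  if @unpickle (rat * rat)%type n is Some pq then
    if mu `]ratr pq.1, ratr pq.2]%classic == 0%E then `]ratr pq.1, ratr pq.2]%classic
    else set0
  else set0.
have mF n : measurable (F n).
  by rewrite /F; case: unpickle => [pq|//]; case: ifP.
have F0 n : mu (F n) = 0%E.
  by rewrite /F; case: unpickle => [pq|]; [case: ifPn => [/eqP//|_]|]; rewrite measure0.
have sub : ~` SR `<=` \bigcup_n F n.
  move=> t /contrapT/(family_const_near_regular ip_norm a_linear a_dense a_sa)[e e0 hE].
  have h1 : t - e < t by rewrite ltrBlDr ltrDl.
  have h2 : t < t + e by rewrite ltrDl.
  have [p] := rat_in_itvoo h1; rewrite in_itv /= => /andP[p1 p2].
  have [q] := rat_in_itvoo h2; rewrite in_itv /= => /andP[q1 q2].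
  have FE : F (pickle (p, q)) = if mu `]ratr p, ratr q]%classic == 0%E
      then `]ratr p, ratr q]%classic else set0 by rewrite /F pickleK.
  exists (pickle (p, q)); [exact: I|rewrite FE ifT].
    by rewrite /= in_itv/= p2 ltW.
  apply/eqP; apply: regular_interval_null; first exact: ltW (lt_trans p2 q1).
  have cst r : t - e <= r -> r <= t + e -> E r x = E (t - e) x.
    move=> r1 r2; rewrite -(family_le ip_norm a_linear a_dense a_sa x r2) -hE.
    exact: family_ge.
  by rewrite !cst// ltW// (lt_trans _ q1, lt_trans p2).
have mS : measurable (~` SR : set B_).
  by apply: measurableC; exact: closed_measurableR real_spectrum_closed.
apply/eqP; rewrite eq_le measure_ge0 andbT.
apply: le_trans (measure_sigma_subadditive _ mF mS sub) _.
by rewrite eseries0// => n _ _; exact: F0.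
Qed.

Lemma measure_setI_spectrum A : measurable A -> mu A = mu (A `&` SR).
Proof.
move=> mA; have mS := closed_measurableR real_spectrum_closed.
have -> : mu A = (mu (A `&` SR) + mu (A `&` ~` SR))%E.
  rewrite -measureU; [by rewrite -setIUr setUv setIT|exact: measurableI|
    by apply: measurableI => //; exact: measurableC|].
  by rewrite setIACA setICr setI0.
have -> : mu (A `&` ~` SR) = 0%E; last by rewrite adde0.
apply/eqP; rewrite eq_le measure_ge0 andbT -regular_null.
by apply: le_measure; rewrite ?inE//; [apply: measurableI => //|]; exact: measurableC.
Qed.

(** The half-lines ]t, +oo[ carry the complementary mass. *)
Lemma measure_ray t : mu `]-oo, t]%classic = (rip (E t x) x)%:E.
Proof.
rewrite -halfline_compl (measureC_fin _ muT (muI t))//; congr (_%:E).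
rewrite ripDl ripNl (ripxx ip_norm); ring.
Qed.

End RealMeasure.

Lemma real_projection_measure : exists P : set B_ -> H -> H,
  exists mu : H -> {measure set B_ -> \bar R},
  [/\ forall B, measurable B -> proj (P B),
      forall B c, measurable B -> bounded_operator c ->
         (forall t, commutes c (E t)) -> commutes c (P B),
      forall B x, measurable B -> mu x B = (rip (P B x) x)%:E,
      forall x, mu x setT = (nrm x ^+ 2)%:E
    & forall t x, mu x `]t, +oo[%classic = (rip (x - E t x) x)%:E].
Proof.
apply: (projection_valued_measure ip_norm).
- exact: family_proj.
- by move=> s t x; exact: family_le.
- exact: family_right_continuous.
- exact: family_pinfty.
- exact: family_ninfty.
Qed.

Lemma spectrum_nonempty : (exists x : H, x != 0) -> spectrum a !=set0.
Proof.
move=> [x x0]; have [P [mu [_ _ _ muT muI]]] := real_projection_measure.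
apply: contrapT => /set0P/negP/negPn/eqP s0.
have := regular_null (muI^~ x); rewrite (_ : ~` _ = setT) ?muT; last first.
  by apply/seteqP; split=> // t _ /=; rewrite s0.
move=> [] /eqP; rewrite sqrf_eq0 => /eqP/nrm_eq0 e.
by rewrite e eqxx in x0.
Qed.

Section OnSpectrum.
Variable l0 : spectrum a.
Local Notation Omega := (pointed_at l0 : ptopologicalType).
Local Notation coord := (@coord R (spectrum a) l0).
Local Notation bcoord := (coord : Measurable.sort (borel Omega) -> R).
Local Notation uncoord := (@uncoord R (spectrum a) l0).
Let S_real := @spectrum_real _ _ _ ip_norm _ a_linear a_dense a_sa.
Let S_closed := real_spectrum_closed.

Let muncoord (w : set (borel Omega)) : measurable w -> measurable (uncoord @^-1` w : set B_).
Proof.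
by move=> mw; rewrite -[X in measurable X]setTI; exact: (measurable_uncoord S_closed).
Qed.

Let mcoord : measurable_fun [set: borel Omega] coord := @measurable_coord _ _ _.

Let ccoord : cmeasurable (fun l : borel Omega => (coord l)%:C%C).
Proof. exact: cmeasurable_coord. Qed.

(** The projections on the line, pulled back along [uncoord]. For a half-line the
    preimage of {l <= t} differs from ]-oo, t] off the spectrum only, where the
    measures vanish. *)
Lemma spectral_measure_ex : exists P : set (borel Omega) -> H -> H,
  [/\ spectral_measure ip P,
      forall t x, P (sublevel bcoord t) x = E t x
    & forall w c, measurable w -> op_commutant a c -> commutes c (P w)].
Proof.
have [P0 [mu [P0p P0c muE muT muI]]] := real_projection_measure.
pose P (w : set (borel Omega)) := P0 (uncoord @^-1` w).
have pP w : measurable w -> proj (P w) by move=> /muncoord; exact: P0p.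
exists P; split.
- split=> //.
    have pT := P0p setT measurableT; have pid := proj_id ip.
    apply/funext => x; rewrite /P preimage_setT.
    apply: (symop_ext ip_norm (proj_lin pT) (proj_lin pid) (proj_sym pT) (proj_sym pid)) => {}x.
    by have := muE setT x measurableT; rewrite muT => -[<-]; rewrite (ripxx ip_norm).
  move=> x; have [m mE] := image_measure (mu x) (measurable_uncoord S_closed (l0 := l0)).
  by exists m => w mw; rewrite mE muE//; exact: muncoord.
- move=> t x; have mS := muncoord (measurable_sublevel mcoord t).
  have pS := P0p _ mS; have pE := family_proj ip_norm a_linear a_dense a_sa t.
  apply: (symop_ext ip_norm (proj_lin pS) (proj_lin pE) (proj_sym pS) (proj_sym pE)) => {}x.
  have := muE _ x mS; rewrite (measure_setI_spectrum (muI^~ x))//.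
  rewrite (_ : _ `&` _ = `]-oo, t]%classic `&` SR); last first.
    apply/seteqP; split=> s [h Ss]; split=> //; move: h;
      by rewrite /sublevel /preimage /= uncoordK// in_itv.
  by rewrite -(measure_setI_spectrum (muI^~ x))// (measure_ray (muT x) (muI^~ x)) => -[].
- move=> w c mw ca; apply: P0c; [exact: muncoord|by case: ca|].
  by move=> t; exact: family_bicommutant.
Qed.

Section Properties.
Variable P : set (borel Omega) -> H -> H.
Hypothesis sP : spectral_measure ip P.
Hypothesis PE : forall t x, P (sublevel bcoord t) x = E t x.
Variable J : H -> H.
Hypothesis JP : resolvent a 'i%C J.
Let Jcpi := resolvent_of_family JP sP mcoord PE.

Lemma commutant_of_measure_commutant c : measure_commutant P c -> op_commutant a c.
Proof.
move=> cP; apply/(res_commutantP ip_norm a_linear a_dense a_sa (@Imi_neq0 R) JP (cP.1)) => x.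
by rewrite !Jcpi; apply: cpi_commutant => //; exact: cbmeas_jfun.
Qed.

(** Suppose l is in u. All m with |m - l| < e are in u for some e > 0, so the
    measure of x lives where |m - l| >= e, and |(a - l) x|^2, the integral of
    |m - l|^2, is at least e^2 |x|^2. Then l is a regular value. *)
Lemma open_null_empty (u : set Omega) : open u -> P u = (fun=> 0) -> u `<=` set0.
Proof.
move=> ou Pu l ul.
have [e e0 he] : exists2 e : R, 0 < e & forall m : Omega, `|coord m - coord l| < e -> u m.
  have [W oW WU] := ou.
  have : nbhs (coord l) (real_complex R @^-1` W).
    apply: open_nbhs_nbhs; split.
      by move/continuousP: (@continuous_real_complex R); exact.
    by rewrite /preimage /= -(coordE S_real); move: ul; rewrite -WU.
  move=> /nbhs_ballP[e /= e0 eW]; exists e => // m ml.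
  rewrite -WU /preimage /= (coordE S_real (l0 := l0)); apply: eW.
  by rewrite /ball /= distrC.
have mu_ : measurable (u : set (borel Omega)) by exact: open_measurable_borel.
have mcu := measurableC mu_.
apply: (@coordP _ _ S_real _ l).
apply/(real_regularP ip_norm a_linear a_dense a_sa); exists e => // x Dx.
have bc := cbmeas_cst (T := borel Omega) ((coord l)%:C%C : R[i]).
have := sq_integral_graph a_linear a_dense a_sa JP mcoord Jcpi Dx bc.
rewrite cpi_cst// => h.
have muC : spm sP x (~` u) = (nrm x ^+ 2)%:E.
  rewrite (measureC_fin mu_ (spm_setT ip_norm sP x) (spmE sP x mu_)).
  by rewrite Pu rip0l subr0.
rewrite -(@ler_pXn2r _ 2) ?nnegrE ?mulr_ge0 ?nrm_ge0 ?(ltW e0)//.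
rewrite -lee_fin -h exprMn EFinM -muC.
have mf := cmeas_normc2 (cmeasB (cmeas_fsp mcoord) (cbmeas_cmeas bc)).
apply: (@le_trans _ _ (\int[spm sP x]_(t in ~` u)
    (ComplexField.Normc.normc ((coord t)%:C%C - (coord l)%:C%C) ^+ 2)%:E)%E); last first.
  by apply: ge0_subset_integral => // t _; rewrite lee_fin sqr_ge0.
rewrite -(integral_cst _ mcu (e ^+ 2)%:E); apply: ge0_le_integral => //.
- by move=> t _; rewrite lee_fin sqr_ge0.
- exact: measurable_funTS.
- move=> t ut; rewrite lee_fin -rmorphB /= expr0n addr0 sqrtr_sqr.
  rewrite ler_pXn2r ?nnegrE ?(ltW e0)// leNgt; apply/negP => /he; exact: ut.
Qed.

Lemma spectral_measure_support : is_support P [set: Omega].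
Proof.
exists set0; split.
- exact: open0.
- apply/funext => x; apply: nrm_eq0; apply/eqP; rewrite -sqrf_eq0.
  by have := spmE2 ip_norm sP x measurable0; rewrite measure0 => -[<-].
- by move=> u; exact: open_null_empty.
- by rewrite setC0.
Qed.

Lemma spectral_measure_resolution : resolution_of_identity ip P.
Proof.
split=> //; [exact: hausdorff_Omega|exact: locally_compact_Omega|].
move=> x; apply: (inner_regular_Omega S_real S_closed (m := spm sP x)).
  by rewrite (spm_setT ip_norm) ltry.
by move=> w mw; rewrite spm_diag.
Qed.

(** Under Q the projection of {l <= t} is a cut of a at t, like the one under P. *)
Lemma spectral_measure_unique Q : spectral_measure ip Q ->
  pointwise_integral ip a Q (fun l : borel Omega => (coord l)%:C%C) ->
  forall w, measurable w -> Q w = P w.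
Proof.
move=> sQ pQ w mw.
have JQ := resolvent_of_pointwise ip_norm JP sQ mcoord ccoord pQ.
have QE t x : Q (sublevel bcoord t) x = P (sublevel bcoord t) x.
  rewrite PE; apply: family_uniq.
  exact: (cut_of_resolvent a_linear a_dense a_sa JP mcoord JQ).
have -> : w = coord @^-1` (uncoord @^-1` w).
  by apply/seteqP; split=> l; rewrite /preimage /= coordK.
exact: (spectral_measure_eq sQ sP mcoord QE (muncoord mw)).
Qed.

End Properties.
End OnSpectrum.
End SpectralTheorem.

Theorem theorem42p13 (R : realType) (H : completeNormedModType R[i])
    (ip : {dot H for Num.conj})
    (ip_norm : forall x : H, `|x| ^+ 2 = ip x x)
    (H_neq0 : exists x : H, x != 0)
    (a : operator H)
    (a_linear : linear_operator a)
    (a_dense : dense (dom a))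
    (a_sa : self_adjoint ip a) :
  spectrum a !=set0 /\
  forall l0 : spectrum a,
  let Omega : ptopologicalType := pointed_at l0 in
  let id_sp (l : borel Omega) : R[i] := set_val (l : spectrum a) in
  exists P : set (borel Omega) -> H -> H,
    [/\ resolution_of_identity ip P,
        pointwise_integral ip a P id_sp,
        forall Q : set (borel Omega) -> H -> H,
          resolution_of_identity ip Q -> pointwise_integral ip a Q id_sp ->
          forall w : set (borel Omega), measurable w -> Q w = P w,
        op_commutant a = measure_commutant P
      & is_support P [set: Omega]].
Proof.
split; first exact: (spectrum_nonempty ip_norm a_linear a_dense a_sa H_neq0).
move=> l0 Omega id_sp.
have S_real := @spectrum_real _ _ _ ip_norm _ a_linear a_dense a_sa.
have -> : id_sp = (fun l => (@coord R (spectrum a) l0 l)%:C%C).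
  by apply/funext => l; exact: (coordE S_real (l0 := l0)).
have [P [sP PE Pc]] := spectral_measure_ex ip_norm a_linear a_dense a_sa l0.
have [J JP] := resolvent_ex ip_norm a_linear a_dense a_sa (@Imi_neq0 R).
have mc := @measurable_coord _ _ l0; have cc := cmeasurable_coord S_real (l0 := l0).
exists P; split.
- exact: spectral_measure_resolution.
- exact: (pointwise_of_resolvent a_linear a_dense a_sa JP mc cc (resolvent_of_family JP sP mc PE)).
- by move=> Q [_ _ sQ _]; exact: (spectral_measure_unique sP PE JP sQ).
- apply/seteqP; split=> c; last exact: (commutant_of_measure_commutant sP PE JP).
  move=> ca; split=> [|w mw]; first by case: ca.
  by apply/funext => x; exact: Pc.
- exact: (spectral_measure_support sP PE JP).
Qed.
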